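(* The pointwise stabilizer of $\mathbb{A}$ in $G_{\mathbb{F}}$ is $T_{\mathbb{F}}(O)=A_{\mathbb{F}}(O)M_{\mathbb{F}}$.
   Context: Let $\mathbb{K},\mathbb{F}$ be real closed fields with $\mathbb{K}\subseteq\mathbb{R}\cap\mathbb{F}$. Let $O\subsetneq\mathbb{F}$ be an order convex subring ($a,b\in O$ and $a\le c\le b$ imply $c\in O$); it is a valuation ring. Let $\Lambda=\mathbb{F}^\times/O^\times$, written additively, and let $v:\mathbb{F}\to\Lambda\cup\{\infty\}$ be the associated valuation, with $\Lambda$ ordered so that $(-v)(a)\ge(-v)(b)$ whenever $a\ge b>0$; thus $O=\{a:(-v)(a)\le 0\}$. For a semialgebraic set $V$ defined over $\mathbb{K}$, $V_{\mathbb{F}}$ denotes its $\mathbb{F}$-extension. $G<\operatorname{SL}_n$ is a connected semisimple algebraic group over $\mathbb{K}$, self-adjoint ($g\in G$ implies $g^{\mathsf T}\in G$). $S<G$ is a maximal $\mathbb{K}$-split torus with $s=s^{\mathsf T}$ for all $s\in S$; $A_{\mathbb{F}}$ is the $\mathbb{F}$-extension of the semialgebraic connected component of $S_{\mathbb{K}}$ containing $\operatorname{Id}$; $K_{\mathbb{F}}=G_{\mathbb{F}}\cap\operatorname{SO}_n(\mathbb{F})$; $M_{\mathbb{F}}=\operatorname{Cen}_{K_{\mathbb{F}}}(A_{\mathbb{F}})$; $T_{\mathbb{F}}=\operatorname{Cen}_{G_{\mathbb{F}}}(A_{\mathbb{F}})$. For a subset $H_{\mathbb{F}}\subseteq G_{\mathbb{F}}$,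 $H_{\mathbb{F}}(O)=H_{\mathbb{F}}\cap O^{n\times n}$. Let $\mathfrak{a}=\operatorname{Lie}(A_{\mathbb{R}})$; $\Sigma\subseteq\mathfrak{a}^\star$ is the (possibly non-reduced) root system of $\operatorname{Lie}(G_{\mathbb{R}})$ with respect to $\mathfrak{a}$. For $\alpha\in\Sigma$, $\chi_\alpha:A_{\mathbb{F}}\to\mathbb{F}_{>0}$ is the restriction of the algebraic character of $S$ over $\mathbb{K}$ which over $\mathbb{R}$ satisfies $\chi_\alpha(\exp H)=e^{\alpha(H)}$, $H\in\mathfrak{a}$. Fix a basis $\Delta$ of $\Sigma$; let $A^+_{\mathbb{F}}=\{a\in A_{\mathbb{F}}:\chi_\alpha(a)\ge1\ \forall\alpha\in\Delta\}$. $G_{\mathbb{F}}$ acts on symmetric positive definite matrices of determinant $1$ over $\mathbb{F}$ by $g.x=gxg^{\mathsf T}$, and $\mathcal{X}_{\mathbb{F}}=G_{\mathbb{F}}.\operatorname{Id}$. For $x=g.\operatorname{Id}$, $y=h.\operatorname{Id}$, $\delta_{\mathbb{F}}(x,y)$ is the unique $a\in A^+_{\mathbb{F}}$ with $g^{-1}h\in K_{\mathbb{F}}aK_{\mathbb{F}}$. For $a\in A_{\mathbb{F}}$, $N_{\mathbb{F}}(a)=\prod_{\alpha\in\Sigma}\max\{\chi_\alpha(a),\chi_\alpha(a)^{-1}\}$, and $d(x,y)=(-v)(N_{\mathbb{F}}(\delta_{\mathbb{F}}(x,y)))\in\Lambda$, a $G_{\mathbb{F}}$-invariant pseudo-distance.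 $\mathcal{B}=\mathcal{X}_{\mathbb{F}}/\!\sim$ with $x\sim y$ iff $d(x,y)=0$, with the induced $G_{\mathbb{F}}$-action; $o\in\mathcal{B}$ is the class of $\operatorname{Id}$; $\mathbb{A}=A_{\mathbb{F}}.o\subseteq\mathcal{B}$. *)

(* Defs.v *)
From HB Require Import structures.
From mathcomp Require Import all_boot all_order all_algebra.
From mathcomp Require Import complex.
From mathcomp Require Import all_classical all_reals all_analysis.
(* The notations of mpoly clash with those of MathComp-Analysis. *)
From mathcomp Require Import (canonicals) mpoly.

Set Implicit Arguments.
Unset Strict Implicit.
Unset Printing Implicit Defensive.

Import Order.TTheory GRing.Theory Num.Theory.
Import numFieldNormedType.Exports.

Local Open Scope classical_set_scope.
Local Open Scope ring_scope.

(* Polynomials over E in the n * n entries of a matrix, in the order of mxvec. *)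
Definition mxpol (E : nzRingType) (n : nat) := mpoly.mpoly (n * n) E.

(* The polynomial p, with coefficients sent to L by f, at the entries of g. *)
Definition peval (E : nzRingType) (L : comNzRingType) (f : E -> L) (n : nat)
    (p : mxpol E n) (g : 'M[L]_n) : L :=
  mpoly.mmap f (fun k : 'I_(n * n) => mxvec g 0 k) p.

(** ** Algebraic groups *)

Definition zero_locus (E : nzRingType) (L : comNzRingType) (f : E -> L)
    (n : nat) (P : seq (mxpol E n)) : set 'M[L]_n :=
  [set g | forall p : mxpol E n, p \in P -> peval f p g = 0].

Definition zariski_closed (D : fieldType) (n : nat) (X : set 'M[D]_n) : Prop :=
  exists P : seq (mxpol D n), X = zero_locus idfun P.

Definition zariski_connected (D : fieldType) (n : nat) (X : set 'M[D]_n) :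
    Prop :=
  X !=set0 /\
  forall C1 C2 : set 'M[D]_n, zariski_closed C1 -> zariski_closed C2 ->
    X `<=` C1 `|` C2 -> X `&` C1 `&` C2 = set0 -> X `<=` C1 \/ X `<=` C2.

Definition mx_subgroup (D : fieldType) (n : nat) (X : set 'M[D]_n) : Prop :=
  [/\ X 1%:M,
      forall g, X g -> g \in unitmx,
      forall g h, X g -> X h -> X (g *m h) &
      forall g, X g -> X (invmx g)].

Definition mx_normal (D : fieldType) (n : nat) (N X : set 'M[D]_n) : Prop :=
  forall g h, X g -> N h -> N (g *m h *m invmx g).

Definition mx_solvable (D : fieldType) (n : nat) (X : set 'M[D]_n) : Prop :=
  exists (m : nat) (C : nat -> set 'M[D]_n),
    [/\ C 0%N = X, C m = [set 1%:M],
        forall k, mx_subgroup (C k),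
        forall k, C k.+1 `<=` C k &
        forall k g h, C k g -> C k h -> C k.+1 (g *m h *m invmx g *m invmx h)].

(* Trivial radical. *)
Definition semisimple (D : fieldType) (n : nat) (X : set 'M[D]_n) : Prop :=
  forall N : set 'M[D]_n, N `<=` X -> mx_subgroup N -> zariski_closed N ->
    zariski_connected N -> mx_normal N X -> mx_solvable N -> N = [set 1%:M].

(* The points over the algebraic closure K[i] of K of the closed set defined by
   P; "an algebraic group over K" is given by such equations P over K. *)
Definition geom_points (K : rcfType) (n : nat) (P : seq (mxpol K n)) :
    set 'M[K[i]]_n :=
  zero_locus (real_complex K) P.

Definition connected_semisimple_in_SL (K : rcfType) (n : nat)
    (PG : seq (mxpol K n)) : Prop :=
  [/\ mx_subgroup (geom_points PG),
      forall g, geom_points PG g -> \det g = 1,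
      zariski_connected (geom_points PG) &
      semisimple (geom_points PG)].

Definition self_adjoint (K : rcfType) (n : nat) (PG : seq (mxpol K n)) : Prop :=
  forall g, geom_points PG g -> geom_points PG g^T.

(* Connected, and diagonalizable by a matrix with entries in K. *)
Definition split_torus (K : rcfType) (n : nat) (PS : seq (mxpol K n)) : Prop :=
  [/\ mx_subgroup (geom_points PS),
      zariski_connected (geom_points PS) &
      exists2 h : 'M[K]_n, h \in unitmx &
        forall s, geom_points PS s ->
          is_diag_mx (map_mx (real_complex K) h *m s
                      *m invmx (map_mx (real_complex K) h))].

Definition maximal_split_torus (K : rcfType) (n : nat)
    (PS PG : seq (mxpol K n)) : Prop :=
  [/\ split_torus PS,
      geom_points PS `<=` geom_points PG &
      forall PS' : seq (mxpol K n), split_torus PS' ->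
        geom_points PS' `<=` geom_points PG ->
        geom_points PS `<=` geom_points PS' ->
        geom_points PS' = geom_points PS].

(** ** Semialgebraic sets over K and their extensions *)

(* A finite union of sets {p = 0 for p in c.1, 0 < q for q in c.2}. *)
Definition sa_data (K : rcfType) (n : nat) :=
  seq (seq (mxpol K n) * seq (mxpol K n)).

Definition sa_set (K F : rcfType) (f : K -> F) (n : nat) (D : sa_data K n) :
    set 'M[F]_n :=
  [set g | exists2 c, c \in D &
     (forall p, p \in c.1 -> peval f p g = 0) /\
     (forall q, q \in c.2 -> 0 < peval f q g)].

Definition semialgebraic (K : rcfType) (n : nat) (X : set 'M[K]_n) : Prop :=
  exists D : sa_data K n, X = sa_set idfun D.

(* The extension X_F of a semialgebraic set X over K; by the transfer principle
   it does not depend on the description D of X. *)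
Definition sa_ext (K F : rcfType) (f : K -> F) (n : nat) (X : set 'M[K]_n) :
    set 'M[F]_n :=
  [set g | exists2 D : sa_data K n, X = sa_set idfun D & sa_set f D g].

Definition sa_connected (K : rcfType) (n : nat) (X : set 'M[K]_n) : Prop :=
  forall C1 C2 : set 'M[K]_n, semialgebraic C1 -> semialgebraic C2 ->
    (exists2 Z, closed Z & C1 = X `&` Z) ->
    (exists2 Z, closed Z & C2 = X `&` Z) ->
    C1 `|` C2 = X -> C1 `&` C2 = set0 -> C1 = X \/ C2 = X.

Definition sa_component (K : rcfType) (n : nat) (X : set 'M[K]_n)
    (x : 'M[K]_n) : set 'M[K]_n :=
  [set y | exists C : set 'M[K]_n,
     [/\ semialgebraic C, sa_connected C, C `<=` X, C x & C y]].

Definition A_ext (K F : rcfType) (f : K -> F) (n : nat) (PS : seq (mxpol K n)) :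
    set 'M[F]_n :=
  sa_ext f (sa_component (zero_locus idfun PS) 1%:M).

(** ** Lie algebras and restricted roots *)

Definition expmx (R : realType) (n : nat) (X : 'M[R]_n) : 'M[R]_n :=
  \matrix_(i, j) limn (series (fun k => (k`!%:R)^-1 * (X ^+ k) i j)).

Definition lie_algebra (R : realType) (n : nat) (H : set 'M[R]_n) :
    set 'M[R]_n :=
  [set X | forall t : R, H (expmx (t *: X))].

(* Lie H as an element of {vspace _}; 0 is a dummy value for the case that
   Lie H is not a subspace. *)
Definition lie_vspace (R : realType) (n : nat) (H : set 'M[R]_n) :
    {vspace 'M[R]_n} :=
  xget 0%VS [set V : {vspace 'M[R]_n} | forall X, X \in V <-> lie_algebra H X].

Definition frak_a (K : rcfType) (R : realType) (iR : K -> R) (n : nat)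
    (PS : seq (mxpol K n)) : {vspace 'M[R]_n} :=
  lie_vspace (A_ext iR PS).

Definition dual_space (R : realType) (n : nat) (a : {vspace 'M[R]_n}) :=
  'Hom(subvs_of a, R^o).

Definition root_system (K : rcfType) (R : realType) (iR : K -> R) (n : nat)
    (PG PS : seq (mxpol K n)) : set (dual_space (frak_a iR PS)) :=
  [set alpha | alpha != 0 /\
     exists X : 'M[R]_n,
       [/\ X != 0, lie_algebra (zero_locus iR PG) X &
           forall H : subvs_of (frak_a iR PS),
             vsval H *m X - X *m vsval H = alpha H *: X]].

Arguments root_system {K R} iR {n} PG PS.

Definition root_basis (R : realType) (n : nat) (a : {vspace 'M[R]_n})
    (Sigma : set (dual_space a)) (Delta : seq (dual_space a)) : Prop :=
  [/\ basis_of {: dual_space a}%VS Delta,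
      forall alpha, alpha \in Delta -> Sigma alpha &
      forall beta, Sigma beta -> exists c : 'I_(size Delta) -> nat,
        beta = \sum_(i < size Delta) Delta`_i *+ c i \/
        beta = - \sum_(i < size Delta) Delta`_i *+ c i].

(* p defines a character of the algebraic group S which over the reals is
   exp H |-> e^(alpha H) on exp(Lie(A_R)). *)
Definition character_of (K : rcfType) (R : realType) (iR : K -> R) (n : nat)
    (PS : seq (mxpol K n)) (alpha : dual_space (frak_a iR PS))
    (p : mxpol K n) : Prop :=
  [/\ peval (real_complex K) p 1%:M = 1,
      forall s t, geom_points PS s -> geom_points PS t ->
        peval (real_complex K) p (s *m t) =
        peval (real_complex K) p s * peval (real_complex K) p t &
      forall H : subvs_of (frak_a iR PS),
        peval iR p (expmx (vsval H)) = expR (alpha H)].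

(* xget selects the common value at a of the polynomials defining the
   character (they agree on S). *)
Definition chi (K : rcfType) (R : realType) (F : rcfType) (iR : K -> R)
    (iF : K -> F) (n : nat) (PS : seq (mxpol K n))
    (alpha : dual_space (frak_a iR PS)) (a : 'M[F]_n) : F :=
  xget 0 [set c |
    exists2 p : mxpol K n, character_of alpha p & c = peval iF p a].

(** ** Subgroups of G_F *)

Section Subgroups.
Context (K F : rcfType) (iF : K -> F) (n : nat) (PG PS : seq (mxpol K n)).

Definition G_F : set 'M[F]_n := zero_locus iF PG.

Definition K_F : set 'M[F]_n :=
  [set g | [/\ G_F g, g *m g^T = 1%:M & \det g = 1]].

Definition centralizer_in (H A : set 'M[F]_n) : set 'M[F]_n :=
  [set g | H g /\ forall a, A a -> g *m a = a *m g].

Definition A_F : set 'M[F]_n := A_ext iF PS.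
Definition M_F : set 'M[F]_n := centralizer_in K_F A_F.
Definition T_F : set 'M[F]_n := centralizer_in G_F A_F.

Definition O_points (O : {pred F}) (H : set 'M[F]_n) : set 'M[F]_n :=
  [set g | H g /\ forall i j, g i j \in O].

End Subgroups.

(** ** The valuation *)

Definition convex_subring (F : rcfType) (O : {pred F}) : Prop :=
  [/\ GRing.subring_closed O,
      forall a b c, a \in O -> b \in O -> a <= c -> c <= b -> c \in O &
      exists x, x \notin O].

Definition O_units (F : rcfType) (O : {pred F}) : set F :=
  [set u | [/\ u != 0, u \in O & u^-1 \in O]].

(* An element of Lambda = F^* / O^* is a coset of O^*, as a subset of F^*; the
   neutral element of Lambda, written 0, is the coset of 1, and the element at
   infinity, v(0), is the set {0}.  coset_opp is the negation of Lambda. *)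
Definition val_coset (F : rcfType) (O : {pred F}) (a : F) : set F :=
  [set a * u | u in O_units O].

Definition coset_opp (F : rcfType) (C : set F) : set F := [set x^-1 | x in C].

Definition coset_zero (F : rcfType) (O : {pred F}) : set F := val_coset O 1.

(** ** The building *)

Section Building.
Context (K : rcfType) (R : realType) (F : rcfType) (iR : K -> R) (iF : K -> F).
Context (O : {pred F}) (n : nat) (PG PS : seq (mxpol K n)).
Context (Delta : seq (dual_space (frak_a iR PS))).

Definition A_plus : set 'M[F]_n :=
  [set a | A_F iF PS a /\ forall alpha, alpha \in Delta -> 1 <= chi iF alpha a].

Definition act_F (g x : 'M[F]_n) : 'M[F]_n := g *m x *m g^T.

Definition X_F : set 'M[F]_n := [set act_F g 1%:M | g in G_F iF PG].

(* For x and y in X_F, exactly one a satisfies the conditions (Cartan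
   decomposition); 1 is a dummy value elsewhere. *)
Definition delta_F (x y : 'M[F]_n) : 'M[F]_n :=
  xget 1%:M [set a | A_plus a /\
    exists g h k k' : 'M[F]_n,
      [/\ G_F iF PG g, G_F iF PG h, x = act_F g 1%:M & y = act_F h 1%:M] /\
      [/\ K_F iF PG k, K_F iF PG k' & invmx g *m h = k *m a *m k']].

Definition N_F (a : 'M[F]_n) : F :=
  \big[*%R/1]_(alpha \in root_system iR PG PS)
     Num.max (chi iF alpha a) (chi iF alpha a)^-1.

Definition dist_F (x y : 'M[F]_n) : set F :=
  coset_opp (val_coset O (N_F (delta_F x y))).

Definition bclass (x : 'M[F]_n) : set 'M[F]_n :=
  [set y | X_F y /\ dist_F x y = coset_zero O].

Definition building : set (set 'M[F]_n) := [set bclass x | x in X_F].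

(* The induced action: the class of x is sent to the class of g.x, which is the
   image of the class of x because dist_F is invariant. *)
Definition bact (g : 'M[F]_n) (p : set 'M[F]_n) : set 'M[F]_n := act_F g @` p.

Definition base_point : set 'M[F]_n := bclass 1%:M.

Definition apartment : set (set 'M[F]_n) :=
  [set bact a base_point | a in A_F iF PS].

Definition pointwise_stabilizer (Y : set (set 'M[F]_n)) : set 'M[F]_n :=
  [set g | G_F iF PG g /\ forall p, Y p -> bact g p = p].

End Building.

(* Main.v *)
(* Everything takes place on the set A of elements of the torus S all of whose
   diagonal coordinates d_i are positive: a path x^(1-t) y^t, available over the
   reals and transported by the transfer principle, shows that A is the component
   of the identity.  Maximality of S over K enters once: if g in G commutes with
   A, then q = g^T g is diagonalizable together with S, and the Zariski closure of
   <q, S> (a set of monomial equations, by independence of characters) is a split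
   torus, so q lies in A.  This is a first-order statement over K and passes to
   every real closed extension.

   Over the reals, maximizing tr(k X k^T H) over the compact group, where
   exp X = g g^T and H is inside the chamber, yields g = k a k' with a in the closed
   chamber; this passes to F.  Hence the base point is the set of matrices of X_F
   with entries in O: entries of a are bounded by products of chi_alpha(a), alpha
   simple, and those by N(a).  An element g fixing the apartment has
   a^-1 g a in O for all a in A; the ratios d_j / d_i that are not constant on A
   are unbounded, so g commutes with A.  Finally g = a m with a^2 = g^T g. *)
From HB Require Import structures.
From mathcomp Require Import all_boot all_order all_algebra.
From mathcomp Require Import complex.
From mathcomp Require Import all_classical all_reals all_analysis.
From mathcomp Require Import (canonicals) mpoly.
From mathcomp Require qe_rcf_th qe_rcf.
From mathcomp Require Import ring lra.
Require Import Defs.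

Set Implicit Arguments.
Unset Strict Implicit.
Unset Printing Implicit Defensive.

Import Order.TTheory GRing.Theory Num.Theory.
Import numFieldNormedType.Exports.

Local Open Scope classical_set_scope.
Local Open Scope ring_scope.

(** * Quantifier elimination commutes with extensions *)

(** In general no morphism links R and F; there are only the two out of K. Exponentials, compactness
    and paths live over R, the valuation over F, so whatever passes from R to F has to be a
    first-order sentence with parameters in K: proved over R, brought down to K, sent up to F.
    Maximality of S, which speaks of all lists of polynomials, and Lie algebras are not of this
    form. They enter the sentences through finite data only: the basis h over K that diagonalizes S,
    the pairs (i, j) for which d_i / d_j is a simple root, and a natural exponent M bounding
    coordinates by simple roots.

    In diagonal coordinates the equations of S or G are sums of monomials, and by independence of
    characters a point satisfies them once it satisfies the monomial relations of a semigroup that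
    does. New points arise in this way: real powers, values of cocharacters, g^T g. A basis of the
    saturated lattice of relations is known to hold only up to a finite order; connectedness removes
    that order for S, positivity of eigenvalues for g^T g. *)

Module QE.
Import qe_rcf_th qe_rcf.

Section MapFormula.
Variables (K L : realFieldType) (f : {rmorphism K -> L}).

Fixpoint map_term (t : term K) : term L :=
  match t with
  | Var i => Var _ i
  | Const x => Const (f x)
  | NatConst m => NatConst _ m
  | Add u v => Add (map_term u) (map_term v)
  | Opp u => Opp (map_term u)
  | NatMul u m => NatMul (map_term u) m
  | Mul u v => Mul (map_term u) (map_term v)
  | Exp u m => Exp (map_term u) m
  end.

Fixpoint map_form (p : formula K) : formula L :=
  match p with
  | Bool b => Bool b
  | Equal u v => Equal (map_term u) (map_term v)
  | Lt u v => Lt (map_term u) (map_term v)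
  | Le u v => Le (map_term u) (map_term v)
  | And p q => And (map_form p) (map_form q)
  | Or p q => Or (map_form p) (map_form q)
  | Implies p q => Implies (map_form p) (map_form q)
  | Not p => Not (map_form p)
  end.

Notation mt := map_term.
Notation mp := (map map_term).
Notation mps := (map (map map_term)).
Notation mf := map_form.

(** The formula transformers are in continuation-passing style: they branch on coefficients and hand
    each outcome to [k]. Hence every lemma of this kind assumes that the extension of coefficients
    commutes with the continuation. *)
Lemma map_Size p k k' : (forall m, mf (k m) = k' m) ->
  mf (Size p k) = Size (mp p) k'.
Proof.
elim: p k k' => [|c q IH] k k' kk' /=; first exact: kk'.
by apply: IH => -[|m] //=; rewrite /If /= !kk'.
Qed.

Lemma map_Isnull p k k' : (forall m, mf (k m) = k' m) ->
  mf (Isnull p k) = Isnull (mp p) k'.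
Proof. by move=> kk'; apply: map_Size. Qed.

Lemma map_LeadCoef p k k' : (forall t, mf (k t) = k' (mt t)) ->
  mf (LeadCoef p k) = LeadCoef (mp p) k'.
Proof.
elim: p k k' => [|c q IH] k k' kk' /=; first by rewrite kk' /= rmorph0.
by apply: IH => t; rewrite /If /= !kk'.
Qed.

Lemma map_AmulXn a m : mp (AmulXn a m) = AmulXn (mt a) m.
Proof. by elim: m => //= m ->; rewrite rmorph0. Qed.

Lemma map_AddPoly p q : mp (AddPoly p q) = AddPoly (mp p) (mp q).
Proof. by elim: p q => [|a p IH] [|b q] //=; rewrite IH. Qed.

Lemma map_ScalPoly c p : mp (ScalPoly c p) = ScalPoly (mt c) (mp p).
Proof. by rewrite /ScalPoly -!map_comp. Qed.

Lemma map_MulPoly p q : mp (MulPoly p q) = MulPoly (mp p) (mp q).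
Proof. by elim: p q => [|a p IH] q //=; rewrite map_AddPoly map_ScalPoly /= IH. Qed.

Lemma map_ExpPoly p m : mp (ExpPoly p m) = ExpPoly (mp p) m.
Proof.
rewrite /ExpPoly; case: m => //= m.
elim: m => //= m IH.
by rewrite map_MulPoly IH.
Qed.

Lemma map_OppPoly p : mp (OppPoly p) = OppPoly (mp p).
Proof. by rewrite /OppPoly map_ScalPoly /= rmorphN1. Qed.

Lemma map_NatMulPoly m p : mp (NatMulPoly m p) = NatMulPoly m (mp p).
Proof. by rewrite /NatMulPoly map_ScalPoly. Qed.

Lemma map_Deriv p : mp (Deriv p) = Deriv (mp p).
Proof. by elim: p => //= a p IH; rewrite map_AddPoly /= IH. Qed.

Definition map_poly := (map_AmulXn, map_AddPoly, map_ScalPoly, map_MulPoly,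
  map_ExpPoly, map_OppPoly, map_NatMulPoly, map_Deriv).

Lemma map_Rediv_rec_loop q sq cq c qq r m k k' :
  (forall c a b, mf (k (c, a, b)) = k' (c, mp a, mp b)) ->
  mf (Rediv_rec_loop q sq cq c qq r m k) =
  Rediv_rec_loop (mp q) sq (mt cq) c (mp qq) (mp r) m k'.
Proof.
move=> kk'; elim: m c qq r => [|m IH] c qq r /=.
  apply: map_Size => s; case: ifP => _; first exact: kk'.
  by apply: map_LeadCoef => t; rewrite kk' !map_poly.
apply: map_Size => s; case: ifP => _; first exact: kk'.
by apply: map_LeadCoef => t; rewrite IH !map_poly.
Qed.

Lemma map_Rediv p q k k' :
  (forall c a b, mf (k (c, a, b)) = k' (c, mp a, mp b)) ->
  mf (Rediv p q k) = Rediv (mp p) (mp q) k'.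
Proof.
move=> kk'; apply: map_Isnull => -[]; first by rewrite kk' /= rmorph0.
apply: map_Size => sq; apply: map_Size => sp; apply: map_LeadCoef => t.
by rewrite (map_Rediv_rec_loop _ _ _ _ _ _ _ kk') /= rmorph0.
Qed.

Lemma map_Rmod p q k k' : (forall a, mf (k a) = k' (mp a)) ->
  mf (Rmod p q k) = Rmod (mp p) (mp q) k'.
Proof. by move=> kk'; apply: map_Rediv => c a b; apply: kk'. Qed.

Lemma map_Rscal p q k k' : (forall a, mf (k a) = k' a) ->
  mf (Rscal p q k) = Rscal (mp p) (mp q) k'.
Proof. by move=> kk'; apply: map_Rediv => c a b; apply: kk'. Qed.

Lemma map_Rgcd_loop m p q k k' : (forall a, mf (k a) = k' (mp a)) ->
  mf (Rgcd_loop m p q k) = Rgcd_loop m (mp p) (mp q) k'.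
Proof.
move=> kk'; elim: m p q => [|m IH] p q /=.
  by apply: map_Rmod => r; apply: map_Isnull => -[].
by apply: map_Rmod => r; apply: map_Isnull => -[].
Qed.

Lemma map_Rgcd p q k k' : (forall a, mf (k a) = k' (mp a)) ->
  mf (Rgcd p q k) = Rgcd (mp p) (mp q) k'.
Proof.
move=> kk'; apply: map_Size => sp; apply: map_Size => sq.
case: ifP => _; apply: map_Isnull => -[] //;
  by apply: map_Size => s; apply: map_Rgcd_loop.
Qed.

Lemma map_BigRgcd ps k k' : (forall a, mf (k a) = k' (mp a)) ->
  mf (BigRgcd ps k) = BigRgcd (mps ps) k'.
Proof.
elim: ps k k' => [|p ps IH] k k' kk' /=; first by rewrite kk' /= rmorph0.
by apply: IH => r; apply: map_Rgcd.
Qed.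

Lemma map_Changes s k k' : (forall a, mf (k a) = k' a) ->
  mf (Changes s k) = Changes (mp s) k'.
Proof.
elim: s k k' => [|a s IH] k k' kk' /=; first exact: kk'.
apply: IH => v; rewrite /If /= !kk'.
by case: s => //=; rewrite ?rmorph0.
Qed.

Lemma map_SeqPInfty ps k k' : (forall a, mf (k a) = k' (mp a)) ->
  mf (SeqPInfty ps k) = SeqPInfty (mps ps) k'.
Proof.
elim: ps k k' => [|p ps IH] k k' kk' /=; first exact: kk'.
by apply: map_LeadCoef => t; apply: IH => a; rewrite kk'.
Qed.

Lemma map_SeqMInfty ps k k' : (forall a, mf (k a) = k' (mp a)) ->
  mf (SeqMInfty ps k) = SeqMInfty (mps ps) k'.
Proof.
elim: ps k k' => [|p ps IH] k k' kk' /=; first exact: kk'.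
apply: map_LeadCoef => t; apply: map_Size => s.
by apply: IH => a; rewrite kk' /= rmorphN1.
Qed.

Lemma map_ChangesPoly ps k k' : (forall a, mf (k a) = k' a) ->
  mf (ChangesPoly ps k) = ChangesPoly (mps ps) k'.
Proof.
move=> kk'; apply: map_SeqMInfty => a; apply: map_SeqPInfty => b.
by apply: map_Changes => u; apply: map_Changes => v; rewrite kk'.
Qed.

Lemma map_NextMod p q k k' : (forall a, mf (k a) = k' (mp a)) ->
  mf (NextMod p q k) = NextMod (mp p) (mp q) k'.
Proof.
move=> kk'; apply: map_LeadCoef => t; apply: map_Rscal => s.
by apply: map_Rmod => r; rewrite kk' map_ScalPoly.
Qed.

Lemma map_ModsAux p q m k k' : (forall a, mf (k a) = k' (mps a)) ->
  mf (ModsAux p q m k) = ModsAux (mp p) (mp q) m k'.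
Proof.
elim: m p q k k' => [|m IH] p q k k' kk' /=; first exact: kk'.
apply: map_Isnull => -[]; first exact: kk'.
by apply: map_NextMod => r; apply: IH => ps; rewrite kk'.
Qed.

Lemma map_Mods p q k k' : (forall a, mf (k a) = k' (mps a)) ->
  mf (Mods p q k) = Mods (mp p) (mp q) k'.
Proof.
by move=> kk'; apply: map_Size => s; apply: map_Size => s'; apply: map_ModsAux.
Qed.

Lemma map_PolyComb sq sc : mp (PolyComb sq sc) = PolyComb (mps sq) sc.
Proof.
rewrite /PolyComb size_map.
elim: (iota 0 (size sq)) => //= i s IH.
rewrite map_MulPoly IH map_ExpPoly; congr (MulPoly (ExpPoly _ _) _).
by elim: sq i {IH} => [|q sq IH] [|i] //=.
Qed.

Lemma map_Pcq sq i : mp (Pcq sq i) = Pcq (mps sq) i.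
Proof.
rewrite /Pcq size_map.
elim: (sg_tab _) i => [|sc s IH] [|i] //=.
by rewrite map_PolyComb.
Qed.

Lemma map_TaqsR p sq i k k' : (forall a, mf (k a) = k' (mt a)) ->
  mf (TaqsR p sq i k) = TaqsR (mp p) (mps sq) i k'.
Proof.
move=> kk'; rewrite /TaqsR /TaqR /bind_def.
rewrite -map_Pcq -map_Deriv -map_MulPoly; apply: map_Mods => r.
by apply: map_ChangesPoly => z; rewrite kk' /= rmorph_int.
Qed.

(** The coefficients are entries of the inverse of an integer matrix, and matrix inversion commutes
    with field morphisms. *)
Lemma map_coefs m i : f (coefs K m i) = coefs L m i.
Proof.
rewrite /coefs.
have [lt|ge] := ltnP i (3 ^ m); last first.
  by rewrite !nth_default ?rmorph0 // size_map size_enum_ord.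
have i0 : 'I_(3 ^ m) by exact: Ordinal lt.
rewrite !(nth_map i0) -?enumT ?size_enum_ord //; set j := nth _ _ _.
rewrite !castmxE /=.
have -> : map_mx intr (ctmat m) = map_mx f (map_mx intr (ctmat m)) :> 'M[L]__.
  by apply/matrixP => a b; rewrite !mxE rmorph_int.
by rewrite -map_invmx mxE.
Qed.

Lemma map_Coefs m i : mt (Coefs K m i) = Coefs L m i.
Proof.
congr Const; case: m => [|[|m]]; [exact: rmorph_nat| |exact: map_coefs].
by move: i => [|[|[|[|i]]]] /=; rewrite ?fmorphV ?rmorphD ?rmorph1 ?rmorph0.
Qed.

Lemma map_CcountWeak p sq k k' : (forall a, mf (k a) = k' (mt a)) ->
  mf (CcountWeak p sq k) = CcountWeak (mp p) (mps sq) k'.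
Proof.
move=> kk'; rewrite /CcountWeak size_map.
(* The running sum grows in the recursion, so its initial value 0 is generalized together with its
   image. *)
have : mt (NatConst K 0) = NatConst L 0 by [].
move: (NatConst K 0) (NatConst L 0) => s s' <- {s'}.
elim: (3 ^ size sq)%N s => [|m IH] s; first exact: kk'.
by apply: map_TaqsR => a; rewrite IH -map_Coefs.
Qed.

Lemma map_BoundingPoly sq : mp (BoundingPoly sq) = BoundingPoly (mps sq).
Proof.
rewrite /BoundingPoly map_Deriv; congr Deriv.
by elim: sq => //= q sq IH; rewrite map_MulPoly IH.
Qed.

Lemma map_CcountGt0 sp sq :
  mf (CcountGt0 sp sq) = CcountGt0 (mps sp) (mps sq).
Proof.
apply: map_BigRgcd => p; apply: map_Isnull => -[] /=; last first.
  by apply: map_CcountWeak.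
rewrite -map_BoundingPoly; apply: map_CcountWeak => a /=.
congr (Or _ (Or _ _)).
  elim: sq => //= q sq ->; congr And.
  exact: map_LeadCoef.
elim: sq => //= q sq ->; congr And.
by apply: map_Size => s; apply: map_LeadCoef.
Qed.

Lemma map_abstrX i t : mp (abstrX i t) = abstrX i (mt t).
Proof.
elim: t => //=.
- by move=> m; case: ifP.
- by move=> u IHu v IHv; rewrite map_AddPoly IHu IHv.
- by move=> u IHu; rewrite map_OppPoly IHu.
- by move=> u IHu m; rewrite map_NatMulPoly IHu.
- by move=> u IHu v IHv; rewrite map_MulPoly IHu IHv.
- by move=> u IHu m; rewrite map_ExpPoly IHu.
Qed.

End MapFormula.

(** * Properties with a quantifier-free definition uniform in the extension *)

Definition clause (K : Type) := (seq (term K) * seq (term K))%type.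

Definition eval_clause (L : realDomainType) (e : seq L) (c : clause L) : bool :=
  all (fun t => eval e t == 0) c.1 && all (fun t => 0 < eval e t) c.2.

Definition map_clause (K L : realFieldType) (f : {rmorphism K -> L})
    (c : clause K) : clause L :=
  (map (map_term f) c.1, map (map_term f) c.2).

(** One list of clauses over K has to serve all extensions L at once; transfer rests on this
    uniformity. *)
Definition qfdef (K : rcfType)
    (P : forall L : rcfType, {rmorphism K -> L} -> seq L -> Prop) : Prop :=
  exists D : seq (clause K), forall (L : rcfType) (f : {rmorphism K -> L}) e,
    P L f e <-> has (eval_clause e) (map (map_clause f) D).

Section QFDef.
Variable K : rcfType.
Implicit Types P Q : forall L : rcfType, {rmorphism K -> L} -> seq L -> Prop.

Lemma qfdef_ext P Q : (forall L f e, P L f e <-> Q L f e) -> qfdef P -> qfdef Q.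
Proof. by move=> PQ [D HD]; exists D => L f e; rewrite -PQ. Qed.

Lemma qfdef_or P Q : qfdef P -> qfdef Q ->
  qfdef (fun L f e => P L f e \/ Q L f e).
Proof.
move=> [D HD] [D' HD']; exists (D ++ D') => L f e.
by rewrite map_cat has_cat HD HD'; split => [/orP|/orP].
Qed.

Lemma qfdef_and P Q : qfdef P -> qfdef Q ->
  qfdef (fun L f e => P L f e /\ Q L f e).
Proof.
move=> [D HD] [D' HD'].
exists [seq (c.1 ++ c'.1, c.2 ++ c'.2) | c <- D, c' <- D'] => L f e.
rewrite HD HD'; set ev := eval_clause e; set mc := map_clause f.
suff -> : has ev (map mc [seq (c.1 ++ c'.1, c.2 ++ c'.2) | c <- D, c' <- D']) =
    has ev (map mc D) && has ev (map mc D').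
  by split => /andP.
elim: D {HD} => //= c D IH.
rewrite map_cat has_cat IH andb_orl; congr (_ || _).
elim: D' {IH HD'} => [|c' D' /= ->] /=; first by rewrite andbF.
rewrite andb_orr; congr (_ || _).
rewrite /ev /mc /map_clause /eval_clause /= !map_cat !all_cat.
by rewrite !andbA; congr (_ && _); rewrite andbAC.
Qed.

Lemma qfdef_bool (b : bool) : @qfdef K (fun L f e => b).
Proof.
exists (if b then [:: ([::], [::])] else [::]) => L f e.
by case: b.
Qed.

Lemma qfdef_eq0 (t : term K) : qfdef (fun L f e => eval e (map_term f t) = 0).
Proof.
exists [:: ([:: t], [::])] => L f e.
by rewrite /= orbF /eval_clause /= !andbT; split => /eqP.
Qed.

Lemma qfdef_gt0 (t : term K) : qfdef (fun L f e => 0 < eval e (map_term f t)).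
Proof. by exists [:: ([::], [:: t])] => L f e; rewrite /= orbF /eval_clause /= !andbT. Qed.

Lemma qfdef_not P : qfdef P -> qfdef (fun L f e => ~ P L f e).
Proof.
move=> [D HD].
suff: qfdef (fun L f e => ~ has (eval_clause e) (map (map_clause f) D)).
  by apply: qfdef_ext => L f e; rewrite HD.
elim: D {HD P} => [|[sp sq] D IH] /=.
  by apply: qfdef_ext (qfdef_bool true) => L f e; split.
apply: (@qfdef_ext (fun L f e =>
    ~ eval_clause e (map_clause f (sp, sq)) /\
    ~ has (eval_clause e) (map (map_clause f) D))).
  move=> L f e; split => [[/negP h1 /negP h2]|/negP].
    by apply/negP; rewrite negb_or h1.
  by rewrite negb_or => /andP[/negP h1 /negP h2].
apply: qfdef_and => // {IH}.
apply: (@qfdef_ext (fun L f e =>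
    ~ all (fun t => eval e t == 0) (map (map_term f) sp) \/
    ~ all (fun t => 0 < eval e t) (map (map_term f) sq))).
  move=> L f e; rewrite /eval_clause /=; split.
    by move=> [/negP/negbTE->|/negP/negbTE->]; rewrite ?andbF.
  by move=> /negP; rewrite negb_and => /orP[/negP|/negP]; [left|right].
apply: qfdef_or.
  elim: sp => [|t sp IH] /=.
    by apply: qfdef_ext (qfdef_bool false) => L f e; split.
  (* Clauses contain only equalities to 0 and strict positivity, so a nonzero t is split into the
     cases t > 0 and - t > 0. *)
  apply: (@qfdef_ext (fun L f e =>
     (0 < eval e (map_term f t) \/ 0 < eval e (map_term f (Opp t))) \/
     ~ all (fun t => eval e t == 0) (map (map_term f) sp))).
    move=> L f e /=; rewrite oppr_gt0; split.
      move=> [h|/negP/negbTE->]; last by rewrite andbF.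
      have -> : (eval e (map_term f t) == 0) = false; last by [].
      by apply/negbTE; rewrite neq_lt; case: h => ->; rewrite ?orbT.
    move=> /negP; rewrite negb_and neq_lt => /orP[/orP[h|h]|/negP].
    - by left; right.
    - by left; left.
    - by right.
  by apply: qfdef_or => //; apply: qfdef_or; apply: qfdef_gt0.
elim: sq => [|t sq IH] /=.
  by apply: qfdef_ext (qfdef_bool false) => L f e; split.
apply: (@qfdef_ext (fun L f e =>
   (eval e (map_term f t) = 0 \/ 0 < eval e (map_term f (Opp t))) \/
   ~ all (fun t => 0 < eval e t) (map (map_term f) sq))).
  move=> L f e /=; rewrite oppr_gt0; split.
    move=> [h|/negP/negbTE->]; last by rewrite andbF.
    have -> : (0 < eval e (map_term f t)) = false; last by [].
    by apply/negbTE; rewrite -leNgt; case: h => [->//|/ltW].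
  move=> /negP; rewrite negb_and -leNgt le_eqVlt.
  move=> /orP[/orP[/eqP h|h]|/negP].
  - by left; left.
  - by left; right.
  - by right.
by apply: qfdef_or => //; apply: qfdef_or; [apply: qfdef_eq0|apply: qfdef_gt0].
Qed.

Lemma qfdef_form (p : formula K) :
  qfdef (fun L f e => qf_eval e (map_form f p)).
Proof.
elim: p => /=.
- exact: qfdef_bool.
- move=> u v; apply: qfdef_ext (qfdef_eq0 (Add u (Opp v))) => L f e /=.
  by split => [/eqP|/eqP h]; [rewrite subr_eq0|rewrite h subrr].
- move=> u v; apply: qfdef_ext (qfdef_gt0 (Add v (Opp u))) => L f e /=.
  by rewrite subr_gt0.
- move=> u v; apply: qfdef_ext (qfdef_not (qfdef_gt0 (Add u (Opp v)))) => L f e /=.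
  by rewrite subr_gt0 leNgt; split => /negP.
- move=> p IHp q IHq; apply: qfdef_ext (qfdef_and IHp IHq) => L f e.
  by split => /andP.
- move=> p IHp q IHq; apply: qfdef_ext (qfdef_or IHp IHq) => L f e.
  by split => /orP.
- move=> p IHp q IHq; apply: qfdef_ext (qfdef_or (qfdef_not IHp) IHq) => L f e.
  split; first by case=> [/negP/negbTE->//|->]; rewrite implybT.
  by case: (qf_eval e (map_form f p)) => /=; [right|left].
- move=> p IHp; apply: qfdef_ext (qfdef_not IHp) => L f e.
  by split => /negP.
Qed.

(** For a single clause the existence of x is decided by [CcountGt0], a root count for polynomials
    in x whose coefficients are terms. By [map_CcountGt0] its formula over L is the image of the one
    over K, which keeps the definition uniform. *)
Lemma qfdef_ex (i : nat) P : qfdef P ->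
  qfdef (fun L f e => exists x : L, P L f (set_nth 0 e i x)).
Proof.
move=> [D HD].
suff: qfdef (fun L f e => exists x : L,
    has (eval_clause (set_nth 0 e i x)) (map (map_clause f) D)).
  by apply: qfdef_ext => L f e; split=> -[x hx]; exists x; move: hx; rewrite HD.
elim: D {HD P} => [|[sp sq] D IH] /=.
  by apply: qfdef_ext (qfdef_bool false) => L f e; split => // -[].
have := qfdef_or (qfdef_form (CcountGt0 (map (abstrX i) sp) (map (abstrX i) sq))) IH.
apply: qfdef_ext => L f e; rewrite map_CcountGt0 eval_CcountGt0.
set b := ccount_gt0 _ _.
suff -> : b <-> exists x : L, eval_clause (set_nth 0 e i x) (map_clause f (sp, sq)).
  split; first by move=> [[x hx]|[x hx]]; exists x; rewrite hx ?orbT.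
  by move=> [x /orP[]]; [left|right]; exists x.
suff E x : eval_clause (set_nth 0 e i x) (map_clause f (sp, sq)) =
    \big[andb/true]_(p <- map (eval_poly e) (map (map (map_term f)) (map (abstrX i) sp))) (p.[x] == 0) &&
    \big[andb/true]_(q <- map (eval_poly e) (map (map (map_term f)) (map (abstrX i) sq))) (q.[x] > 0).
  by split=> [/ccount_gt0P[x hx]|[x hx]];
    [exists x; rewrite E|apply/ccount_gt0P; exists x; rewrite -E].
rewrite /eval_clause !big_all !all_map /=.
congr andb; apply: eq_all => t /=; by rewrite map_abstrX abstrXP.
Qed.

End QFDef.
End QE.

(** * Transfer for statements about matrices *)

(* Variables are named, with one sort of names for matrices and one for scalars. *)
Section Language.
Variables (E : Type) (n : nat).

(** [MAdj] replaces the inverse, which is not polynomial; on matrices of determinant 1 the two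
    agree. *)
Inductive mterm :=
| MVar of nat
| MCst of 'M[E]_n
| MMul of mterm & mterm
| MTr of mterm
| MAdj of mterm.

End Language.

Inductive sterm (E : nzRingType) (n : nat) :=
| SVar of nat
| SCst of E
| SEnt of mterm E n & 'I_n & 'I_n
| SAdd of sterm E n & sterm E n
| SOpp of sterm E n
| SMul of sterm E n & sterm E n
| SDet of mterm E n
| SPol of mxpol E n & mterm E n.

(** [FConj] ranges over a list of the metatheory, so that lists of equations, indices and pairs of
    indices need no coding inside the language. *)
Inductive mform (E : nzRingType) (n : nat) :=
| FLt of sterm E n & sterm E n
| FEq of sterm E n & sterm E n
| FEqM of mterm E n & mterm E n
| FNot of mform E n
| FAnd of mform E n & mform E n
| FOr of mform E n & mform E n
| FImp of mform E n & mform E n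
| FConj (I : eqType) of seq I & (I -> mform E n)
| FExM of nat & mform E n
| FAllM of nat & mform E n
| FExS of nat & mform E n
| FAllS of nat & mform E n.

Arguments SVar {E n}.

Definition upd (T : Type) (r : nat -> T) (b : nat) (x : T) : nat -> T :=
  fun c => if eqn c b then x else r c.

Section Semantics.
Variables (E : nzRingType) (n : nat).

Section Terms.
Variables (L : comNzRingType) (f : E -> L).

Fixpoint mval (r : nat -> 'M[L]_n) (t : mterm E n) : 'M[L]_n :=
  match t with
  | MVar b => r b
  | MCst A => map_mx f A
  | MMul u v => mval r u *m mval r v
  | MTr u => (mval r u)^T
  | MAdj u => \adj (mval r u)
  end.

Fixpoint sval_ (r : nat -> 'M[L]_n) (s : nat -> L) (t : sterm E n) : L :=
  match t with
  | SVar c => s c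
  | SCst x => f x
  | SEnt u i j => mval r u i j
  | SAdd u v => sval_ r s u + sval_ r s v
  | SOpp u => - sval_ r s u
  | SMul u v => sval_ r s u * sval_ r s v
  | SDet u => \det (mval r u)
  | SPol p u => peval f p (mval r u)
  end.

End Terms.

Fixpoint fsem (L : rcfType) (f : E -> L) (r : nat -> 'M[L]_n) (s : nat -> L)
    (p : mform E n) : Prop :=
  match p with
  | FLt u v => sval_ f r s u < sval_ f r s v
  | FEq u v => sval_ f r s u = sval_ f r s v
  | FEqM u v => mval f r u = mval f r v
  | FNot p => ~ fsem f r s p
  | FAnd p q => fsem f r s p /\ fsem f r s q
  | FOr p q => fsem f r s p \/ fsem f r s q
  | FImp p q => fsem f r s p -> fsem f r s q
  | FConj _ l p => forall i, i \in l -> fsem f r s (p i)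
  | FExM b p => exists M, fsem f (upd r b M) s p
  | FAllM b p => forall M, fsem f (upd r b M) s p
  | FExS c p => exists x, fsem f r (upd s c x) p
  | FAllS c p => forall x, fsem f r (upd s c x) p
  end.

End Semantics.

Section Encoding.
Variable n : nat.

(** Quantifier elimination works with lists of scalars; pickling a disjoint sum gives each matrix
    entry and each scalar variable a position of its own. *)
Definition mpos (b : nat) (i j : 'I_n) : nat :=
  pickle (inl (b, (i, j)) : nat * ('I_n * 'I_n) + nat)%type.
Definition spos (c : nat) : nat :=
  pickle (inr c : nat * ('I_n * 'I_n) + nat)%type.

Lemma mpos_inj b b' i i' j j' : mpos b i j = mpos b' i' j' ->
  [/\ b = b', i = i' & j = j'].
Proof. by move/(pcan_inj (@pickleK _)) => -[-> -> ->]. Qed.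

Lemma spos_inj c c' : spos c = spos c' -> c = c'.
Proof. by move/(pcan_inj (@pickleK _)) => -[->]. Qed.

Lemma mpos_spos b i j c : mpos b i j <> spos c.
Proof. by move/(pcan_inj (@pickleK _)). Qed.

Definition menv (L : nzRingType) (e : seq L) (b : nat) : 'M[L]_n :=
  \matrix_(i, j) e`_(mpos b i j).
Definition senv (L : nzRingType) (e : seq L) (c : nat) : L := e`_(spos c).

Lemma exists_seq (L : nzRingType) (N : nat) (g : nat -> L) :
  (forall j, (N <= j)%N -> g j = 0) -> exists e : seq L, forall j, e`_j = g j.
Proof.
move=> gN; exists (mkseq g N) => j.
have [lt|ge] := ltnP j N; first by rewrite nth_mkseq.
by rewrite nth_default ?size_mkseq ?gN.
Qed.

Definition mblock (b : nat) : seq nat := [seq mpos b p.1 p.2 | p : 'I_n * 'I_n].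

Lemma mblockP b i j : mpos b i j \in mblock b.
Proof. by apply/fintype.imageP; exists (i, j). Qed.

(** Beyond the old list and the block of b all values are 0, so a finite list realizes the update.
    Together with [menv_agree] this turns a quantifier over matrices into one over finitely many
    scalars. *)
Lemma exists_menv (L : nzRingType) (e : seq L) b (M : 'M[L]_n) :
  exists2 e', (forall j, j \notin mblock b -> e'`_j = e`_j) &
    menv e' = upd (menv e) b M /\ senv e' = senv e.
Proof.
pose g j := if [pick p : 'I_n * 'I_n | mpos b p.1 p.2 == j] is Some p
  then M p.1 p.2 else e`_j.
have gM i j : g (mpos b i j) = M i j.
  rewrite /g; case: pickP => [[i' j'] /eqP /=|/(_ (i, j))]; last by rewrite eqxx.
  by move=> /mpos_inj[_ -> ->].
have gE j : j \notin mblock b -> g j = e`_j.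
  move=> jb; rewrite /g; case: pickP => [[i' j'] /= /eqP E|//].
  by move: jb; rewrite -E mblockP.
have [e' He'] : exists e' : seq L, forall j, e'`_j = g j.
  apply: (@exists_seq _ (size e + \max_(j <- mblock b) j.+1)) => j Hj.
  rewrite gE ?nth_default //; first exact: leq_trans (leq_addr _ _) Hj.
  apply/negP => jb; have := @leq_bigmax_seq _ _ xpredT succn j jb isT.
  by rewrite leqNgt ltnS (leq_trans (leq_addl _ _) Hj).
exists e'; first by move=> j jb; rewrite He' gE.
split; apply/funext => c.
  apply/matrixP => i j; rewrite mxE He' /upd.
  have [->|cb] := eqVneq c b; first by rewrite eqnE eqxx gM.
  rewrite eqnE (negbTE cb) gE ?mxE //; apply/fintype.imageP => -[[i' j'] _ /= /mpos_inj[E]].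
  by rewrite E eqxx in cb.
by rewrite /senv He' gE //; apply/fintype.imageP => -[[i' j'] _ /= /esym/mpos_spos].
Qed.

Lemma exists_senv (L : nzRingType) (e : seq L) c (x : L) :
  exists2 e', (forall j, j \notin [:: spos c] -> e'`_j = e`_j) &
    menv e' = menv e /\ senv e' = upd (senv e) c x.
Proof.
exists (set_nth 0 e (spos c) x) => [j|].
  by rewrite inE nth_set_nth /= => /negbTE->.
split; apply/funext => b.
  apply/matrixP => i j; rewrite !mxE nth_set_nth /=.
  by case: eqP => // /mpos_spos.
rewrite /senv nth_set_nth /= /upd eqnE; have [->|bc] := eqVneq b c.
  by rewrite eqxx.
by case: eqP => // /spos_inj /eqP; rewrite (negbTE bc).
Qed.

Lemma menv_agree (L : nzRingType) (e e' : seq L) b :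
  (forall j, j \notin mblock b -> e'`_j = e`_j) ->
  menv e' = upd (menv e) b (menv e' b) /\ senv e' = senv e.
Proof.
move=> H; split; apply/funext => c.
  apply/matrixP => i j; rewrite /upd eqnE; case: eqP => [->//|cb].
  by rewrite !mxE H //; apply/fintype.imageP => -[[i' j'] _ /= /mpos_inj[]].
by rewrite /senv H //; apply/fintype.imageP => -[[i' j'] _ /= /esym/mpos_spos].
Qed.

Lemma senv_agree (L : nzRingType) (e e' : seq L) c :
  (forall j, j \notin [:: spos c] -> e'`_j = e`_j) ->
  menv e' = menv e /\ senv e' = upd (senv e) c (senv e' c).
Proof.
move=> H; split; apply/funext => b.
  apply/matrixP => i j; rewrite !mxE H // inE; apply/eqP; exact: mpos_spos.
rewrite /upd eqnE; case: eqP => [->//|bc].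
by rewrite /senv H // inE; apply/eqP => /spos_inj.
Qed.

End Encoding.

Module MQE.
Import qe_rcf QE.

Lemma eval_nth (L : realDomainType) (e e' : seq L) (t : term L) :
  (forall j, e`_j = e'`_j) -> eval e t = eval e' t.
Proof.
move=> ee; elim: t => //= [u -> v ->|u ->|u -> m|u -> v ->|u -> m] //.
Qed.

Lemma eval_clause_nth (L : realDomainType) (e e' : seq L) (c : clause L) :
  (forall j, e`_j = e'`_j) -> eval_clause e c = eval_clause e' c.
Proof.
by move=> ee; rewrite /eval_clause; congr (_ && _); apply: eq_all => t;
  rewrite (eval_nth t ee).
Qed.

Section PolFam.
Variable K : rcfType.

(** The counterpart of [qfdef] for scalars: one polynomial term over K computes the value in every
    extension. *)
Definition polfam (t : forall L : rcfType, {rmorphism K -> L} -> seq L -> L) :=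
  exists t0 : term K, forall L f e, t L f e = eval e (map_term f t0).

Lemma polfam_ext t u : (forall L f e, t L f e = u L f e) -> polfam t -> polfam u.
Proof. by move=> tu [t0 H]; exists t0 => L f e; rewrite -tu. Qed.

Lemma polfam_var i : @polfam (fun L f e => e`_i).
Proof. by exists (Var _ i). Qed.

Lemma polfam_cst x : @polfam (fun L f e => f x).
Proof. by exists (Const x). Qed.

Lemma polfam_nat m : @polfam (fun L f e => m%:R).
Proof. by exists (NatConst _ m). Qed.

Lemma polfam_one : @polfam (fun L f e => 1).
Proof. by exists (NatConst _ 1). Qed.

Lemma polfam_add t u : polfam t -> polfam u ->
  polfam (fun L f e => t L f e + u L f e).
Proof. by move=> [t0 H] [u0 H']; exists (Add t0 u0) => L f e; rewrite H H'. Qed.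

Lemma polfam_mul t u : polfam t -> polfam u ->
  polfam (fun L f e => t L f e * u L f e).
Proof. by move=> [t0 H] [u0 H']; exists (Mul t0 u0) => L f e; rewrite H H'. Qed.

Lemma polfam_opp t : polfam t -> polfam (fun L f e => - t L f e).
Proof. by move=> [t0 H]; exists (Opp t0) => L f e; rewrite H. Qed.

Lemma polfam_exp t m : polfam t -> polfam (fun L f e => t L f e ^+ m).
Proof. by move=> [t0 H]; exists (Exp t0 m) => L f e; rewrite H. Qed.

Lemma polfam_sum (I : Type) (l : seq I) (P : pred I) (t : I -> forall L, _) :
  (forall i, polfam (t i)) ->
  polfam (fun L f e => \sum_(i <- l | P i) t i L f e).
Proof.
move=> H; elim: l => [|i l IH].
  by apply: polfam_ext (polfam_nat 0) => L f e; rewrite big_nil.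
apply: (@polfam_ext (fun L f e => (P i)%:R * t i L f e +
    \sum_(j <- l | P j) t j L f e)).
  by move=> L f e; rewrite big_cons; case: (P i); rewrite ?mul1r ?mul0r ?add0r.
by apply: polfam_add => //; apply: polfam_mul => //; apply: polfam_nat.
Qed.

Lemma polfam_prod (I : Type) (l : seq I) (P : pred I) (t : I -> forall L, _) :
  (forall i, polfam (t i)) ->
  polfam (fun L f e => \prod_(i <- l | P i) t i L f e).
Proof.
move=> H; elim: l => [|i l IH].
  by apply: polfam_ext polfam_one => L f e; rewrite big_nil.
apply: (@polfam_ext (fun L f e => (if P i then t i L f e else 1) *
    \prod_(j <- l | P j) t j L f e)).
  by move=> L f e; rewrite big_cons; case: (P i); rewrite ?mul1r.
by apply: polfam_mul => //; case: (P i) => //; apply: polfam_one.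
Qed.

Variable n : nat.

Lemma polfam_det m (A : forall L : rcfType, {rmorphism K -> L} -> seq L -> 'M[L]_m) :
  (forall i j, polfam (fun L f e => A L f e i j)) ->
  polfam (fun L f e => \det (A L f e)).
Proof.
move=> HA; apply: polfam_sum => s; apply: polfam_mul.
  by apply: polfam_exp; apply: polfam_opp; apply: polfam_one.
by apply: polfam_prod => i.
Qed.

Lemma polfam_mval (t : mterm K n) i j :
  polfam (fun L f e => mval f (menv n e) t i j).
Proof.
elim: t i j => [b|A|u IHu v IHv|u IHu|u IHu] i j /=.
- by apply: polfam_ext (polfam_var (mpos b i j)) => L f e; rewrite mxE.
- by apply: polfam_ext (polfam_cst (A i j)) => L f e; rewrite mxE.
- apply: (@polfam_ext (fun L f e =>
    \sum_k mval f (menv n e) u i k * mval f (menv n e) v k j)).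
    by move=> L f e; rewrite mxE.
  by apply: polfam_sum => k; apply: polfam_mul.
- by apply: polfam_ext (IHu j i) => L f e; rewrite mxE.
- apply: (@polfam_ext (fun L f e => (-1) ^+ (j + i) *
    \det (row' j (col' i (mval f (menv n e) u))))).
    by move=> L f e; rewrite mxE.
  apply: polfam_mul.
    by apply: polfam_exp; apply: polfam_opp; apply: polfam_one.
  apply: polfam_det => k l.
  by apply: polfam_ext (IHu (lift j k) (lift i l)) => L f e; rewrite !mxE.
Qed.

Lemma polfam_peval (p : mxpol K n) (t : mterm K n) :
  polfam (fun L f e => peval f p (mval f (menv n e) t)).
Proof.
apply: polfam_sum => m; apply: polfam_mul; first exact: polfam_cst.
apply: polfam_prod => k; apply: polfam_exp.
case/mxvec_indexP: k => i j.
by apply: polfam_ext (polfam_mval t i j) => L f e; rewrite mxvecE.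
Qed.

Lemma polfam_sval (t : sterm K n) :
  polfam (fun L f e => sval_ f (menv n e) (senv n e) t).
Proof.
elim: t => [c|x|u i j|u IHu v IHv|u IHu|u IHu v IHv|u|p u] /=.
- exact: polfam_var.
- exact: polfam_cst.
- exact: polfam_mval.
- exact: polfam_add.
- exact: polfam_opp.
- exact: polfam_mul.
- by apply: polfam_det => i j; apply: polfam_mval.
- exact: polfam_peval.
Qed.

Lemma qfdef_exs (l : seq nat) P : @qfdef K P ->
  qfdef (fun L f e => exists2 e' : seq L,
    forall j, j \notin l -> e'`_j = e`_j & P L f e').
Proof.
move=> HP; elim: l => [|i l IH].
  (* Lists with the same entries may differ in length, so e' need not be e; clauses see only the
     entries. *)
  have [D HD] := HP; apply: qfdef_ext HP => L f e; split=> [Pe|[e' ee]].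
    by exists e.
  rewrite !HD; set a := has _ _; set b := has _ _.
  suff -> : a = b by [].
  by apply: eq_has => c; apply: eval_clause_nth => j; apply: ee.
apply: qfdef_ext (qfdef_ex i IH) => L f e; split.
  move=> [x [e' H Pe']]; exists e' => // j; rewrite inE negb_or => /andP[ji jl].
  by rewrite H // nth_set_nth /= (negbTE ji).
move=> [e' H Pe']; exists e'`_i, e' => // j jl.
rewrite nth_set_nth /=; case: eqP => [->//|/eqP ji].
by apply: H; rewrite inE negb_or ji.
Qed.

Lemma qfdef_all P : @qfdef K (fun L f e => ~ P L f e) -> qfdef P.
Proof. by move/qfdef_not; apply: qfdef_ext => L f e; split=> [/contrapT|h]. Qed.

Lemma qfdef_fsem (p : mform K n) :
  qfdef (fun L f e => fsem f (menv n e) (senv n e) p).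
Proof.
have exM b (q : mform K n) : qfdef (fun L f e => fsem f (menv n e) (senv n e) q) ->
    qfdef (fun L f e => exists M, fsem f (upd (menv n e) b M) (senv n e) q).
  move=> H; apply: qfdef_ext (qfdef_exs (mblock n b) H) => L f e; split.
    by move=> [e' /menv_agree[-> ->] h]; exists (menv n e' b).
  move=> [M h]; have [e' He' [E1 E2]] := exists_menv e b M.
  by exists e' => //; rewrite E1 E2.
have exS c (q : mform K n) : qfdef (fun L f e => fsem f (menv n e) (senv n e) q) ->
    qfdef (fun L f e => exists x, fsem f (menv n e) (upd (senv n e) c x) q).
  move=> H; apply: qfdef_ext (qfdef_exs [:: spos n c] H) => L f e; split.
    by move=> [e' /senv_agree[-> ->] h]; exists (senv n e' c).
  move=> [x h]; have [e' He' [E1 E2]] := exists_senv n e c x.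
  by exists e' => //; rewrite E1 E2.
elim: p => /=.
- move=> u v; have [t Ht] := polfam_add (polfam_sval v) (polfam_opp (polfam_sval u)).
  by apply: qfdef_ext (qfdef_gt0 t) => L f e; rewrite -Ht subr_gt0.
- move=> u v; have [t Ht] := polfam_add (polfam_sval v) (polfam_opp (polfam_sval u)).
  apply: qfdef_ext (qfdef_eq0 t) => L f e; rewrite -Ht.
  by split=> [/eqP|->]; rewrite ?subrr // subr_eq0 => /eqP.
- move=> u v.
  have Hij (ij : 'I_n * 'I_n) : qfdef (fun L f e => mval f (menv n e) u ij.1 ij.2 =
      mval f (menv n e) v ij.1 ij.2).
    have [t Ht] := polfam_add (polfam_mval v ij.1 ij.2)
      (polfam_opp (polfam_mval u ij.1 ij.2)).
    apply: qfdef_ext (qfdef_eq0 t) => L f e; rewrite -Ht.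
    by split=> [/eqP|->]; rewrite ?subrr // subr_eq0 => /eqP.
  suff: qfdef (fun L f e => forall ij, ij \in enum (('I_n * 'I_n)%type : finType) ->
      mval f (menv n e) u ij.1 ij.2 = mval f (menv n e) v ij.1 ij.2).
    apply: qfdef_ext => L f e; split=> [H|->//].
    by apply/matrixP => i j; apply: (H (i, j)); rewrite mem_enum.
  elim: (enum _) => [|ij l IH].
    by apply: qfdef_ext (qfdef_bool K true) => L f e; split.
  apply: qfdef_ext (qfdef_and (Hij ij) IH) => L f e; split.
    by move=> [h1 h2] i; rewrite inE => /orP[/eqP->|/h2].
  by move=> H; split=> [|i il]; apply: H; rewrite inE ?eqxx ?il ?orbT.
- by move=> p; apply: qfdef_not.
- by move=> p IHp q; apply: qfdef_and.
- by move=> p IHp q; apply: qfdef_or.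
- move=> p IHp q IHq; apply: qfdef_ext (qfdef_or (qfdef_not IHp) IHq) => L f e.
  split=> [[h /h//|//]|h].
  by have [/h|] := pselect (fsem f (menv n e) (senv n e) p); [right|left].
- move=> I l p IH; elim: l => [|i l IHl].
    by apply: qfdef_ext (qfdef_bool K true) => L f e; split.
  apply: qfdef_ext (qfdef_and (IH i) IHl) => L f e; split.
    by move=> [h1 h2] j; rewrite inE => /orP[/eqP->|/h2].
  by move=> H; split=> [|j jl]; apply: H; rewrite inE ?eqxx ?jl ?orbT.
- by move=> b p; apply: exM.
- move=> b p IH; apply: qfdef_all.
  apply: qfdef_ext (exM b (FNot p) (qfdef_not IH)) => L f e /=.
  by split=> [[M h] /(_ M)//|/existsNP].
- by move=> c p; apply: exS.
- move=> c p IH; apply: qfdef_all.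
  apply: qfdef_ext (exS c (FNot p) (qfdef_not IH)) => L f e /=.
  by split=> [[x h] /(_ x)//|/existsNP].
Qed.

End PolFam.

Section Transfer.
Variables (K L : rcfType) (f : {rmorphism K -> L}).

(** Positive elements of a real closed field are nonzero squares, and morphisms preserve these. *)
Lemma rmorph_gt0 (x : K) : (0 < f x) = (0 < x).
Proof.
have mono (y : K) : 0 < y -> 0 < f y.
  move=> y0; rewrite lt_neqAle eq_sym fmorph_eq0 gt_eqF //=.
  by rewrite -(sqr_sqrtr (ltW y0)) rmorphXn sqr_ge0.
apply/idP/idP => [fx|/mono//]; rewrite ltNge le_eqVlt; apply/negP => /orP[/eqP x0|x0].
  by move: fx; rewrite x0 rmorph0 ltxx.
by have := mono (- x); rewrite rmorphN !oppr_gt0 => /(_ x0) /(lt_trans fx); rewrite ltxx.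
Qed.

Lemma eval_map_term (t : term K) : eval [::] (map_term f t) = f (eval [::] t).
Proof.
elim: t => //= [i|m|u -> v ->|u ->|u -> m|u -> v ->|u -> m].
- by rewrite !nth_nil rmorph0.
- by rewrite rmorph_nat.
- by rewrite rmorphD.
- by rewrite rmorphN.
- by rewrite rmorphMn.
- by rewrite rmorphM.
- by rewrite rmorphXn.
Qed.

Lemma map_term_id (t : term K) : map_term idfun t = t.
Proof. by elim: t => //= [u -> v ->|u ->|u ->|u -> v ->|u -> m]. Qed.

(** With all variables at 0 the clauses are evaluated in the empty environment, where each term over
    L takes the image under f of its value over K; f preserves the signs. *)
Theorem transfer n (p : mform K n) :
  fsem f (fun=> 0) (fun=> 0) p <-> fsem idfun (fun=> 0) (fun=> 0) p.
Proof.
have env0 (M : nzRingType) : @menv n M [::] = (fun=> 0) /\ @senv n M [::] = (fun=> 0).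
  split; apply/funext => b; last by rewrite /senv nth_nil.
  by apply/matrixP => i j; rewrite !mxE nth_nil.
have [D HD] := qfdef_fsem p.
have := HD L f [::]; have := HD K idfun [::].
rewrite !(env0 K).1 !(env0 K).2 !(env0 L).1 !(env0 L).2 => -> ->.
suff -> : has (eval_clause [::]) (map (map_clause f) D) =
    has (eval_clause [::]) (map (map_clause idfun) D) by [].
rewrite !has_map; apply: eq_has => -[sp sq] /=; rewrite /eval_clause /= !all_map.
by congr (_ && _); apply: eq_all => t /=;
  rewrite eval_map_term map_term_id ?fmorph_eq0 ?rmorph_gt0.
Qed.

End Transfer.

(** * Semialgebraic sets defined by formulas *)

Section Semialg.
Variables (K : rcfType) (n : nat).

(** The environments of [eval_term_pol] vanish off the block of matrix variable 0, so every other
    variable becomes the polynomial 0. *)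
Fixpoint term_pol (t : term K) : mxpol K n :=
  match t with
  | Var k => if @pickle_inv (nat * ('I_n * 'I_n) + nat)%type k is Some (inl (b, (i, j))) then
      if eqn b 0 then mpoly.mpolyX K (mpoly.mnm1 (mxvec_index i j)) else 0 else 0
  | Const x => mpoly.mpolyC (n * n) x
  | NatConst m => m%:R
  | Add u v => term_pol u + term_pol v
  | Opp u => - term_pol u
  | NatMul u m => term_pol u *+ m
  | Mul u v => term_pol u * term_pol v
  | Exp u m => term_pol u ^+ m
  end.

Lemma eval_term_pol (L : rcfType) (f : {rmorphism K -> L}) (g : 'M[L]_n) (e : seq L) (t : term K) :
  (forall j, j \notin mblock n 0 -> e`_j = 0) -> menv n e 0%N = g ->
  peval f (term_pol t) g = eval e (map_term f t).
Proof.
move=> He Hg; rewrite /peval; elim: t => /=.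
- move=> k; have kE x : @pickle_inv (nat * ('I_n * 'I_n) + nat)%type k = Some x -> k = pickle x.
    by move=> E; have := @pickle_invK (nat * ('I_n * 'I_n) + nat)%type k; rewrite E.
  have k0 : (forall i j : 'I_n, k <> mpos 0 i j) -> e`_k = 0.
    by move=> H; rewrite He //; apply/fintype.imageP => -[[i j] _ /H].
  case E: (@pickle_inv (nat * ('I_n * 'I_n) + nat)%type k) => [[[b [i j]]|c]|].
  + rewrite eqnE; case: eqP => [b0|b0]; last first.
      by rewrite rmorph0 k0 // => i' j'; rewrite (kE _ E) => /mpos_inj[].
    rewrite mpoly.mmapX mpoly.mmap1U mxvecE -Hg mxE; congr (_`_ _).
    by rewrite (kE _ E) b0.
  + rewrite rmorph0 k0 // => i j; rewrite (kE _ E) => /esym; exact: mpos_spos.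
  + by rewrite rmorph0 k0 // => i j kk; move: E; rewrite kk pickleK_inv.
- by move=> x; rewrite mpoly.mmapC.
- by move=> m; rewrite rmorph_nat.
- by move=> u <- v <-; rewrite rmorphD.
- by move=> u <-; rewrite rmorphN.
- by move=> u <- m; rewrite rmorphMn.
- by move=> u <- v <-; rewrite rmorphM.
- by move=> u <- m; rewrite rmorphXn.
Qed.

Theorem fsem_sa_set (p : mform K n) : exists D : sa_data K n,
  forall (L : rcfType) (f : {rmorphism K -> L}) g,
    sa_set f D g <-> fsem f (upd (fun=> 0) 0 g) (fun=> 0) p.
Proof.
have [D HD] := qfdef_fsem p.
exists [seq (map term_pol c.1, map term_pol c.2) | c <- D] => L f g.
have [e He [Em Es]] := exists_menv [::] 0 g.
have {}He j : j \notin mblock n 0 -> e`_j = 0 by move/He; rewrite nth_nil.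
have Eg : menv n e 0%N = g by rewrite Em.
have := HD L f e; rewrite Em Es.
have -> : menv n ([::] : seq L) = (fun=> 0).
  by apply/funext => b; apply/matrixP => i j; rewrite !mxE nth_nil.
have -> : senv n ([::] : seq L) = (fun=> 0).
  by apply/funext => b; rewrite /senv nth_nil.
move=> ->.
have E c : eval_clause e (map_clause f c) <->
    (forall q, q \in map term_pol c.1 -> peval f q g = 0) /\
    (forall q, q \in map term_pol c.2 -> 0 < peval f q g).
  case: c => sp sq; rewrite /eval_clause /= !all_map; split.
    move=> /andP[h1 h2]; split => q.
      elim: sp h1 => //= t sp IH /andP[/eqP t0 h1]; rewrite inE.
      by move=> /orP[/eqP->|/(IH h1)//]; rewrite (eval_term_pol f _ He Eg).
    elim: sq h2 => //= t sq IH /andP[t0 h2]; rewrite inE.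
    by move=> /orP[/eqP->|/(IH h2)//]; rewrite (eval_term_pol f _ He Eg).
  move=> [h1 h2]; apply/andP; split.
    elim: sp h1 => //= t sp IH h1; rewrite -(eval_term_pol f _ He Eg).
    rewrite h1 ?mem_head // eqxx IH // => q qs; apply: h1.
    by rewrite inE qs orbT.
  elim: sq h2 => //= t sq IH h2; rewrite -(eval_term_pol f _ He Eg).
  rewrite h2 ?mem_head // IH // => q qs; apply: h2.
  by rewrite inE qs orbT.
elim: D {HD} => [|c D IH] /=.
  by split=> // -[].
split.
  move=> [c']; rewrite inE => /orP[/eqP->|c'D] /= H.
    by apply/orP; left; apply/E.
  by apply/orP; right; apply/IH; exists c'.
move=> /orP[/E H|/IH[c' c'D H]]; first by exists (map term_pol c.1, map term_pol c.2); rewrite ?mem_head.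
by exists c' => //; rewrite inE c'D orbT.
Qed.

End Semialg.
End MQE.

(** * Terms in one matrix as polynomials *)

Section TermPol.
Variables (E : comNzRingType) (n : nat).

(** All matrix variables are read as one generic matrix, whence the constant environments
    [fun=> g]. *)
Fixpoint mpolm (t : mterm E n) : 'M[mxpol E n]_n :=
  match t with
  | MVar b => \matrix_(i, j) mpoly.mpolyX E (mpoly.mnm1 (mxvec_index i j))
  | MCst A => map_mx (@mpoly.mpolyC (n * n) E) A
  | MMul u v => mpolm u *m mpolm v
  | MTr u => (mpolm u)^T
  | MAdj u => \adj (mpolm u)
  end.

Fixpoint spolm (t : sterm E n) : mxpol E n :=
  match t with
  | SVar c => 0
  | SCst x => mpoly.mpolyC (n * n) x
  | SEnt u i j => mpolm u i j
  | SAdd u v => spolm u + spolm v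
  | SOpp u => - spolm u
  | SMul u v => spolm u * spolm v
  | SDet u => \det (mpolm u)
  | SPol p u => peval (@mpoly.mpolyC (n * n) E) p (mpolm u)
  end.

Variables (L : comNzRingType) (f : {rmorphism E -> L}) (g : 'M[L]_n).
Notation ev := (mpoly.mmap f (fun k : 'I_(n * n) => mxvec g 0 k)).

Lemma peval_mpolm t : map_mx ev (mpolm t) = mval f (fun=> g) t.
Proof.
elim: t => /=.
- by move=> _; apply/matrixP => i j; rewrite !mxE mpoly.mmapX mpoly.mmap1U mxvecE.
- by move=> A; apply/matrixP => i j; rewrite !mxE mpoly.mmapC.
- by move=> u <- v <-; rewrite map_mxM.
- by move=> u <-; rewrite map_trmx.
- by move=> u <-; rewrite map_mx_adj.
Qed.

Lemma peval_spolm t : peval f (spolm t) g = sval_ f (fun=> g) (fun=> 0) t.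
Proof.
rewrite /peval; elim: t => /=.
- by move=> c; rewrite rmorph0.
- by move=> x; rewrite mpoly.mmapC.
- by move=> u i j; rewrite -peval_mpolm mxE.
- by move=> u <- v <-; rewrite rmorphD.
- by move=> u <-; rewrite rmorphN.
- by move=> u <- v <-; rewrite rmorphM.
- by move=> u; rewrite -peval_mpolm det_map_mx.
- move=> p u; rewrite -peval_mpolm /peval [in X in ev X]/mpoly.mmap rmorph_sum /=.
  apply: eq_bigr => m _; rewrite rmorphM /= mpoly.mmapC; congr (_ * _).
  rewrite /mpoly.mmap1 rmorph_prod; apply: eq_bigr => k _.
  by rewrite rmorphXn /= -map_mxvec mxE.
Qed.

End TermPol.

(** * Commutative diagonal semigroups *)

Section Characters.
Variables (L : fieldType) (T : Type) (op : T -> T -> T) (X : set T).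
Variables (N : nat) (chi : 'I_N -> T -> L) (c z : 'I_N -> L) (x0 : T).
Hypothesis opX : forall x y, X x -> X y -> X (op x y).
Hypothesis chiM : forall k x y, X x -> X y -> chi k (op x y) = chi k x * chi k y.
Hypothesis Xx0 : X x0.
Hypothesis chi0 : forall k, chi k x0 != 0.
Hypothesis relX : forall x, X x -> \sum_k c k * chi k x = 0.
Hypothesis zchi : forall k l, (forall x, X x -> chi k x = chi l x) -> z k = z l.

Let same k l := `[< forall x, X x -> chi k x = chi l x >].

(* Dedekind independence: applying, for every character different from chi k,
   an operator (translate by x - value at x) that kills it, isolates the sum of
   the coefficients of the characters that coincide with chi k on X. *)
Lemma class_sum_eq0 k : \sum_(l | same k l) c l = 0.
Proof.
have [xs xsP] : exists xs : 'I_N -> T, forall j, ~~ same k j ->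
    X (xs j) /\ chi k (xs j) != chi j (xs j).
  suff H j : exists x, ~~ same k j -> X x /\ chi k x != chi j x.
    by have [xs] := choice H; exists xs.
  have [s|/asboolPn] := boolP (same k j); first by exists x0.
  by move=> /existsNP[x /not_implyP[Xx /eqP Hx]]; exists x.
have kill (s : seq 'I_N) : all (fun j => ~~ same k j) s -> forall x, X x ->
    \sum_l c l * \prod_(j <- s) (chi l (xs j) - chi j (xs j)) * chi l x = 0.
  elim: s => [|j s IH] /=.
    move=> _ x Xx; rewrite -[RHS](relX Xx); apply: eq_bigr => l _.
    by rewrite big_nil mulr1.
  move=> /andP[/xsP[Xj _] /IH{}IH] x Xx.
  pose F y := \sum_l c l * \prod_(j <- s) (chi l (xs j) - chi j (xs j)) * chi l y.
  transitivity (F (op (xs j) x) - chi j (xs j) * F x); last first.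
    by rewrite /F !IH ?mulr0 ?subr0 //; apply: opX.
  rewrite mulr_sumr -sumrB; apply: eq_bigr => l _.
  by rewrite big_cons chiM //; ring.
pose s := [seq j <- enum 'I_N | ~~ same k j].
have := kill s (filter_all _ _) x0 Xx0.
rewrite (bigID (same k)) /= [X in _ + X]big1 ?addr0; last first.
  move=> l kl; have ls : l \in s by rewrite mem_filter kl mem_enum.
  rewrite (big_rem l ls) /=.
  by rewrite subrr mul0r mulr0 mul0r.
set P := \prod_(j <- s) (chi k (xs j) - chi j (xs j)).
suff -> : \sum_(l | same k l) c l * \prod_(j <- s) (chi l (xs j) - chi j (xs j))
    * chi l x0 = (\sum_(l | same k l) c l) * (P * chi k x0).
  move=> /eqP; rewrite mulf_eq0 => /orP[/eqP//|].
  rewrite mulf_eq0 (negbTE (chi0 k)) orbF => H; exfalso; apply/negP: H.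
  rewrite prodf_seq_neq0; apply/allP => j; rewrite mem_filter /=.
  by move=> /andP[/xsP[_ H] _]; rewrite subr_eq0.
rewrite mulr_suml; apply: eq_bigr => l /asboolP kl.
rewrite -kl // mulrA; congr (_ * _ * _).
rewrite /P big_seq [RHS]big_seq; apply: eq_bigr => j.
by rewrite mem_filter => /andP[/xsP[Xj _] _]; rewrite kl.
Qed.

(** The family z stands for the values of the characters at a point that may lie outside X. It is
    constant on each class of characters that agree on X, and such a class contributes this constant
    times its coefficient sum 0. *)
Lemma characters_relation : \sum_k c k * z k = 0.
Proof.
pose rep k := odflt k [pick l | same k l].
have sxx k : same k k by apply/asboolP.
have sC k l : same k l = same l k.
  by apply/asboolP/asboolP => H x Xx; rewrite H.
have sT k l m : same k l -> same l m -> same k m.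
  by move=> /asboolP H /asboolP H'; apply/asboolP => x Xx; rewrite H ?H'.
have repP k : same k (rep k).
  by rewrite /rep; case: pickP => //= _; exact: sxx.
have rep_eq k l : same k l -> rep k = rep l.
  move=> kl; rewrite /rep (@eq_pick _ (same k) (same l)).
    by case: pickP => [//|/(_ l)]; rewrite sxx.
  by move=> m; apply/idP/idP; [rewrite sC in kl|]; apply: sT.
rewrite (partition_big rep xpredT) //= big1 // => r _.
have [/existsP[k0 /eqP k0r]|nex] := boolP [exists k, rep k == r]; last first.
  by rewrite big1 // => k kr; case/existsP: nex; exists k.
rewrite (eq_bigl (same k0)); last first.
  move=> k; apply/eqP/idP => [kr|/rep_eq <-//].
  by apply: (sT _ (rep k0)) => //; rewrite k0r -kr sC.
rewrite (eq_bigr (fun k => c k * z k0)).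
  by rewrite -mulr_suml class_sum_eq0 mul0r.
by move=> k /asboolP k0k; congr (_ * _); apply/esym/zchi.
Qed.

End Characters.

(** * Monomials and their relations *)

Definition mon (L : comNzRingType) n (m : 'I_n -> nat) (x : 'rV[L]_n) : L :=
  \prod_i x 0 i ^+ m i.

Definition rv_mul (L : nzRingType) n (x y : 'rV[L]_n) : 'rV[L]_n :=
  \row_i (x 0 i * y 0 i).

Definition cdiag (L : fieldType) n (h : 'M[L]_n) (x : 'rV[L]_n) : 'M[L]_n :=
  invmx h *m diag_mx x *m h.

Section Monomials.
Variables (L : fieldType) (n : nat).
Implicit Types x y : 'rV[L]_n.

Lemma monM m x y : mon m (rv_mul x y) = mon m x * mon m y.
Proof. by rewrite /mon -big_split; apply: eq_bigr => i _; rewrite mxE exprMn. Qed.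

Lemma mon_neq0 m x : (forall i, x 0 i != 0) -> mon m x != 0.
Proof. by move=> H; apply/prodf_neq0 => i _; apply: expf_neq0. Qed.

Definition msum (l : seq (L * ('I_n -> nat))) x : L :=
  \sum_(c <- l) c.1 * mon c.2 x.

Definition ismsum (F : 'rV[L]_n -> L) := exists l, F =1 msum l.

Lemma ismsum_ext F G : F =1 G -> ismsum F -> ismsum G.
Proof. by move=> FG [l Hl]; exists l => x; rewrite -FG. Qed.

Lemma ismsum_cst c : ismsum (fun=> c).
Proof.
exists [:: (c, fun=> 0%N)] => x; rewrite /msum big_seq1 /= /mon.
by rewrite big1 ?mulr1.
Qed.

Lemma ismsum_coord i : ismsum (fun x => x 0 i).
Proof.
exists [:: (1, fun j => nat_of_bool (j == i))] => x; rewrite /msum big_seq1 mul1r.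
rewrite /mon (bigD1 i) //= eqxx expr1 big1 ?mulr1 // => j ji.
by rewrite (negbTE ji) expr0.
Qed.

Lemma ismsumD F G : ismsum F -> ismsum G -> ismsum (fun x => F x + G x).
Proof.
by move=> [l Hl] [l' Hl']; exists (l ++ l') => x; rewrite /msum big_cat Hl Hl'.
Qed.

Lemma ismsumM F G : ismsum F -> ismsum G -> ismsum (fun x => F x * G x).
Proof.
move=> [l Hl] [l' Hl'].
exists [seq (c.1 * c'.1, fun i => (c.2 i + c'.2 i)%N) | c <- l, c' <- l'] => x.
rewrite Hl Hl' /msum big_allpairs_dep /= mulr_suml; apply: eq_bigr => c _.
rewrite mulr_sumr; apply: eq_bigr => c' _ /=.
rewrite mulrACA; congr (_ * _); rewrite /mon -big_split /=.
by apply: eq_bigr => i _; rewrite exprD.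
Qed.

Lemma ismsum_sum (I : Type) (l : seq I) P (F : I -> _) :
  (forall i, ismsum (F i)) -> ismsum (fun x => \sum_(i <- l | P i) F i x).
Proof.
move=> H; elim: l => [|i l IH].
  by apply: ismsum_ext (ismsum_cst 0) => x; rewrite big_nil.
have [Pi|Pi] := boolP (P i); last first.
  by apply: ismsum_ext IH => x; rewrite big_cons (negbTE Pi).
by apply: ismsum_ext (ismsumD (H i) IH) => x; rewrite big_cons Pi.
Qed.

Lemma ismsum_prod (I : Type) (l : seq I) P (F : I -> _) :
  (forall i, ismsum (F i)) -> ismsum (fun x => \prod_(i <- l | P i) F i x).
Proof.
move=> H; elim: l => [|i l IH].
  by apply: ismsum_ext (ismsum_cst 1) => x; rewrite big_nil.
have [Pi|Pi] := boolP (P i); last first.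
  by apply: ismsum_ext IH => x; rewrite big_cons (negbTE Pi).
by apply: ismsum_ext (ismsumM (H i) IH) => x; rewrite big_cons Pi.
Qed.

Lemma ismsumX F m : ismsum F -> ismsum (fun x => F x ^+ m).
Proof.
move=> H; elim: m => [|m IH].
  by apply: ismsum_ext (ismsum_cst 1) => x; rewrite expr0.
by apply: ismsum_ext (ismsumM H IH) => x; rewrite exprS.
Qed.

Lemma ismsum_cdiag (h : 'M[L]_n) i j : ismsum (fun x => cdiag h x i j).
Proof.
apply: (@ismsum_ext (fun x => \sum_k (invmx h i k * x 0 k) * h k j)).
  move=> x; rewrite mxE; apply: eq_bigr => k _; congr (_ * _).
  by rewrite mul_mx_diag mxE.
apply: ismsum_sum => k; apply: ismsumM; last exact: ismsum_cst.
by apply: ismsumM; [exact: ismsum_cst|exact: ismsum_coord].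
Qed.

Lemma ismsum_peval (E : nzRingType) (f : E -> L) (p : mxpol E n) (h : 'M[L]_n) :
  ismsum (fun x => peval f p (cdiag h x)).
Proof.
apply: ismsum_sum => m; apply: ismsumM; first exact: ismsum_cst.
apply: ismsum_prod => k; apply: ismsumX; case/mxvec_indexP: k => i j.
by apply: ismsum_ext (ismsum_cdiag h i j) => x; rewrite mxvecE.
Qed.

(* The monomials of an equation that agree on X agree at d, and class_sum_eq0
   says that their coefficients add up to 0. *)
Lemma zero_locus_cdiag (E : nzRingType) (f : E -> L) (P : seq (mxpol E n))
    (h : 'M[L]_n) (X : set 'rV[L]_n) (d : 'rV[L]_n) :
  X !=set0 ->
  (forall x y, X x -> X y -> X (rv_mul x y)) ->
  (forall x, X x -> forall i, x 0 i != 0) ->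
  (forall x, X x -> zero_locus f P (cdiag h x)) ->
  (forall m m', (forall x, X x -> mon m x = mon m' x) -> mon m d = mon m' d) ->
  zero_locus f P (cdiag h d).
Proof.
move=> [x0 Xx0] XM Xn0 XP Hd p pP.
have [l Hl] := ismsum_peval f p h; rewrite Hl.
rewrite /msum (big_nth (0, fun=> 0%N)) big_mkord.
apply: (@characters_relation _ _ (@rv_mul L n) X _
  (fun (k : 'I_(size l)) x => mon (nth (0, fun=> 0%N) l k).2 x) _ _ x0) => //.
- by move=> k x y _ _; apply: monM.
- by move=> k; apply/mon_neq0/Xn0.
- move=> x Xx; have := XP _ Xx p pP; rewrite Hl.
  by rewrite /msum (big_nth (0, fun=> 0%N)) big_mkord.
by move=> k k'; apply: Hd.
Qed.

Definition zmon (m : 'rV[int]_n) x : L := \prod_i x 0 i ^ m 0 i.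

Lemma zmon0 x : zmon 0 x = 1.
Proof. by rewrite /zmon big1 // => i _; rewrite mxE. Qed.

Lemma zmonM m x y : zmon m (rv_mul x y) = zmon m x * zmon m y.
Proof. by rewrite /zmon -big_split; apply: eq_bigr => i _; rewrite mxE expfzMl. Qed.

Lemma zmonZ a m x : zmon (a *: m) x = zmon m x ^ a.
Proof.
rewrite /zmon (big_morph (fun u : L => u ^ a) (fun u v => expfzMl u v a) (exp1rz _ a)).
by apply: eq_bigr => i _; rewrite mxE mulrC exprz_exp.
Qed.

Lemma zmon_neq0 m x : (forall i, x 0 i != 0) -> zmon m x != 0.
Proof. by move=> H; apply/prodf_neq0 => i _; apply: expfz_neq0. Qed.

Lemma zmonD m m' x : (forall i, x 0 i != 0) ->
  zmon (m + m') x = zmon m x * zmon m' x.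
Proof.
by move=> H; rewrite /zmon -big_split; apply: eq_bigr => i _; rewrite mxE expfzDr.
Qed.

Lemma zmonB m m' x : (forall i, x 0 i != 0) ->
  zmon (m - m') x = zmon m x / zmon m' x.
Proof. by move=> H; rewrite zmonD // -scaleN1r zmonZ. Qed.

Lemma zmon_mulmx p (u : 'rV[int]_p) (M : 'M[int]_(p, n)) x :
  (forall i, x 0 i != 0) ->
  zmon (u *m M) x = \prod_k zmon (row k M) x ^ u 0 k.
Proof.
move=> H; rewrite mulmx_sum_row.
rewrite (big_morph (fun m => zmon m x) (fun m m' => zmonD m m' H) (zmon0 x)).
by apply: eq_bigr => k _; rewrite zmonZ.
Qed.

Lemma zmon_nat (m : 'I_n -> nat) x : zmon (\row_i (m i)%:Z) x = mon m x.
Proof. by rewrite /zmon /mon; apply: eq_bigr => i _; rewrite mxE. Qed.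

Lemma zmon_const x : zmon (const_mx 1) x = \prod_i x 0 i.
Proof. by apply: eq_bigr => i _; rewrite mxE expr1z. Qed.

Lemma zmon_rel (m m' : 'I_n -> nat) x : (forall i, x 0 i != 0) ->
  mon m x = mon m' x <-> zmon (\row_i (m i)%:Z - \row_i (m' i)%:Z) x = 1.
Proof.
move=> H; rewrite zmonB // !zmon_nat; split=> [->|E].
  by rewrite divff // mon_neq0.
by rewrite -[LHS](divfK (mon_neq0 m' H)) E mul1r.
Qed.

(** Two monomials agree where their quotient, a Laurent monomial, is 1; so only the lattice of
    exponents of trivial Laurent monomials has to be known. *)
Lemma zero_locus_zmon (E : nzRingType) (f : E -> L) (P : seq (mxpol E n))
    (h : 'M[L]_n) (X : set 'rV[L]_n) (d : 'rV[L]_n) :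
  X !=set0 ->
  (forall x y, X x -> X y -> X (rv_mul x y)) ->
  (forall x, X x -> forall i, x 0 i != 0) ->
  (forall x, X x -> zero_locus f P (cdiag h x)) ->
  (forall i, d 0 i != 0) ->
  (forall m, (forall x, X x -> zmon m x = 1) -> zmon m d = 1) ->
  zero_locus f P (cdiag h d).
Proof.
move=> X0 XM Xn0 XP d0 Hd; apply: (zero_locus_cdiag X0 XM Xn0 XP) => m m' mm'.
apply/zmon_rel => //; apply: Hd => x Xx; apply/zmon_rel; first exact: Xn0.
exact: mm'.
Qed.

(* By the Smith normal form, the rows of U indexed by I0 span the saturation of
   the lattice of monomial relations of X. *)
Lemma relation_lattice (X : set 'rV[L]_n) :
  (forall x, X x -> forall i, x 0 i != 0) ->
  exists (U : 'M[int]_n) (I0 : pred 'I_n),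
    [/\ U \in unitmx,
        forall m, (forall x, X x -> zmon m x = 1) ->
          forall k, ~~ I0 k -> (m *m invmx U) 0 k = 0 &
        exists2 N : nat, (0 < N)%N & forall k, I0 k -> forall x, X x ->
          zmon (row k U) x ^+ N = 1].
Proof.
move=> Xn0; pose rel m := forall x, X x -> zmon m x = 1.
pose Q : int -> rat := intr.
(* Take relations of maximal rational rank: adjoining another relation m does not raise the rank, so
   m is a rational combination of the rows of M. *)
have [p [M [MX Mmax]]] : exists p (M : 'M[int]_(p, n)), (forall k, rel (row k M)) /\
    forall m, rel m -> (map_mx Q m <= map_mx Q M)%MS.
  pose good r := `[< exists p (M : 'M[int]_(p, n)), (forall k, rel (row k M)) /\
    \rank (map_mx Q M) = r >].
  have ex : exists r, good r.
    exists 0%N; apply/asboolP; exists 0%N, 0; split=> [[]//|].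
    by apply/eqP; rewrite -leqn0 rank_leq_row.
  have bnd r : good r -> (r <= n)%N.
    by move=> /asboolP[p [M [_ <-]]]; exact: rank_leq_col.
  have [r /asboolP[p [M [MX Mr]]] rmax] := ex_maxnP ex bnd.
  exists p, M; split=> // m mX.
  have /asboolP/rmax : exists p' (M' : 'M[int]_(p', n)), (forall k, rel (row k M')) /\
      \rank (map_mx Q M') = \rank (map_mx Q (col_mx M m)).
    exists (p + 1)%N, (col_mx M m); split=> // k.
    case: (split_ordP k) => j ->; first by rewrite rowKu.
    by rewrite rowKd ord1 row_id.
  rewrite map_col_mx -addsmxE -Mr => le_r.
  have : (map_mx Q M + map_mx Q m <= map_mx Q M)%MS.
    by rewrite -(geq_leqif (mxrank_leqif_sup (addsmxSl _ _))).
  by rewrite addsmx_sub => /andP[].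
(* M = A D U with A and U unimodular. Since a relation m is u M with u rational, m U^-1 vanishes
   where D has a zero column, and d_k times row k of U is an integral combination of rows of M. *)
have [A Au [U Uu [d _ MD]]] := int_Smith_normal_form M.
set D := (X in _ *m X *m _) in MD.
exists U, (fun k : 'I_n => (k < p)%N && (d`_k != 0)); split=> //.
  move=> m /Mmax/submxP[u Hu] k Hk.
  apply: (@intr_inj rat); rewrite -[LHS]/(Q _) rmorph0.
  have -> : Q ((m *m invmx U) 0 k) = map_mx Q (m *m invmx U) 0 k by rewrite [RHS]mxE.
  rewrite map_mxM Hu MD !map_mxM -!mulmxA -(map_mxM _ U) mulmxV //.
  rewrite map_mx1 mulmx1 mulmxA mxE big1 // => j _.
  rewrite !mxE; have [jk|jk] := eqVneq (val j) (val k); last by rewrite mulr0n mulr0.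
  move: Hk; rewrite -jk ltn_ord /= negbK => /eqP ->.
  by rewrite mul0rn mulr0.
(* A common multiple of the nonzero invariant factors; zeros are replaced by 1 to keep N
   positive. *)
pose N := (\prod_(k < n) (if (d`_k == 0)%R then 1 else absz (d`_k)%R))%N.
exists N.
  rewrite /N big_seq prodn_cond_gt0 // => k _.
  by case: eqVneq => // d0; rewrite absz_gt0.
move=> k /andP[kp dk] x Xx.
suff : zmon (row k U) x ^+ absz (d`_k) = 1.
  by rewrite /N (bigD1 k) //= (negbTE dk) exprM => ->; rewrite expr1n.
have /eqP : zmon (row k U) x ^ d`_k = 1.
  rewrite -zmonZ.
  have -> : d`_k *: row k U = row (Ordinal kp) (invmx A) *m M.
    rewrite MD -row_mul -mulmxA mulKmx // row_mul.
    apply/rowP => i; rewrite !mxE (bigD1 k) //= !mxE eqxx mulr1n big1 ?addr0 //.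
    move=> j jk; have /negbTE H : (k : nat) != j by rewrite eq_sym; exact: jk.
    by rewrite !mxE /= H mulr0n mul0r.
  rewrite zmon_mulmx; last exact: Xn0.
  by rewrite big1 // => j _; rewrite MX // exp1rz.
case: (d`_k) => m; first by move/eqP.
by rewrite NegzE -invr_expz invr_eq1 => /eqP.
Qed.

End Monomials.

(** Inverse of [cdiag h] on the matrices that h diagonalizes; of any other matrix it reads only the
    diagonal in the basis h. *)
Definition dv (L : fieldType) n (h g : 'M[L]_n) : 'rV[L]_n :=
  \row_i (h *m g *m invmx h) i i.

Section DiagCoordinates.
Variables (L : fieldType) (n : nat) (h : 'M[L]_n).
Hypothesis hu : h \in unitmx.

Lemma cdiagK : cancel (cdiag h) (dv h).
Proof.
move=> x; apply/rowP => i; rewrite mxE /cdiag !mulmxA mulmxV // mul1mx.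
by rewrite mulmxK // mxE eqxx mulr1n.
Qed.

Lemma dvK g : is_diag_mx (h *m g *m invmx h) -> cdiag h (dv h g) = g.
Proof.
move=> /is_diag_mxP gd; rewrite /cdiag.
have -> : diag_mx (dv h g) = h *m g *m invmx h.
  apply/matrixP => i j; rewrite [LHS]mxE [X in X *+ _]mxE.
  by have [->|ij] := eqVneq i j; rewrite ?mulr1n // mulr0n gd.
by rewrite !mulmxA mulVmx // mul1mx mulmxKV.
Qed.

Lemma cdiag_diag x : is_diag_mx (h *m cdiag h x *m invmx h).
Proof. by rewrite /cdiag !mulmxA mulmxV // mul1mx mulmxK // diag_mx_is_diag. Qed.

Lemma cdiagM x y : cdiag h x *m cdiag h y = cdiag h (rv_mul x y).
Proof.
rewrite /cdiag !mulmxA mulmxK // -!mulmxA (mulmxA (diag_mx x)) mulmx_diag.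
by congr (_ *m (diag_mx _ *m _)); apply/rowP => i; rewrite !mxE.
Qed.

Lemma cdiag1 : cdiag h (const_mx 1) = 1%:M.
Proof. by rewrite /cdiag diag_const_mx mulmx1 mulVmx. Qed.

Lemma det_cdiag x : \det (cdiag h x) = \prod_i x 0 i.
Proof.
rewrite /cdiag !det_mulmx mulrAC -det_mulmx mulVmx // det1 mul1r.
by rewrite det_diag.
Qed.

Lemma dvM g g' : is_diag_mx (h *m g *m invmx h) ->
  is_diag_mx (h *m g' *m invmx h) -> dv h (g *m g') = rv_mul (dv h g) (dv h g').
Proof. by move=> gd gd'; rewrite -{1}(dvK gd) -{1}(dvK gd') cdiagM cdiagK. Qed.

Lemma cdiag_comm x y : cdiag h x *m cdiag h y = cdiag h y *m cdiag h x.
Proof.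
by rewrite !cdiagM; congr cdiag; apply/rowP => i; rewrite !mxE mulrC.
Qed.

End DiagCoordinates.

Section CharTerms.
Variables (E : fieldType) (n : nat) (h : 'M[E]_n).

(* The entry (i, j) of h g h^-1, resp. of h (adj g) h^-1, at g = MVar b. *)
Definition eterm (b : nat) (i j : 'I_n) : sterm E n :=
  SEnt (MMul (MMul (MCst h) (MVar _ _ b)) (MCst (invmx h))) i j.
Definition eterm_adj (b : nat) (i j : 'I_n) : sterm E n :=
  SEnt (MMul (MMul (MCst h) (MAdj (MVar _ _ b))) (MCst (invmx h))) i j.

Definition SExp (t : sterm E n) (m : nat) := iter m (SMul t) (SCst n 1).
Definition SProd (I : Type) (l : seq I) (t : I -> sterm E n) :=
  foldr (fun i u => SMul (t i) u) (SCst n 1) l.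
Definition SSum (I : Type) (l : seq I) (t : I -> sterm E n) :=
  foldr (fun i u => SAdd (t i) u) (SCst n 0) l.

(** Negative exponents go through the adjugate, which inverts matrices of determinant 1; [Negz k] is
    - (k + 1). *)
Definition zterm (b : nat) (m : 'rV[int]_n) : sterm E n :=
  SProd (enum 'I_n) (fun i => match m 0 i with
    | Posz k => SExp (eterm b i i) k
    | Negz k => SExp (eterm_adj b i i) k.+1 end).

Variables (L : fieldType) (f : {rmorphism E -> L}) (r : nat -> 'M[L]_n) (s : nat -> L).
Notation ev := (sval_ f r s).

Lemma sval_SExp t m : ev (SExp t m) = ev t ^+ m.
Proof. by elim: m => [|m IH] /=; rewrite ?rmorph1 // exprS -IH. Qed.

Lemma sval_SProd (I : Type) (l : seq I) t : ev (SProd l t) = \prod_(i <- l) ev (t i).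
Proof. by elim: l => [|i l IH] /=; rewrite ?big_nil ?rmorph1 // big_cons -IH. Qed.

Lemma sval_SSum (I : Type) (l : seq I) t : ev (SSum l t) = \sum_(i <- l) ev (t i).
Proof. by elim: l => [|i l IH] /=; rewrite ?big_nil ?rmorph0 // big_cons -IH. Qed.

Lemma sval_eterm b i j :
  ev (eterm b i j) = (map_mx f h *m r b *m invmx (map_mx f h)) i j.
Proof. by rewrite /= map_invmx. Qed.

Lemma sval_eterm_diag b i : ev (eterm b i i) = dv (map_mx f h) (r b) 0 i.
Proof. by rewrite sval_eterm [RHS]mxE. Qed.

Lemma sval_eterm_adj b i : h \in unitmx -> \det (r b) = 1 ->
  is_diag_mx (map_mx f h *m r b *m invmx (map_mx f h)) ->
  ev (eterm_adj b i i) = (dv (map_mx f h) (r b) 0 i)^-1.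
Proof.
move=> hu det1 rd; have hfu : map_mx f h \in unitmx by rewrite map_unitmx.
rewrite /= map_invmx.
have -> : \adj (r b) = invmx (r b).
  by rewrite /invmx unitmxE det1 unitr1 invr1 scale1r.
set x := dv _ _; have xE : r b = cdiag (map_mx f h) x by rewrite dvK.
clearbody x.
have xn0 j : x 0 j != 0.
  have := oner_neq0 L; rewrite -det1 xE det_cdiag // => /prodf_neq0; exact.
have -> : invmx (r b) = cdiag (map_mx f h) (\row_j (x 0 j)^-1).
  have ru : r b \in unitmx by rewrite unitmxE det1 unitr1.
  rewrite -[RHS](mulKmx ru) {3}xE cdiagM //.
  have -> : rv_mul x (\row_j (x 0 j)^-1) = const_mx 1.
    by apply/rowP => j; rewrite !mxE divff.
  by rewrite cdiag1 // mulmx1.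
have := cdiagK hfu (\row_j (x 0 j)^-1) => /rowP /(_ i).
by rewrite mxE [in X in _ = X -> _]mxE.
Qed.

Lemma sval_zterm b m : h \in unitmx -> \det (r b) = 1 ->
  is_diag_mx (map_mx f h *m r b *m invmx (map_mx f h)) ->
  ev (zterm b m) = zmon m (dv (map_mx f h) (r b)).
Proof.
move=> hu det1 rd; rewrite sval_SProd big_enum; apply: eq_bigr => i _.
case: (m 0 i) => k; rewrite sval_SExp; first by rewrite sval_eterm_diag.
by rewrite sval_eterm_adj // NegzE -exprnN exprVn.
Qed.

End CharTerms.

Lemma zero_locus_spolm (E : fieldType) (L : fieldType) (f : {rmorphism E -> L}) n
    (ts : seq (sterm E n)) (g : 'M[L]_n) :
  zero_locus f (map (@spolm E n) ts) g <->
  forall t, List.In t ts -> sval_ f (fun=> g) (fun=> 0) t = 0.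
Proof.
rewrite /zero_locus /=; elim: ts => [|t ts IH] /=; first by split.
split=> H.
  move=> u [<-|]; first by rewrite -peval_spolm H // inE eqxx.
  by move: u; apply: (IH.1 _) => p pP; apply: H; rewrite inE pP orbT.
move=> p; rewrite inE => /orP[/eqP->|]; first by rewrite peval_spolm; apply: H; left.
by move: p; apply: (IH.2 _) => u uP; apply: H; right.
Qed.

Lemma closed_sterm (E : fieldType) n (ts : seq (sterm E n)) :
  zariski_closed [set g : 'M[E]_n |
    forall t, List.In t ts -> sval_ idfun (fun=> g) (fun=> 0) t = 0].
Proof.
exists (map (@spolm _ _) ts); apply/seteqP; split=> g /=;
  exact: (zero_locus_spolm idfun ts g).2 || exact: (zero_locus_spolm idfun ts g).1.
Qed.

(* X is covered by the disjoint closed sets chi = 1 and 1 + ... + chi^(N-1) = 0. *)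
Lemma connected_finite_order (C : numFieldType) n (X : set 'M[C]_n) (h : 'M[C]_n)
    (m : 'rV[int]_n) (N : nat) :
  h \in unitmx -> (0 < N)%N -> zariski_connected X -> X 1%:M ->
  (forall g, X g -> \det g = 1 /\ is_diag_mx (h *m g *m invmx h)) ->
  (forall g, X g -> zmon m (dv h g) ^+ N = 1) ->
  forall g, X g -> zmon m (dv h g) = 1.
Proof.
move=> hu N0 [_ Xc] X1 Xd XN.
pose u := zterm h 0 m.
have uE g : X g -> sval_ idfun (fun=> g) (fun=> 0) u = zmon m (dv h g).
  move=> Xg; have [d1 dg] := Xd _ Xg.
  by rewrite sval_zterm ?map_mx_id.
pose t1 := SAdd u (SCst n (-1)).
pose t2 := SSum (iota 0 N) (SExp u).
have t1E g : X g -> sval_ idfun (fun=> g) (fun=> 0) t1 = zmon m (dv h g) - 1.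
  by move=> Xg; rewrite /= uE.
have t2E g : X g ->
    sval_ idfun (fun=> g) (fun=> 0) t2 = \sum_(i < N) zmon m (dv h g) ^+ i.
  move=> Xg; rewrite sval_SSum -[in iota 0 N](subn0 N) -/(index_iota 0 N) big_mkord.
  by apply: eq_bigr => i _; rewrite sval_SExp uE.
have cover g : X g -> sval_ idfun (fun=> g) (fun=> 0) t1 = 0 \/
    sval_ idfun (fun=> g) (fun=> 0) t2 = 0.
  move=> Xg; rewrite t1E // t2E //.
  have := subrX1 (zmon m (dv h g)) N; rewrite XN // subrr => /esym/eqP.
  by rewrite mulf_eq0 => /orP[/eqP|/eqP]; [left|right].
have one1 : zmon m (dv h 1%:M) = 1.
  have -> : dv h 1%:M = const_mx 1 by rewrite -{1}(cdiag1 hu) cdiagK.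
  by rewrite /zmon big1 // => i _; rewrite mxE exp1rz.
case: (Xc _ _ (closed_sterm [:: t1]) (closed_sterm [:: t2])).
- move=> g Xg; case: (cover g Xg) => H; [left|right] => t /=; by move=> [<-|].
- apply/seteqP; split=> g //= [[Xg H1] H2].
  have := H2 _ (or_introl erefl); have := H1 _ (or_introl erefl).
  rewrite t1E // t2E // => /eqP; rewrite subr_eq0 => /eqP ->.
  rewrite (eq_bigr (fun=> 1)); last by move=> i _; rewrite expr1n.
  by rewrite sumr_const card_ord => /eqP; rewrite pnatr_eq0 -leqn0 leqNgt N0.
- move=> H g Xg; have := H _ Xg _ (or_introl erefl).
  by rewrite t1E // => /eqP; rewrite subr_eq0 => /eqP.
- move=> H; have := H _ X1 _ (or_introl erefl).
  rewrite t2E // one1 (eq_bigr (fun=> 1)); last by move=> i _; rewrite expr1n.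
  by rewrite sumr_const card_ord => /eqP; rewrite pnatr_eq0 -leqn0 leqNgt N0.
Qed.

(** A monomial change of coordinates. Composition corresponds to the product of exponent matrices,
    so a unimodular U gives an automorphism of the diagonal torus. *)
Definition zmap (L : fieldType) n (U : 'M[int]_n) (x : 'rV[L]_n) : 'rV[L]_n :=
  \row_k zmon (row k U) x.

Section Zmap.
Variables (L : fieldType) (n : nat).
Implicit Types (U V : 'M[int]_n) (x : 'rV[L]_n).

Lemma zmap_neq0 U x : (forall i, x 0 i != 0) -> forall i, zmap U x 0 i != 0.
Proof. by move=> x0 i; rewrite mxE zmon_neq0. Qed.

Lemma zmon_zmap (m : 'rV[int]_n) U x : (forall i, x 0 i != 0) ->
  zmon m (zmap U x) = zmon (m *m U) x.
Proof.
move=> x0; rewrite zmon_mulmx //.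
by apply: eq_bigr => k _; rewrite mxE.
Qed.

Lemma zmap_zmap U V x : (forall i, x 0 i != 0) ->
  zmap U (zmap V x) = zmap (U *m V) x.
Proof. by move=> x0; apply/rowP => k; rewrite !mxE zmon_zmap // row_mul. Qed.

Lemma zmap1 x : zmap 1%:M x = x.
Proof.
apply/rowP => k; rewrite mxE /zmon (bigD1 k) //= !mxE eqxx expr1z big1 ?mulr1 //.
by move=> i ik; rewrite !mxE eq_sym (negbTE ik) expr0z.
Qed.

End Zmap.

(** * Rational curves in monomial sets *)

Section RationalCurve.
Variables (C : numFieldType) (w : {poly C}).

(** Rational functions with poles at most at the roots of w, with cleared denominators; at those
    roots g is arbitrary. *)
Definition ratl (g : C -> C) := exists (q : {poly C}) (N : nat),
  forall t, w.[t] != 0 -> g t * w.[t] ^+ N = q.[t].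

Lemma ratl_ext g g' : (forall t, w.[t] != 0 -> g t = g' t) -> ratl g -> ratl g'.
Proof. by move=> gg [q [N H]]; exists q, N => t wt; rewrite -gg ?H. Qed.

Lemma ratl_poly (p : {poly C}) : ratl (fun t => p.[t]).
Proof. by exists p, 0%N => t _; rewrite expr0 mulr1. Qed.

Lemma ratl_cst c : ratl (fun=> c).
Proof. by apply: ratl_ext (ratl_poly c%:P) => t _; rewrite hornerC. Qed.

Lemma ratlD g g' : ratl g -> ratl g' -> ratl (fun t => g t + g' t).
Proof.
move=> [q [N H]] [q' [N' H']]; exists (q * w ^+ N' + q' * w ^+ N), (N + N')%N.
by move=> t wt; rewrite !hornerE -H // -H' // exprD; ring.
Qed.

Lemma ratlM g g' : ratl g -> ratl g' -> ratl (fun t => g t * g' t).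
Proof.
move=> [q [N H]] [q' [N' H']]; exists (q * q'), (N + N')%N.
by move=> t wt; rewrite !hornerE -H // -H' // exprD; ring.
Qed.

Lemma ratl_sum (I : Type) (l : seq I) P (F : I -> C -> C) :
  (forall i, ratl (F i)) -> ratl (fun x => \sum_(i <- l | P i) F i x).
Proof.
move=> H; elim: l => [|i l IH].
  by apply: ratl_ext (ratl_cst 0) => x _; rewrite big_nil.
have [Pi|Pi] := boolP (P i); last first.
  by apply: ratl_ext IH => x _; rewrite big_cons (negbTE Pi).
by apply: ratl_ext (ratlD (H i) IH) => x _; rewrite big_cons Pi.
Qed.

Lemma ratl_prod (I : Type) (l : seq I) P (F : I -> C -> C) :
  (forall i, ratl (F i)) -> ratl (fun x => \prod_(i <- l | P i) F i x).
Proof.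
move=> H; elim: l => [|i l IH].
  by apply: ratl_ext (ratl_cst 1) => x _; rewrite big_nil.
have [Pi|Pi] := boolP (P i); last first.
  by apply: ratl_ext IH => x _; rewrite big_cons (negbTE Pi).
by apply: ratl_ext (ratlM (H i) IH) => x _; rewrite big_cons Pi.
Qed.

Lemma ratlX g m : ratl g -> ratl (fun x => g x ^+ m).
Proof.
move=> H; elim: m => [|m IH].
  by apply: ratl_ext (ratl_cst 1) => x _; rewrite expr0.
by apply: ratl_ext (ratlM H IH) => x _; rewrite exprS.
Qed.

Lemma ratlV (p p' : {poly C}) : w = p * p' -> ratl (fun t => p.[t]^-1).
Proof.
move=> wE; exists p', 1%N => t wt; move: wt; rewrite wE hornerM expr1.
by rewrite mulf_eq0 negb_or => /andP[pt _]; rewrite mulKf.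
Qed.

Lemma exists_nonroot (p : {poly C}) : p != 0 -> exists t, p.[t] != 0.
Proof.
move=> p0; apply: contrapT => H.
have H' t : p.[t] = 0 by apply/eqP; apply: contrapT => /negP h; apply: H; exists t.
pose s := [seq i%:R : C | i <- iota 0 (size p)].
have := max_poly_roots p0 (rs := s).
rewrite size_map size_iota ltnn; case/(_ _ _)/negP => //.
  by apply/allP => x _; rewrite rootE H'.
by rewrite map_inj_uniq ?iota_uniq // => i j /eqP; rewrite eqr_nat => /eqP.
Qed.

End RationalCurve.

(* Two points of a monomial set are joined by a rational curve inside it. *)
Lemma monomial_connected (C : numFieldType) n (h : 'M[C]_n) (U : 'M[int]_n)
    (I0 : pred 'I_n) :
  h \in unitmx -> U \in unitmx ->
  zariski_connected [set cdiag h x | x in [set x : 'rV[C]_n |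
    (forall i, x 0 i != 0) /\ forall k, I0 k -> zmon (row k U) x = 1]].
Proof.
move=> hu Uu; split.
  exists (cdiag h (const_mx 1)); exists (const_mx 1) => //; split.
    by move=> i; rewrite mxE oner_neq0.
  by move=> k _; rewrite /zmon big1 // => i _; rewrite mxE exp1rz.
move=> _ _ [P1 ->] [P2 ->] cover _.
apply: contrapT => /not_orP[/existsNP[_ /not_implyP[[x [x0 xI] <-] nP1]]].
move=> /existsNP[_ /not_implyP[[y [y0 yI] <-] nP2]].
move: nP1 nP2 => /existsNP[p1 /not_implyP[p1P /eqP n1]].
move=> /existsNP[p2 /not_implyP[p2P /eqP n2]].
(* In the coordinates [zmap U] the relations say that the coordinates in I0 are 1, and the line
   through zx and zy preserves this. Where w is nonzero its points are invertible, and [invmx U]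
   brings them back into the set. *)
pose zx := zmap U x; pose zy := zmap U y.
pose zt k : {poly C} := (zx 0 k)%:P + (zy 0 k - zx 0 k) *: 'X.
pose w := \prod_k zt k.
pose z t : 'rV[C]_n := \row_k (zt k).[t].
pose phi t := zmap (invmx U) (z t).
have ztE t k : (zt k).[t] = zx 0 k + (zy 0 k - zx 0 k) * t.
  by rewrite /zt !hornerE.
have z0 : z 0 = zx by apply/rowP => k; rewrite mxE ztE mulr0 addr0.
have z1 : z 1 = zy by apply/rowP => k; rewrite mxE ztE mulr1 addrC subrK.
have phi0 : phi 0 = x by rewrite /phi z0 zmap_zmap // mulVmx // zmap1.
have phi1 : phi 1 = y by rewrite /phi z1 zmap_zmap // mulVmx // zmap1.
have wE t : w.[t] = \prod_k z t 0 k.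
  by rewrite /w horner_prod; apply: eq_bigr => k _; rewrite mxE.
have w0 : w.[0] != 0.
  by rewrite wE z0; apply/prodf_neq0 => k _; apply: zmap_neq0.
have w1 : w.[1] != 0.
  by rewrite wE z1; apply/prodf_neq0 => k _; apply: zmap_neq0.
have phiX t : w.[t] != 0 -> [set cdiag h x | x in [set x : 'rV[C]_n |
    (forall i, x 0 i != 0) /\ forall k, I0 k -> zmon (row k U) x = 1]]
    (cdiag h (phi t)).
  rewrite wE => /prodf_neq0 zn0; exists (phi t) => //; split.
    by apply: zmap_neq0 => k; apply: zn0.
  move=> k Ik; have := zmap_zmap U (invmx U) (fun k => zn0 k isT).
  rewrite mulmxV // zmap1 => /rowP /(_ k); rewrite !mxE => ->.
  by rewrite ztE !mxE xI // yI // subrr mul0r addr0.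
have ratl_phi j : ratl w (fun t => phi t 0 j).
  apply: (@ratl_ext _ _ (fun t => \prod_k (zt k).[t] ^ (invmx U j k))).
    by move=> t _; rewrite mxE; apply: eq_bigr => k _; rewrite !mxE.
  apply: ratl_prod => k; case: (invmx U j k) => m.
    by apply: ratlX; apply: ratl_poly.
  apply: (@ratl_ext _ _ (fun t => (zt k).[t]^-1 ^+ m.+1)).
    by move=> t _; rewrite NegzE -exprnN exprVn.
  by apply/ratlX/ratlV; rewrite /w (bigD1 k).
have ratl_peval (p : mxpol C n) : ratl w (fun t => peval idfun p (cdiag h (phi t))).
  apply: ratl_sum => m; apply: ratlM; first exact: ratl_cst.
  apply: ratl_prod => k; apply: ratlX; case/mxvec_indexP: k => i j.
  apply: (@ratl_ext _ _ (fun t => \sum_k (invmx h i k * phi t 0 k) * h k j)).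
    move=> t _; rewrite mxvecE mxE; apply: eq_bigr => k _; congr (_ * _).
    by rewrite mul_mx_diag [RHS]mxE.
  apply: ratl_sum => k; apply: ratlM; last exact: ratl_cst.
  by apply: ratlM => //; exact: ratl_cst.
have [q1 [N1 E1]] := ratl_peval p1; have [q2 [N2 E2]] := ratl_peval p2.
have q1n0 : q1 != 0.
  apply/eqP => q10; have := E1 0 w0; rewrite phi0 q10 horner0 => /eqP.
  by rewrite mulf_eq0 (negbTE n1) expf_eq0 (negbTE w0) andbF.
have q2n0 : q2 != 0.
  apply/eqP => q20; have := E2 1 w1; rewrite phi1 q20 horner0 => /eqP.
  by rewrite mulf_eq0 (negbTE n2) expf_eq0 (negbTE w1) andbF.
have wn0 : w != 0 by apply: contraNneq w0 => ->; rewrite horner0.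
(* At a point that is no root of q1 q2 w neither p1 nor p2 vanishes on the curve, although the curve
   is there covered by the two closed sets. *)
have [t] := exists_nonroot (mulf_neq0 (mulf_neq0 q1n0 q2n0) wn0).
rewrite !hornerM mulf_eq0 negb_or => /andP[]; rewrite mulf_eq0 negb_or.
move=> /andP[q1t q2t] wt; case: (cover _ (phiX t wt)) => /=.
  move=> /(_ p1 p1P) H; move: q1t; rewrite -E1 // H mul0r eqxx //.
by move=> /(_ p2 p2P) H; move: q2t; rewrite -E2 // H mul0r eqxx.
Qed.

(** Over K[i] the matrix is hermitian, so the spectral theorem diagonalizes it with eigenvalues in
    K. The product of X - d over the distinct eigenvalues d annihilates it already over K, so the
    minimal polynomial splits with simple roots. *)
Lemma symmetric_diagonalizable (K : rcfType) n (A : 'M[K]_n) :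
  A^T = A -> diagonalizable A.
Proof.
case: n A => [|n] A AT.
  exists 1%:M; rewrite ?unitmx1 //; apply/diagonalizable_forPex.
  by exists 0; apply/eqP/matrixP => -[].
pose rc := real_complex K; pose B := map_mx rc A.
have Bh : B \is hermsymmx.
  apply/is_hermitianmxP; rewrite expr0 scale1r /B -[in LHS]AT.
  by apply/matrixP => i j; rewrite !mxE; apply/esym; exact: conjc_real.
have Breal := hermitian_spectral_diag_real Bh.
have BE := orthomx_spectralP (hermitian_normalmx Bh).
set P := spectralmx B in BE; set sd := spectral_diag B in Breal BE.
have Pu : P \in unitmx by exact: spectral_unit.
have [d Hd] : exists d : 'rV[K]_n.+1, sd = map_mx rc d.
  exists (map_mx (@complex.Re K) sd); apply/rowP => i; rewrite !mxE.
  have /mxOverP /(_ 0 i) := Breal; case: (sd 0 i) => a b /=.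
  by rewrite complex_real => /eqP /= ->.
apply/diagonalizableP; exists (undup [seq d 0 i | i : 'I_n.+1]); first exact: undup_uniq.
apply: mxminpoly_min; set p := \prod_(_ <- _) _.
apply: (@map_mx_inj _ _ rc); rewrite map_horner_mx -/B BE map_mx0.
rewrite horner_mx_uconjC // horner_mx_diag Hd.
have -> : map_mx (horner (map_poly rc p)) (map_mx rc d) = 0.
  apply/rowP => i; rewrite !mxE horner_map /=.
  suff /eqP -> : p.[d 0 i] == 0 by rewrite rmorph0.
  rewrite /p -rootE root_prod_XsubC mem_undup.
  by apply/mapP; exists i; rewrite ?mem_enum.
by rewrite raddf0 mulmx0 mul0mx.
Qed.

(** * Maximality of the torus *)

Lemma peval_comp (E : nzRingType) (L M : comNzRingType) (f : E -> L)
    (u : {rmorphism L -> M}) n (p : mxpol E n) (g : 'M[L]_n) :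
  peval (fun x => u (f x)) p (map_mx u g) = u (peval f p g).
Proof.
rewrite /peval /mpoly.mmap rmorph_sum; apply: eq_bigr => m _.
rewrite rmorphM /mpoly.mmap1 rmorph_prod; congr (_ * _).
by apply: eq_bigr => k _; rewrite rmorphXn /= -map_mxvec mxE.
Qed.

Lemma zero_locus_map (E : nzRingType) (L M : fieldType) (f : E -> L)
    (u : {rmorphism L -> M}) n (P : seq (mxpol E n)) (g : 'M[L]_n) :
  zero_locus (fun x => u (f x)) P (map_mx u g) <-> zero_locus f P g.
Proof.
split=> H p pP; have := H p pP; rewrite peval_comp; last by move=> ->; rewrite rmorph0.
by move/eqP; rewrite fmorph_eq0 => /eqP.
Qed.

Lemma map_cdiag (L M : fieldType) (u : {rmorphism L -> M}) n (h : 'M[L]_n) x :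
  map_mx u (cdiag h x) = cdiag (map_mx u h) (map_mx u x).
Proof. by rewrite /cdiag !map_mxM map_invmx map_diag_mx. Qed.

Lemma map_dv (L M : fieldType) (u : {rmorphism L -> M}) n (h g : 'M[L]_n) :
  dv (map_mx u h) (map_mx u g) = map_mx u (dv h g).
Proof.
apply/rowP => i; rewrite [LHS]mxE -map_invmx -!map_mxM [LHS]mxE [RHS]mxE.
by congr (u _); rewrite [RHS]mxE.
Qed.

Lemma zmon_pow (L : fieldType) n (m v : 'I_n -> int) (a : L) : a != 0 ->
  zmon (\row_j m j) (\row_j a ^ v j) = a ^ (\sum_j m j * v j).
Proof.
move=> a0; rewrite (big_morph (exprz a) (fun x y => expfzDr x y a0) (expr0z a)).
by apply: eq_bigr => j _; rewrite !mxE exprz_exp mulrC.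
Qed.

Lemma zmon_lattice (L : fieldType) n (U : 'M[int]_n) (I0 : pred 'I_n) m
    (x : 'rV[L]_n) : U \in unitmx -> (forall i, x 0 i != 0) ->
  (forall k, ~~ I0 k -> (m *m invmx U) 0 k = 0) ->
  (forall k, I0 k -> zmon (row k U) x = 1) -> zmon m x = 1.
Proof.
move=> Uu x0 Hm HU; rewrite -(mulmxKV Uu m) zmon_mulmx // big1 // => k _.
have [/HU->|/Hm->] := boolP (I0 k); first by rewrite exp1rz.
by rewrite expr0z.
Qed.

Lemma sum_sqr_gt0 (K : realDomainType) n (v : 'rV[K]_n) : v != 0 ->
  0 < (v *m v^T) 0 0.
Proof.
move=> v0; rewrite mxE lt_neqAle eq_sym; apply/andP; split; last first.
  by apply: sumr_ge0 => k _; rewrite mxE -expr2 sqr_ge0.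
apply: contraNneq v0 => H; apply/eqP/rowP => k; rewrite mxE.
have /eqP : \sum_k v 0 k * v^T k 0 = 0 by exact: H.
rewrite psumr_eq0; last by move=> j _; rewrite mxE -expr2 sqr_ge0.
by move=> /allP /(_ k (mem_index_enum _)) /=; rewrite mxE -expr2 sqrf_eq0 => /eqP.
Qed.

Lemma unitmx_row_neq0 (K : fieldType) n (h : 'M[K]_n) i :
  h \in unitmx -> row i h != 0.
Proof.
move=> hu; apply/eqP => h0; have /matrixP /(_ i i) := mulmxV hu.
rewrite !mxE eqxx big1 => [/eqP|j _]; first by rewrite eq_sym oner_eq0.
by have /rowP /(_ j) := h0; rewrite !mxE => ->; rewrite mul0r.
Qed.

(** Row i of h is a left eigenvector v, and |v g^T|^2 = d_i |v|^2. *)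
Lemma gram_eigenvalue_gt0 (K : realFieldType) n (h g : 'M[K]_n) (d : 'rV[K]_n) i :
  h \in unitmx -> g \in unitmx -> g^T *m g = cdiag h d -> 0 < d 0 i.
Proof.
move=> hu gu E; pose v := row i h.
have vE : v *m (g^T *m g) = d 0 i *: v.
  rewrite E /cdiag -row_mul !mulmxA mulmxV // mul1mx row_mul row_diag_mx.
  by rewrite -scalemxAl -rowE.
have vn0 : v != 0 by exact: unitmx_row_neq0.
have un0 : v *m g^T != 0.
  apply: contraNneq vn0 => v0; rewrite -(mulmxK (_ : g^T \in unitmx) v) ?v0 ?mul0mx //.
  by rewrite unitmx_tr.
have := sum_sqr_gt0 un0; rewrite trmx_mul trmxK !mulmxA -(mulmxA v) vE.
by rewrite -scalemxAl mxE pmulr_lgt0 // sum_sqr_gt0.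
Qed.

Lemma similar_diagE (K : fieldType) n (k A : 'M[K]_n) : k \in unitmx ->
  similar_diag k A = is_diag_mx (k *m A *m invmx k).
Proof. by move=> ku; rewrite /similar_to conjumx. Qed.

Section MonomialTorus.
Variables (C : numFieldType) (n : nat) (h : 'M[C]_n) (U : 'M[int]_n) (I0 : pred 'I_n).
Hypothesis hu : h \in unitmx.

Definition mon_torus : set 'M[C]_n := [set cdiag h x | x in [set x : 'rV[C]_n |
    (forall i, x 0 i != 0) /\ forall k, I0 k -> zmon (row k U) x = 1]].

Lemma mon_torus_subgroup : mx_subgroup mon_torus.
Proof.
have tM x y : mon_torus x -> mon_torus y -> mon_torus (x *m y).
  move=> [a [a0 aI] <-] [b [b0 bI] <-]; rewrite cdiagM //.
  exists (rv_mul a b) => //; split=> [i|k Ik]; first by rewrite mxE mulf_neq0.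
  by rewrite zmonM aI // bI // mulr1.
split=> //.
- rewrite -(cdiag1 hu); exists (const_mx 1) => //; split.
    by move=> i; rewrite mxE oner_neq0.
  by move=> k _; rewrite /zmon big1 // => i _; rewrite mxE exp1rz.
- move=> _ [a [a0 _] <-]; rewrite unitmxE det_cdiag // unitfE.
  by apply/prodf_neq0.
- move=> _ [a [a0 aI] <-]; exists (\row_j (a 0 j)^-1).
    split=> [i|k Ik]; first by rewrite mxE invr_neq0.
    rewrite -[RHS](invr1) -(aI _ Ik) /zmon -prodfV.
    by apply: eq_bigr => j _; rewrite mxE exprz_inv invr_expz.
  have au : cdiag h a \in unitmx.
    by rewrite unitmxE det_cdiag // unitfE; apply/prodf_neq0.
  rewrite -[LHS](mulKmx au) cdiagM //.
  have -> : rv_mul a (\row_j (a 0 j)^-1) = const_mx 1.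
    by apply/rowP => j; rewrite !mxE divff.
  by rewrite cdiag1 // mulmx1.
Qed.

End MonomialTorus.

Section Tori.
Local Opaque peval.
Variables (K : rcfType) (n : nat) (PG PS : seq (mxpol K n)).
Notation rc := (real_complex K).
Notation C := (K[i]).
Hypothesis hG : connected_semisimple_in_SL PG.
Hypothesis hGT : self_adjoint PG.
Hypothesis hS : maximal_split_torus PS PG.
Hypothesis hST : forall s, geom_points PS s -> s = s^T.
Variable h : 'M[K]_n.
Hypothesis hu : h \in unitmx.
Hypothesis hd : forall s, geom_points PS s ->
  is_diag_mx (map_mx rc h *m s *m invmx (map_mx rc h)).
Notation hC := (map_mx rc h).

Lemma real_geom (P : seq (mxpol K n)) (g : 'M[K]_n) :
  geom_points P (map_mx rc g) <-> zero_locus idfun P g.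
Proof. exact: (@zero_locus_map K K C idfun rc). Qed.

Lemma torus_det s : geom_points PS s -> \det s = 1.
Proof.
by have [_ SG _] := hS; have [_ Gdet _ _] := hG; move=> /SG /Gdet.
Qed.

Lemma cdiag_neq0 (L : fieldType) (k : 'M[L]_n) x : k \in unitmx ->
  \det (cdiag k x) = 1 -> forall i, x 0 i != 0.
Proof.
move=> ku; rewrite det_cdiag // => H i.
by have := oner_neq0 L; rewrite -H => /prodf_neq0; exact.
Qed.

Lemma hCu : hC \in unitmx. Proof. by rewrite map_unitmx. Qed.

(* The cocharacters of S at 2. *)
Lemma separating_elements : exists sl : seq 'M[K]_n,
  (forall s, s \in sl -> zero_locus idfun PS s /\ exists2 d, s = cdiag h d &
    forall i, 0 < d 0 i) /\
  forall i j, (forall s, s \in sl -> dv h s 0 i = dv h s 0 j) ->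
    forall s, geom_points PS s -> dv hC s 0 i = dv hC s 0 j.
Proof.
have [[[S1 Su SM SV] Scon _] SG _] := hS.
pose X := [set x | geom_points PS (cdiag hC x)].
have Xn0 x : X x -> forall i, x 0 i != 0.
  by move=> /torus_det; apply: cdiag_neq0; exact: hCu.
have [U [I0 [Uu IU [N N0 UI]]]] := relation_lattice Xn0.
have {}UI k x : I0 k -> X x -> zmon (row k U) x = 1.
  move=> Ik Xx; rewrite -(cdiagK hCu x).
  apply: (@connected_finite_order C n (geom_points PS) hC (row k U) N) => //.
  - exact: hCu.
  - by move=> g gS; split; [exact: (torus_det gS)|exact: (hd gS)].
  - move=> g gS; apply: (UI k Ik (dv hC g)).
    by rewrite /X /= (dvK hCu (hd gS)).
(* Column k of V holds the exponents of a cocharacter. For k outside I0 every relation m of S has (m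
   V)_k = 0 and therefore holds at [e k]. *)
pose V := invmx U.
pose e k : 'rV[K]_n := \row_j 2%:R ^ V j k.
have e_gt0 k j : 0 < e k 0 j by rewrite mxE exprz_gt0 // ltr0n.
exists [seq cdiag h (e k) | k <- enum 'I_n & ~~ I0 k]; split.
  move=> s /mapP[k]; rewrite mem_filter => /andP[Ik _] -> {s}; split; last first.
    by exists (e k) => // j; apply: e_gt0.
  apply/real_geom; rewrite map_cdiag.
  have eE : map_mx rc (e k) = \row_j 2%:R ^ V j k.
    by apply/rowP => j; rewrite !mxE fmorphXz rmorph_nat.
  apply: (@zero_locus_zmon _ _ _ _ _ _ X).
  - by exists (const_mx 1); rewrite /X /= cdiag1 ?hCu.
  - by move=> x y Xx Xy; rewrite /X /= -(cdiagM hCu); exact: (SM _ _ Xx Xy).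
  - exact: Xn0.
  - by [].
  - by move=> i; rewrite mxE fmorph_eq0 gt_eqF.
  move=> m /IU /(_ k Ik) mk.
  have {1}-> : m = \row_j m 0 j by apply/rowP => j; rewrite mxE.
  rewrite eE zmon_pow ?pnatr_eq0 //.
  by move: mk; rewrite mxE => ->; rewrite expr0z.
move=> i j Hij s sS.
set x := dv hC s; have sE : cdiag hC x = s := dvK hCu (hd sS).
have Xx : X x by rewrite /X /= sE.
clearbody x.
(* As 2 to an integral power determines the exponent, the hypothesis gives V i k = V j k for k
   outside I0. So x_i / x_j is a product of powers of the monomials in I0, which are 1 on S. *)
pose m : 'rV[int]_n := delta_mx 0 i - delta_mx 0 j.
have : zmon m x = 1.
  apply: (zmon_lattice (U := U) (I0 := I0)) => //; first exact: Xn0.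
    move=> k Ik; rewrite mulmxBl -!rowE !mxE.
    have /Hij : cdiag h (e k) \in [seq cdiag h (e k) | k <- enum 'I_n & ~~ I0 k].
      by apply: map_f; rewrite mem_filter Ik mem_enum.
    rewrite cdiagK // !mxE => /ieexprIz -> //; first by rewrite subrr.
    by rewrite (eqr_nat K 2 1).
  by move=> k Ik; apply: UI.
have zd k : zmon (delta_mx 0 k) x = x 0 k.
  rewrite /zmon (bigD1 k) //= mxE !eqxx expr1z big1 ?mulr1 // => l lk.
  by rewrite mxE (negbTE lk) andbF expr0z.
rewrite zmonB; last exact: Xn0.
by rewrite !zd => /(canRL (divfK (Xn0 _ Xx j))); rewrite mul1r.
Qed.

Variable sl : seq 'M[K]_n.
Hypothesis slS : forall s, s \in sl -> zero_locus idfun PS s /\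
  exists2 d, s = cdiag h d & forall i, 0 < d 0 i.
Hypothesis sl_sep : forall i j, (forall s, s \in sl -> dv h s 0 i = dv h s 0 j) ->
    forall s, geom_points PS s -> dv hC s 0 i = dv hC s 0 j.

(** E = k h^-1 intertwines both diagonal forms of s in sl, so all columns i with E a i nonzero carry
    the same coordinate of s. By [sl_sep] this persists on S, and the nonzero column j a of row a
    supplies the diagonal coordinate in the basis k. *)
Lemma codiag_torus (k : 'M[K]_n) : k \in unitmx ->
  (forall s, s \in sl -> is_diag_mx (k *m s *m invmx k)) ->
  forall s, geom_points PS s ->
    is_diag_mx (map_mx rc k *m s *m invmx (map_mx rc k)).
Proof.
move=> ku kd s sS; set kC := map_mx rc k.
have kCu : kC \in unitmx by rewrite map_unitmx.
pose E := k *m invmx h; have Eu : E \in unitmx by rewrite unitmx_mul ku unitmx_inv.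
have [j Hj] : exists j : 'I_n -> 'I_n, forall i, E i (j i) != 0.
  suff H i : exists j, E i j != 0 by have [j] := choice H; exists j.
  apply: contrapT => H; have /eqP[] := unitmx_row_neq0 i Eu.
  apply/rowP => l; rewrite !mxE; apply/eqP; apply: contrapT => /negP H'.
  by apply: H; exists l; rewrite mxE.
set x := dv hC s; have sE : cdiag hC x = s := dvK hCu (hd sS).
pose y : 'rV[C]_n := \row_i x 0 (j i).
have EC : map_mx rc E *m diag_mx x = diag_mx y *m map_mx rc E.
  rewrite mul_mx_diag mul_diag_mx; apply/matrixP => a b; rewrite [LHS]mxE [RHS]mxE.
  have [E0|En0] := eqVneq (E a b) 0.
    by rewrite mxE E0 rmorph0 mul0r mulr0.
  rewrite mulrC; congr (_ * _); rewrite [RHS]mxE; apply: sl_sep => // t tsl.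
  have [_ [d tE _]] := slS tsl; rewrite tE cdiagK //.
  pose c := dv k t; have : k *m t = diag_mx c *m k.
    by rewrite -{1}(dvK ku (kd _ tsl)) /cdiag !mulmxA mulmxV // mul1mx.
  rewrite tE /cdiag !mulmxA => /(congr1 (mulmx^~ (invmx h))).
  rewrite mulmxK // -(mulmxA (diag_mx c)) -/E mul_mx_diag mul_diag_mx => /matrixP H.
  have Hn i : E a i != 0 -> d 0 i = c 0 a.
    move=> Ei; have := H a i; rewrite [LHS]mxE [RHS]mxE mulrC => /mulIf; exact.
  by rewrite !Hn.
have -> : kC *m s *m invmx kC = diag_mx y; last exact: diag_mx_is_diag.
have kCE : kC = map_mx rc E *m hC by rewrite -map_mxM /E mulmxKV.
rewrite -sE /cdiag !mulmxA {1}kCE mulmxK ?hCu // EC -(mulmxA (diag_mx y)) -kCE.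
by rewrite mulmxK.
Qed.

Theorem centralizer_gram (g : 'M[K]_n) : zero_locus idfun PG g ->
  (forall s, s \in sl -> g *m s = s *m g) ->
  zero_locus idfun PS (g^T *m g) /\ forall i, 0 < dv h (g^T *m g) 0 i.
Proof.
move=> gG gsl; set q := g^T *m g.
have [[G1 Gu GM GV] Gdet _ _] := hG.
have [[[S1 Su SM SV] Scon _] SG Smax] := hS.
have gGC : geom_points PG (map_mx rc g) by apply/real_geom.
have qGC : geom_points PG (map_mx rc q).
  by rewrite map_mxM -map_trmx; exact: (GM _ _ (hGT gGC) gGC).
have gu : g \in unitmx by have := Gu _ gGC; rewrite map_unitmx.
have qT : q^T = q by rewrite /q trmx_mul trmxK.
have slT s : s \in sl -> s^T = s.
  move=> /slS[/real_geom/hST + _]; rewrite map_trmx => H; apply/esym.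
  by apply: (@map_mx_inj _ _ rc).
have qsl s : s \in sl -> q *m s = s *m q.
  move=> ssl; rewrite /q -mulmxA gsl // !mulmxA; congr (_ *m _).
  by have := congr1 trmx (gsl _ ssl); rewrite !trmx_mul slT // => ->.
(* The basis h is not known to diagonalize q, so the group generated by q and S is studied in a
   common eigenbasis k. *)
have [k ku /andP[/= kq /allP ksl]] : codiagonalizable (q :: sl).
  apply/codiagonalizableP; split.
    move=> A B; rewrite !inE => /orP[/eqP->|Asl] /orP[/eqP->|Bsl] //.
    - exact: qsl.
    - by apply/esym; apply: qsl.
    have [_ [a -> _]] := slS Asl; have [_ [b -> _]] := slS Bsl.
    exact: cdiag_comm.
  move=> A; rewrite inE => /orP[/eqP->|Asl]; first exact: symmetric_diagonalizable.
  have [_ [a -> _]] := slS Asl; exists h => //.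
  by rewrite similar_diagE // cdiag_diag.
have {}kq : is_diag_mx (k *m q *m invmx k) by rewrite -similar_diagE.
have {}ksl s : s \in sl -> is_diag_mx (k *m s *m invmx k).
  by move=> /ksl /= H; rewrite -similar_diagE.
have kS := codiag_torus ku ksl.
set kC := map_mx rc k in kS.
have kCu : kC \in unitmx by rewrite map_unitmx.
set d := dv k q; have qE : cdiag k d = q by rewrite dvK.
have d_gt0 i : 0 < d 0 i by apply: (gram_eigenvalue_gt0 _ ku gu); rewrite -/q qE.
set dC := map_mx rc d; have qEC : map_mx rc q = cdiag kC dC by rewrite -qE map_cdiag.
pose dk m : 'rV[C]_n := \row_i (dC 0 i) ^+ m.
have dkE m : cdiag kC (dk m.+1) = map_mx rc q *m cdiag kC (dk m).
  rewrite qEC (cdiagM kCu); congr (cdiag _ _).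
  by apply/rowP => i; rewrite !mxE exprS.
have dkG m : geom_points PG (cdiag kC (dk m)).
  elim: m => [|m IH]; last by rewrite dkE; exact: (GM _ _ qGC IH).
  have -> : dk 0%N = const_mx 1 by apply/rowP => i; rewrite !mxE expr0.
  by rewrite cdiag1.
(* Relations of a semigroup are enough for [zero_locus_zmon], so only natural powers of q occur. *)
pose X := [set x | exists m y, geom_points PS (cdiag kC y) /\ x = rv_mul (dk m) y].
have XG x : X x -> geom_points PG (cdiag kC x).
  by move=> [m [y [yS ->]]]; rewrite -(cdiagM kCu); exact: (GM _ _ (dkG m) (SG _ yS)).
have Xn0 x : X x -> forall i, x 0 i != 0.
  by move=> /XG/Gdet; apply: cdiag_neq0.
have XM x y : X x -> X y -> X (rv_mul x y).
  move=> [a [x' [xS ->]]] [b [y' [yS ->]]].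
  exists (a + b)%N, (rv_mul x' y'); split; first by rewrite -(cdiagM kCu); exact: (SM _ _ xS yS).
  by apply/rowP => i; rewrite !mxE exprD; ring.
have SX y : geom_points PS (cdiag kC y) -> X y.
  by move=> yS; exists 0%N, y; split=> //; apply/rowP => i; rewrite !mxE expr0 mul1r.
have [U [I0 [Uu IU [N N0 UI]]]] := relation_lattice Xn0.
pose Y := mon_torus kC U I0.
(* The determinant is itself a monomial relation of X; hence Y has determinant 1, as the adjugates
   in [zterm] require. *)
have one_det (x : 'rV[C]_n) : (forall i, x 0 i != 0) -> (forall k, I0 k -> zmon (row k U) x = 1) ->
    \prod_i x 0 i = 1.
  move=> x0 xI; rewrite -zmon_const; apply: (zmon_lattice (U := U) (I0 := I0)) => //.
  apply: IU => y Xy; rewrite zmon_const.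
  by rewrite -(det_cdiag kCu); apply/Gdet/XG.
(* Equations with coefficients in K for Y, which make it a competitor of S: diagonal in the basis k,
   determinant 1, and the monomials of I0 equal to 1. *)
pose ts : seq (sterm K n) :=
  [seq eterm k 0 ij.1 ij.2 | ij <- enum {: 'I_n * 'I_n} & ij.1 != ij.2] ++
  SAdd (SDet (MVar _ _ 0)) (SCst n (-1)) ::
  [seq SAdd (zterm k 0 (row i U)) (SCst n (-1)) | i <- enum 'I_n & I0 i].
pose PS' := map (@spolm K n) ts.
have PS'P s : geom_points PS' s <->
    forall t, List.In t ts -> sval_ rc (fun=> s) (fun=> 0) t = 0.
  exact: zero_locus_spolm.
have PS'Y : geom_points PS' = Y.
  apply/seteqP; split=> s.
    move=> /PS'P H.
    have sdiag : is_diag_mx (kC *m s *m invmx kC).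
      apply/is_diag_mxP => i j ij.
      rewrite -[LHS]/((map_mx rc k *m s *m invmx (map_mx rc k)) i j).
      rewrite -(sval_eterm k rc (fun=> s) (fun=> 0) 0%N i j).
      apply: H; apply: List.in_or_app; left.
      have : (i, j) \in [seq ij <- enum {: 'I_n * 'I_n} | ij.1 != ij.2].
        by rewrite mem_filter /= ij mem_enum.
      elim: [seq _ <- _ | _] => //= a l IH; rewrite inE => /orP[/eqP <-|/IH]; by [left|right].
    have sdet : \det s = 1.
      apply/eqP; rewrite -subr_eq0; apply/eqP; rewrite -[RHS](H (SAdd (SDet (MVar _ _ 0)) (SCst n (-1)))) /=.
        by rewrite rmorphN1.
      by apply: List.in_or_app; right; left.
    exists (dv kC s); last by rewrite dvK.
    split; first by apply: (cdiag_neq0 kCu); rewrite dvK.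
    move=> i Ii.
    have : sval_ rc (fun=> s) (fun=> 0) (SAdd (zterm k 0 (row i U)) (SCst n (-1))) = 0.
      apply: H; apply: List.in_or_app; right; right.
      have : i \in [seq i <- enum 'I_n | I0 i] by rewrite mem_filter Ii mem_enum.
      elim: [seq _ <- _ | _] => //= a l IH; rewrite inE => /orP[/eqP <-|/IH]; by [left|right].
    by rewrite /= sval_zterm // rmorphN1 => /eqP; rewrite subr_eq0 => /eqP.
  move=> [x [x0 xI] <-]; apply/PS'P => t ht.
  have [] := List.in_app_or _ _ _ ht => {ht}.
    have : all (fun ij => ij.1 != ij.2)
       [seq ij <- enum {: 'I_n * 'I_n} | ij.1 != ij.2] by exact: filter_all.
    elim: [seq _ <- _ | _] => //= a l IH /andP[a12 al] [<-|]; last exact: IH.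
    rewrite -[LHS]/(sval_ rc (fun=> cdiag kC x) (fun=> 0) (eterm k 0 a.1 a.2)).
    rewrite sval_eterm; have /is_diag_mxP := cdiag_diag kCu x.
    exact.
  have xdet : \det (cdiag kC x) = 1 by rewrite det_cdiag // one_det.
  move=> [<-|]; first by rewrite /= xdet rmorphN1 subrr.
  have : all I0 [seq i <- enum 'I_n | I0 i] by exact: filter_all.
  elim: [seq _ <- _ | _] => //= a l IH /andP[Ia al] [<-|]; last exact: IH.
  by rewrite /= sval_zterm ?cdiag_diag // cdiagK // xI // rmorphN1 subrr.
(* On X these monomials are only N-th roots of unity; on the connected group S they are 1. *)
have UI' i x : I0 i -> geom_points PS (cdiag kC x) -> zmon (row i U) x = 1.
  move=> Ii xS; rewrite -(cdiagK kCu x).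
  apply: (@connected_finite_order C n (geom_points PS) kC (row i U) N) => //.
  - by move=> s sS; split; [exact: (torus_det sS)|exact: (kS s sS)].
  - move=> s sS; apply: (UI i Ii (dv kC s)).
    by apply: SX; rewrite (dvK kCu (kS s sS)).
have PS_PS' : geom_points PS' = geom_points PS.
  apply: Smax.
  - split; first by rewrite PS'Y; apply: mon_torus_subgroup.
      by rewrite PS'Y; apply: monomial_connected.
    exists k => // s; rewrite PS'Y => -[x _ <-]; exact: cdiag_diag.
  - rewrite PS'Y => _ [x [x0 xI] <-].
    apply: (@zero_locus_zmon _ _ _ _ _ _ X) => //.
      by exists (const_mx 1); apply: SX; rewrite cdiag1.
    by move=> m /IU mU; apply: (zmon_lattice (U := U) (I0 := I0)).
  - rewrite PS'Y => s sS; have sE : cdiag kC (dv kC s) = s := dvK kCu (kS s sS).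
    exists (dv kC s) => //.
    split; first by apply: (cdiag_neq0 kCu); rewrite sE; apply: torus_det.
    by move=> i Ii; apply: UI' => //; rewrite sE.
have qS : geom_points PS (map_mx rc q).
  rewrite -PS_PS' PS'Y qEC; exists dC => //; split.
    by move=> i; rewrite mxE fmorph_eq0 gt_eqF.
  move=> i Ii.
  have XdC : X dC.
    exists 1%N, (const_mx 1); split; first by rewrite cdiag1.
    by apply/rowP => j; rewrite !mxE expr1 mulr1.
  have zE : zmon (row i U) dC = rc (zmon (row i U) d).
    by rewrite /zmon rmorph_prod; apply: eq_bigr => j _; rewrite fmorphXz mxE.
  have := UI i Ii _ XdC; rewrite zE -rmorphXn -[RHS](rmorph1 rc) => /fmorph_inj.
  (* For q positivity takes the place of connectedness: a positive root of unity is 1. *)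
  have z_gt0 : 0 < zmon (row i U) d.
    by apply: prodr_gt0 => j _; rewrite exprz_gt0.
  move=> /eqP; rewrite pexpr_eq1 ?ltW // => /eqP ->; exact: rmorph1.
split; first by apply/real_geom.
move=> i; apply: (gram_eigenvalue_gt0 _ hu gu); rewrite dvK //.
have := hd qS; rewrite -map_invmx -!map_mxM => /is_diag_mxP H.
apply/is_diag_mxP => a b ab; have := H a b ab; rewrite mxE => /eqP.
by rewrite fmorph_eq0 => /eqP.
Qed.

End Tori.

(** * Matrix exponential *)

Section MatrixNorm.
Variables (R : realFieldType) (n : nat).
Implicit Types A B : 'M[R]_n.

Definition l1 A : R := \sum_i \sum_j `|A i j|.

Lemma l1_ge0 A : 0 <= l1 A.
Proof. by apply: sumr_ge0 => i _; apply: sumr_ge0. Qed.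

Lemma l1_entry A i j : `|A i j| <= l1 A.
Proof.
rewrite /l1 (bigD1 i) //= (bigD1 j) //= -addrA lerDl.
by apply: addr_ge0; apply: sumr_ge0 => // k _; apply: sumr_ge0.
Qed.

Lemma l1D A B : l1 (A + B) <= l1 A + l1 B.
Proof.
rewrite /l1 -big_split; apply: ler_sum => i _; rewrite -big_split /=.
by apply: ler_sum => j _; rewrite mxE ler_normD.
Qed.

Lemma l1Z c A : l1 (c *: A) = `|c| * l1 A.
Proof.
rewrite /l1 mulr_sumr; apply: eq_bigr => i _; rewrite mulr_sumr.
by apply: eq_bigr => j _; rewrite mxE normrM.
Qed.

Lemma l1N A : l1 (- A) = l1 A.
Proof. by rewrite -scaleN1r l1Z normrN1 mul1r. Qed.

Lemma l1_0 : l1 0 = 0.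
Proof. by rewrite -(scale0r 0) l1Z normr0 mul0r. Qed.

Lemma l1_sum (I : Type) (r : seq I) (P : pred I) (F : I -> 'M[R]_n) :
  l1 (\sum_(i <- r | P i) F i) <= \sum_(i <- r | P i) l1 (F i).
Proof.
elim/big_rec2: _ => [|i x A _ IH]; first by rewrite l1_0.
by apply: le_trans (l1D _ _) _; rewrite lerD2l.
Qed.

Lemma l1M A B : l1 (A *m B) <= l1 A * l1 B.
Proof.
rewrite [X in X * _]/l1 mulr_suml; apply: ler_sum => i _.
apply: (@le_trans _ _ (\sum_j \sum_k `|A i k| * `|B k j|)).
  apply: ler_sum => j _; rewrite mxE; apply: le_trans (ler_norm_sum _ _ _) _.
  by apply: ler_sum => k _; rewrite normrM.
rewrite exchange_big mulr_suml; apply: ler_sum => k _ /=.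
rewrite -mulr_sumr ler_wpM2l // /l1 [leRHS](bigD1 k) //= lerDl.
by apply: sumr_ge0 => l _; apply: sumr_ge0.
Qed.

Lemma l1X A k : l1 (A ^+ k.+1) <= l1 A ^+ k.+1.
Proof.
elim: k => [|k IH]; first by rewrite !expr1.
rewrite exprS [leRHS]exprS; apply: le_trans (l1M _ _) _.
by rewrite ler_wpM2l // l1_ge0.
Qed.

Lemma l1_mul1D U M : l1 ((1 + U) *m M) <= (1 + l1 U) * l1 M.
Proof.
rewrite mulmxDl mul1mx mulrDl mul1r; apply: le_trans (l1D _ _) _.
by rewrite lerD2l l1M.
Qed.

(** A telescoping sum. As [l1] of the identity is n rather than 1, multiplication by A is estimated
    as multiplication by 1 + (A - 1), at the cost of a factor 1 + c. *)
Lemma l1_exprB A B c : l1 (A - 1) <= c -> l1 (B - 1) <= c -> forall m,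
  l1 (A ^+ m.+1 - B ^+ m.+1) <= m.+1%:R * (1 + c) ^+ m * l1 (A - B).
Proof.
move=> Ac Bc; have c0 : 0 <= c by apply: le_trans (l1_ge0 _) Ac.
have mulBl k M : l1 (M *m B ^+ k) <= (1 + c) ^+ k * l1 M.
  elim: k M => [|k IH] M; first by rewrite expr0 mulmx1 mul1r.
  rewrite exprS mulmxA; apply: le_trans (IH _) _.
  rewrite exprSr -mulrA ler_wpM2l ?exprn_ge0 ?addr_ge0 //.
  have -> : M *m B = M + M *m (B - 1) by rewrite mulmxBr mulmx1 addrC subrK.
  apply: le_trans (l1D _ _) _; rewrite mulrDl mul1r lerD2l mulrC.
  by apply: le_trans (l1M _ _) _; rewrite ler_wpM2l ?l1_ge0.
elim=> [|m IH]; first by rewrite !expr1 expr0 !mul1r.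
have -> : A ^+ m.+2 - B ^+ m.+2 =
    (1 + (A - 1)) *m (A ^+ m.+1 - B ^+ m.+1) + (A - B) *m B ^+ m.+1.
  have -> : 1 + (A - 1) = A by rewrite addrC subrK.
  by rewrite mulmxBr mulmxBl addrA subrK !(exprS _ m.+1).
apply: le_trans (l1D _ _) _; rewrite -[m.+2]addn1 natrD !mulrDl mul1r.
apply: lerD; last exact: mulBl.
apply: le_trans (l1_mul1D _ _) _.
apply: (@le_trans _ _ ((1 + c) * (m.+1%:R * (1 + c) ^+ m * l1 (A - B)))).
  by apply: ler_pM; rewrite ?l1_ge0 ?addr_ge0 ?l1_ge0 ?lerD2l.
rewrite exprS le_eqVlt; apply/orP; left; apply/eqP; ring.
Qed.

End MatrixNorm.

Definition mcvg (R : realType) m n (u : nat -> 'M[R]_(m, n)) (l : 'M[R]_(m, n)) :=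
  forall i j, (fun k => u k i j) @ \oo --> l i j.

Section MatrixCvg.
Variable R : realType.

Lemma mcvg_cst m n (A : 'M[R]_(m, n)) : mcvg (fun=> A) A.
Proof. by move=> i j; apply: cvg_cst. Qed.

Lemma mcvg_unique m n (u : nat -> 'M[R]_(m, n)) l l' : mcvg u l -> mcvg u l' -> l = l'.
Proof.
move=> ul ul'; apply/matrixP => i j.
by apply: (cvg_unique _ (ul i j) (ul' i j)); exact: Rhausdorff.
Qed.

Lemma cvg_bigsum (I : Type) (r : seq I) (P : pred I) (F : I -> nat -> R) (l : I -> R) :
  (forall i, P i -> F i @ \oo --> l i) ->
  (fun k => \sum_(i <- r | P i) F i k) @ \oo --> \sum_(i <- r | P i) l i.
Proof. by move=> H; apply: cvg_big => //; exact: add_continuous. Qed.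

Lemma mcvgM m n p (u : nat -> 'M[R]_(m, n)) (v : nat -> 'M[R]_(n, p)) l l' :
  mcvg u l -> mcvg v l' -> mcvg (fun k => u k *m v k) (l *m l').
Proof.
move=> ul vl i j; rewrite mxE.
under eq_fun do rewrite mxE.
by apply: cvg_bigsum => k _; apply: cvgM.
Qed.

Lemma mcvgT m n (u : nat -> 'M[R]_(m, n)) l :
  mcvg u l -> mcvg (fun k => (u k)^T) l^T.
Proof. by move=> ul i j; rewrite mxE; under eq_fun do rewrite mxE; apply: ul. Qed.

Lemma mcvg_peval n (E : nzRingType) (f : E -> R) (p : mxpol E n) u l :
  mcvg u l -> (fun k => peval f p (u k)) @ \oo --> peval f p l.
Proof.
move=> ul; apply: cvg_bigsum => m _; apply: cvgM; first exact: cvg_cst.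
rewrite /mpoly.mmap1; apply: cvg_big => [|k _]; first exact: mul_continuous.
elim: (_ k) => [|d IH]; first by under eq_fun do rewrite expr0; exact: cvg_cst.
under eq_fun do rewrite exprS; rewrite exprS; apply: cvgM => //.
by case/mxvec_indexP: k {IH} => i j; rewrite mxvecE; under eq_fun do rewrite mxvecE; apply: ul.
Qed.

Lemma mcvg_zero_locus n (E : nzRingType) (f : E -> R) (P : seq (mxpol E n)) u l :
  mcvg u l -> (forall k, zero_locus f P (u k)) -> zero_locus f P l.
Proof.
move=> ul uP p pP; have := @mcvg_peval _ _ f p _ _ ul.
under eq_fun do rewrite uP //; move=> H.
by apply: (cvg_unique _ H (cvg_cst _)); exact: Rhausdorff.
Qed.

Lemma mcvg_l1 n (u v : nat -> 'M[R]_n) l c :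
  (forall k, l1 (u k - v k) <= c * (k.+1%:R)^-1) -> mcvg v l -> mcvg u l.
Proof.
move=> uv vl i j.
suff : (fun k => u k i j - v k i j) @ \oo --> (0 : R).
  move=> H; have H2 := cvgD H (vl i j); rewrite add0r in H2.
  have -> : (fun k => u k i j) = (fun k => u k i j - v k i j) \+ (fun k => v k i j).
    by apply/funext => k; rewrite /= subrK.
  exact: H2.
have c0 : (fun k => c * (k.+1%:R : R)^-1) @ \oo --> (0 : R).
  by rewrite -(mulr0 c); apply: cvgM; [exact: cvg_cst|exact: cvg_harmonic].
apply: (@squeeze_cvgr _ _ _ _ (fun k => - (c * (k.+1%:R)^-1)) (fun k => c * (k.+1%:R)^-1)) => //.
  apply: nearW => k; rewrite -ler_norml.
  have := l1_entry (u k - v k) i j; rewrite !mxE => H.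
  exact: le_trans H (uv k).
by rewrite -oppr0; apply: cvgN.
Qed.

End MatrixCvg.

Section MatrixExp.
Variables (R : realType) (n : nat).
Implicit Types X Y Z A : 'M[R]_n.

Definition psum (X : 'M[R]_n) m : 'M[R]_n := \sum_(k < m) (k`!%:R)^-1 *: X ^+ k.

Lemma psum_exp (x : R) m : 0 <= x -> \sum_(k < m) (k`!%:R)^-1 * x ^+ k <= expR x.
Proof.
move=> x0; have := @nondecreasing_cvgn_le _ (series (exp_coeff x)) _
  (is_cvg_series_exp_coeff x) m.
rewrite /series /= /exp_coeff /= big_mkord => H.
under eq_bigr do rewrite mulrC.
apply: H => a b ab; rewrite -(subnKC ab) /index_iota !subn0 iotaD big_cat /= lerDl.
by apply: sumr_ge0 => k _; rewrite divr_ge0 ?exprn_ge0.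
Qed.

Lemma expmx_cvg X : mcvg (psum X) (expmx X).
Proof.
move=> i j; rewrite mxE.
have -> : (fun m => psum X m i j) = series (fun k => (k`!%:R)^-1 * (X ^+ k) i j).
  apply/funext => m; rewrite /psum summxE /series /= big_mkord.
  by apply: eq_bigr => k _; rewrite mxE.
apply: normed_cvg.
apply: (@series_le_cvg _ _ (fun k => (n%:R + 1) * exp_coeff (l1 X) k)) => [k|k|k|].
- by rewrite /= normr_ge0.
- by rewrite /exp_coeff /= mulr_ge0 ?addr_ge0 // divr_ge0 // exprn_ge0 // l1_ge0.
- rewrite /= normrM ger0_norm ?invr_ge0 // mulrC /exp_coeff /= mulrA.
  rewrite ler_wpM2r ?invr_ge0 //; case: k => [|k] /=.
    rewrite !expr0 mulr1 mxE (le_trans (_ : _ <= 1)) ?lerDr //.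
    by case: eqP; rewrite ?normr1 ?normr0.
  apply: le_trans (l1_entry _ _ _) _; apply: le_trans (l1X _ _) _.
  by rewrite mulrDl mul1r lerDr mulr_ge0 // exprn_ge0 // l1_ge0.
have -> : series (fun k => (n%:R + 1) * exp_coeff (l1 X) k) =
    (fun k => (n%:R + 1) * series (exp_coeff (l1 X)) k).
  by apply/funext => k; rewrite /series /= mulr_sumr.
by apply: is_cvgMl_tmp; exact: is_cvg_series_exp_coeff.
Qed.

(** The bound on the tails passes to the limit entry by entry; summing over the entries costs the
    factor n * n. *)
Lemma expmx_remainder X d : (0 < d)%N ->
  l1 (expmx X - psum X d) <= n%:R * n%:R * (l1 X ^+ d * expR (l1 X)).
Proof.
case: d => // d _.
have tail m : (d < m)%N -> l1 (psum X m - psum X d.+1) <= l1 X ^+ d.+1 * expR (l1 X).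
  move=> dm; have -> : psum X m - psum X d.+1 =
      \sum_(k < m - d.+1) ((d.+1 + k)`!%:R)^-1 *: X ^+ (d.+1 + k).
    rewrite /psum -!(big_mkord xpredT (fun k => (k`!%:R)^-1 *: X ^+ k)).
    rewrite (big_cat_nat (n := d.+1)) //= addrAC subrr add0r.
    by rewrite -{1}(add0n d.+1) big_addn big_mkord; apply: eq_bigr => k _; rewrite addnC.
  apply: le_trans (l1_sum _ _ _) _.
  apply: (@le_trans _ _ (l1 X ^+ d.+1 * \sum_(k < m - d.+1) (k`!%:R)^-1 * l1 X ^+ k)); last first.
    by rewrite ler_wpM2l ?exprn_ge0 ?l1_ge0 // psum_exp // l1_ge0.
  rewrite mulr_sumr; apply: ler_sum => k _.
  rewrite l1Z ger0_norm ?invr_ge0 // mulrCA -exprD; apply: ler_pM.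
  - by rewrite invr_ge0.
  - exact: l1_ge0.
  - rewrite lef_pV2 ?posrE ?ltr0n ?fact_gt0 // ler_nat.
    by apply: leq_fact; rewrite leq_addl.
  - by rewrite addSn l1X.
have H i j : `|(expmx X - psum X d.+1) i j| <= l1 X ^+ d.+1 * expR (l1 X).
  have subE (A B : 'M[R]_n) : (A - B) i j = A i j - B i j.
    by rewrite [LHS]mxE [X in _ + X]mxE.
  have cv : (fun m => psum X m i j - psum X d.+1 i j) @ \oo -->
      expmx X i j - psum X d.+1 i j.
    by apply: cvgB; [exact: expmx_cvg|exact: cvg_cst].
  rewrite subE; apply: (cvgr_to_le (cvg_norm cv)); exists d.+1 => // m /= dm.
  by have := le_trans (l1_entry _ i j) (tail m dm); rewrite subE.
rewrite /l1; apply: (@le_trans _ _ (\sum_(i < n) \sum_(j < n) (l1 X ^+ d.+1 * expR (l1 X)))).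
  by apply: ler_sum => i _; apply: ler_sum => j _; apply: H.
by rewrite !sumr_const !card_ord -mulrnA -[in leLHS]mulr_natl natrM.
Qed.

Lemma bernoulli (y : R) m : 0 <= y -> y <= 1 -> 1 - m%:R * y <= (1 - y) ^+ m.
Proof.
move=> y0 y1; elim: m => [|m IH]; first by rewrite mul0r subr0 expr0.
rewrite exprS; apply: le_trans (_ : _ <= (1 - y) * (1 - m%:R * y)) _; last first.
  by rewrite ler_wpM2l // subr_ge0.
have : 0 <= m%:R * y * y by rewrite !mulr_ge0.
rewrite -(addn1 m) natrD; lra.
Qed.

(** Put x = z / M. Then (1 + x) e^(-x) >= 1 - x^2, and by Bernoulli its M-th power is at least 1 - M
    x^2 = 1 - z^2 / M. For x > 1 the right-hand side is already at least e^z. *)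
Lemma expR_compound (z : R) m : 0 <= z ->
  expR z - (1 + z / m.+1%:R) ^+ m.+1 <= expR z * z ^+ 2 / m.+1%:R.
Proof.
move=> z0; set M : R := m.+1%:R; have M0 : 0 < M by rewrite ltr0n.
pose x := z / M; have x0 : 0 <= x by rewrite divr_ge0 // ltW.
have [x1|x1] := lerP x 1; last first.
  apply: (@le_trans _ _ (expR z)).
    by rewrite lerBlDr lerDl exprn_ge0 // addr_ge0.
  rewrite -mulrA ler_peMr ?expR_ge0 // expr2 -mulrA -/x.
  have zM : M <= z by move: x1; rewrite /x ltr_pdivlMr // mul1r => /ltW.
  have M1 : 1 <= M by rewrite ler1n.
  apply: le_trans (_ : _ <= 1 * 1) _; first by rewrite mulr1.
  by apply: ler_pM => //; [exact: le_trans M1 zM|exact: ltW].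
have E1 : 1 - x ^+ 2 <= (1 + x) * expR (- x).
  have -> : 1 - x ^+ 2 = (1 + x) * (1 - x) by ring.
  by rewrite ler_wpM2l ?addr_ge0 // expR_ge1Dx.
have E2 : 1 - M * x ^+ 2 <= (1 + x) ^+ m.+1 * expR (- z).
  have -> : expR (- z) = expR (- x) ^+ m.+1.
    rewrite -expRM_natl; congr expR; rewrite /x -/M; field; exact: lt0r_neq0.
  rewrite -exprMn; apply: le_trans (bernoulli _ _ _) _.
  - by rewrite exprn_ge0.
  - by rewrite exprn_ile1.
  - apply: ler_pM2l_exp || (apply: lerXn2r; rewrite ?nnegrE ?subr_ge0 ?exprn_ile1 //).
    by rewrite mulr_ge0 ?addr_ge0 ?expR_ge0.
have E3 : (1 - M * x ^+ 2) * expR z <= (1 + x) ^+ m.+1.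
  rewrite -ler_pdivlMr ?expR_gt0 // -expRN; exact: E2.
have E4 : M * x ^+ 2 = z ^+ 2 / M by rewrite /x; field; exact: lt0r_neq0.
rewrite lerBlDr -lerBlDl -mulrA -E4.
by apply: le_trans E3; rewrite mulrBl mul1r mulrC.
Qed.

Lemma bin_fact_le m k : ('C(m, k) * k`! <= m ^ k)%N.
Proof.
rewrite bin_ffact; elim: k m => [|k IH] m; first by rewrite ffactn0.
case: m => [|m]; first by rewrite ffact0n.
rewrite ffactSS expnS leq_mul2l; apply: leq_trans (IH m) _.
by rewrite leq_exp2r_or || case: k {IH} => // k; rewrite leq_exp2r.
Qed.

Lemma mx_exprZ (c : R) Z k : (c *: Z) ^+ k = c ^+ k *: Z ^+ k.
Proof.
elim: k => [|k IH]; first by rewrite !expr0 scale1r.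
by rewrite !exprS IH -mulmxE -scalemxAl -scalemxAr scalerA.
Qed.

(** The coefficients c k of the difference are nonnegative, so its norm is at most the same
    expression in the scalar [l1 Z], and [expR_compound] applies. The partial sum has as many terms,
    m.+2, as the binomial expansion. *)
Lemma l1_compound Z m : l1 ((1 + (m.+1%:R)^-1 *: Z) ^+ m.+1 - psum Z m.+2) <=
  expR (l1 Z) * l1 Z ^+ 2 / m.+1%:R.
Proof.
set M : R := m.+1%:R; have M0 : 0 < M by rewrite ltr0n.
pose c k : R := (k`!%:R)^-1 - 'C(m.+1, k)%:R / M ^+ k.
have c_ge0 k : 0 <= c k.
  rewrite subr_ge0 ler_pdivrMr ?exprn_gt0 // mulrC ler_pdivlMr ?ltr0n ?fact_gt0 //.
  by rewrite -natrX -natrM ler_nat bin_fact_le.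
have c0 : c 0%N = 0 by rewrite /c fact0 bin0 expr0 divr1 invr1 subrr.
have E : psum Z m.+2 - (1 + M^-1 *: Z) ^+ m.+1 = \sum_(k < m.+2) c k *: Z ^+ k.
  rewrite /psum [1 + _]addrC exprD1n -sumrB; apply: eq_bigr => k _.
  by rewrite scalerBl mx_exprZ scalerMnl exprVn mulr_natl.
have E' : \sum_(k < m.+2) (k`!%:R)^-1 * l1 Z ^+ k - (1 + l1 Z / M) ^+ m.+1 =
    \sum_(k < m.+2) c k * l1 Z ^+ k.
  rewrite [1 + _]addrC exprD1n -sumrB; apply: eq_bigr => k _.
  rewrite mulrBl exprMn exprVn; congr (_ - _).
  by rewrite -[LHS]mulr_natl mulrA mulrAC.
rewrite -l1N opprB E; apply: le_trans (l1_sum _ _ _) _.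
apply: (@le_trans _ _ (\sum_(k < m.+2) c k * l1 Z ^+ k)).
  apply: ler_sum => -[[|k] kP] _ /=; first by rewrite c0 scale0r l1_0 mul0r.
  by rewrite l1Z ger0_norm // ler_wpM2l // l1X.
rewrite -E'; apply: le_trans (expR_compound _ (l1_ge0 _)).
by rewrite lerD2r psum_exp // l1_ge0.
Qed.

(** Knowing g m up to order 1 / m^2 identifies the limit of the powers; [expmxN] and the product
    formula in [lieD] follow with no products of series. *)
Lemma compound_cvg (g : nat -> 'M[R]_n) Z (c : R) :
  (forall m, l1 (g m - 1 - (m.+1%:R)^-1 *: Z) <= c / m.+1%:R ^+ 2) ->
  mcvg (fun m => g m ^+ m.+1) (expmx Z).
Proof.
move=> Hg; have c0 : 0 <= c.
  by have := le_trans (l1_ge0 _) (Hg 0%N); rewrite expr1n divr1.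
apply: (@mcvg_l1 _ _ _ (fun m => psum Z m.+2) _
  (c * expR (l1 Z + c) + expR (l1 Z) * l1 Z ^+ 2)); last first.
  move=> i j; have := @expmx_cvg Z i j; rewrite -(cvg_shiftn 2) /=.
  by under eq_fun do rewrite addn2.
move=> m; set M : R := m.+1%:R; have M0 : 0 < M by rewrite ltr0n.
have M1 : 1 <= M by rewrite ler1n.
pose B := 1 + M^-1 *: Z.
have -> : g m ^+ m.+1 - psum Z m.+2 = (g m ^+ m.+1 - B ^+ m.+1) +
   (B ^+ m.+1 - psum Z m.+2) by rewrite addrA subrK.
apply: le_trans (l1D _ _) _; rewrite mulrDl; apply: lerD; last exact: l1_compound.
have cM : c / M ^+ 2 <= c / M.
  by rewrite ler_wpM2l // lef_pV2 ?posrE ?exprn_gt0 // expr2 ler_peMl.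
pose u := (l1 Z + c) / M.
have HB : l1 (B - 1) <= u.
  rewrite /B addrC addKr l1Z ger0_norm ?invr_ge0 ?(ltW M0) // [leLHS]mulrC /u.
  by rewrite ler_wpM2r ?invr_ge0 ?(ltW M0) // lerDl.
have HA : l1 (g m - 1) <= u.
  rewrite -[g m - 1](subrK (M^-1 *: Z)); apply: le_trans (l1D _ _) _.
  rewrite l1Z ger0_norm ?invr_ge0 ?(ltW M0) // /u mulrDl addrC; apply: lerD.
    by rewrite [leLHS]mulrC.
  exact: le_trans (Hg m) cM.
apply: le_trans (l1_exprB HA HB m) _.
have HAB : l1 (g m - B) <= c / M ^+ 2.
  by rewrite /B opprD addrA; exact: Hg.
have u0 : 0 <= u by rewrite divr_ge0 ?addr_ge0 ?l1_ge0 // ltW.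
have Hu : (1 + u) ^+ m <= expR (l1 Z + c).
  apply: (@le_trans _ _ (expR u ^+ m.+1)).
    apply: (@le_trans _ _ ((1 + u) ^+ m.+1)).
      by rewrite exprS ler_peMl ?exprn_ge0 ?addr_ge0 // lerDl.
    by apply: lerXn2r; rewrite ?nnegrE ?addr_ge0 ?expR_ge0 // expR_ge1Dx.
  rewrite -expRM_natl -/M /u mulrC divfK //; exact: lt0r_neq0.
apply: (@le_trans _ _ (M * expR (l1 Z + c) * (c / M ^+ 2))).
  apply: ler_pM => //; rewrite ?l1_ge0 ?mulr_ge0 ?exprn_ge0 ?addr_ge0 ?(ltW M0) //.
  by rewrite ler_wpM2l // ltW.
rewrite le_eqVlt; apply/orP; left; apply/eqP.
by field; exact: lt0r_neq0.
Qed.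

Lemma expmx0 : expmx 0 = 1%:M :> 'M[R]_n.
Proof.
apply: (@mcvg_unique R n n (psum 0)); first exact: expmx_cvg.
move=> i j; rewrite -(cvg_shiftn 1) /=.
have H k : psum 0 (k + 1) i j = (1%:M : 'M[R]_n) i j.
  rewrite /psum addn1 big_ord_recl expr0 invr1 scale1r big1 ?addr0 // => l _.
  by rewrite exprS mul0r scaler0.
by under eq_fun do rewrite H; exact: cvg_cst.
Qed.

Lemma compound1_cvg Z : mcvg (fun m => (1 + (m.+1%:R)^-1 *: Z) ^+ m.+1) (expmx Z).
Proof.
apply: (@compound_cvg _ _ 0) => m.
by rewrite [1 + _]addrC addrK subrr l1_0 mul0r.
Qed.

Lemma expmxN Z : expmx Z *m expmx (- Z) = 1%:M.
Proof.
have H := mcvgM (@compound1_cvg Z) (@compound1_cvg (- Z)).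
apply: (mcvg_unique H) => {H}.
rewrite -expmx0.
(* The product of the two factors is 1 - (Z / M)^2, which differs from 1 only to second order: the
   limit is exp 0. *)
have -> : (fun k => (1 + k.+1%:R^-1 *: Z) ^+ k.+1 *m (1 + k.+1%:R^-1 *: - Z) ^+ k.+1) =
  (fun k => (1 - (k.+1%:R^-1 *: Z) ^+ 2) ^+ k.+1).
  apply/funext => k; rewrite -[LHS]/(_ * _) scalerN -exprMn_comm.
    by rewrite -[in RHS](expr1n _ 2) subr_sqr_1 || congr (_ ^+ _);
       rewrite mulrBr mulr1 mulrDl mul1r opprD addrA addrK expr2.
  by apply: commrD; [exact: commr1|apply: commrN; apply/commr_sym/commrD; [exact: commr1|exact: commr_refl]].
apply: (@compound_cvg _ _ (l1 Z ^+ 2)) => m.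
rewrite scaler0 subr0 addrAC subrr add0r l1N mx_exprZ l1Z.
rewrite ger0_norm ?exprn_ge0 ?invr_ge0 // mulrC exprVn ler_wpM2r ?invr_ge0 ?exprn_ge0 //.
exact: l1X.
Qed.

Lemma expmx_tr X : (expmx X)^T = expmx X^T.
Proof.
have H := mcvgT (@expmx_cvg X); apply: (mcvg_unique H) => {H}.
have -> : (fun k => (psum X k)^T) = psum X^T; last exact: expmx_cvg.
apply/funext => k; rewrite /psum raddf_sum; apply: eq_bigr => l _ /=.
rewrite linearZ /=; congr (_ *: _); elim: (val l) => [|d IH].
  by rewrite !expr0 trmx1.
by rewrite exprS exprSr trmx_mul IH.
Qed.

Lemma expmx_conj (u X : 'M[R]_n) : u \in unitmx ->
  expmx (u *m X *m invmx u) = u *m expmx X *m invmx u.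
Proof.
move=> uu; apply/esym.
have H := mcvgM (mcvgM (@mcvg_cst R n n u) (@expmx_cvg X)) (@mcvg_cst R n n (invmx u)).
apply: (mcvg_unique H) => {H}.
have -> : (fun k => u *m psum X k *m invmx u) = psum (u *m X *m invmx u);
  last exact: expmx_cvg.
apply/funext => k; rewrite /psum mulmx_sumr mulmx_suml; apply: eq_bigr => l _.
rewrite -scalemxAr -scalemxAl; congr (_ *: _); elim: (val l) => [|d IH].
  by rewrite !expr0 mulmx1 mulmxV.
by rewrite !exprS -IH -!mulmxE !mulmxA mulmxKV.
Qed.

Lemma expmx_cdiag (h : 'M[R]_n) (x : 'rV[R]_n) : h \in unitmx ->
  expmx (cdiag h x) = cdiag h (map_mx expR x).
Proof.
move=> hu; rewrite /cdiag -{2}(invmxK h) expmx_conj ?unitmx_inv // invmxK.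
congr (_ *m _ *m _); apply: (mcvg_unique (@expmx_cvg (diag_mx x))) => i j.
have dX k : (diag_mx x) ^+ k = diag_mx (\row_j x 0 j ^+ k).
  elim: k => [|k IH].
    rewrite expr0 -[LHS]diag_const_mx; congr diag_mx; apply/rowP => l.
    by rewrite !mxE expr0.
  rewrite exprS IH -mulmxE mulmx_diag; congr diag_mx; apply/rowP => l.
  by rewrite !mxE exprS.
have H k : psum (diag_mx x) k i j =
    (\sum_(l < k) (l`!%:R)^-1 * x 0 i ^+ l) *+ (i == j).
  rewrite /psum summxE -sumrMnl; apply: eq_bigr => l _.
  by rewrite mxE dX !mxE mulrnAr.
under eq_fun do rewrite H.
rewrite !mxE; case: eqP => _; last by rewrite mulr0n; exact: cvg_cst.
rewrite mulr1n; have := is_cvg_series_exp_coeff (x 0 i) => /cvg_ex[l Hl].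
rewrite /expR (cvg_lim _ Hl) //.
have -> : (fun k => (\sum_(l < k) (l`!%:R)^-1 * x 0 i ^+ l) *+ true) =
    series (exp_coeff (x 0 i)); last exact: Hl.
apply/funext => k; rewrite mulr1n /series /= big_mkord; apply: eq_bigr => l' _.
by rewrite /exp_coeff /= mulrC.
Qed.

End MatrixExp.

(** * Lie algebras of closed matrix groups *)

Lemma interpolation (R : fieldType) (s : seq R) (phi : R -> R) :
  exists p : {poly R}, forall x, x \in s -> p.[x] = phi x.
Proof.
elim: s => [|a s [p Hp]]; first by exists 0.
have [as_|as_] := boolP (a \in s).
  by exists p => x; rewrite inE => /orP[/eqP->|]; apply: Hp.
pose w := \prod_(b <- s) ('X - b%:P).
have wa : w.[a] != 0 by rewrite -rootE root_prod_XsubC.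
exists (p + ((phi a - p.[a]) / w.[a])%:P * w) => x.
rewrite !hornerE inE => /orP[/eqP->|xs]; first by rewrite divfK // addrC subrK.
have /rootP -> : root w x by rewrite root_prod_XsubC.
by rewrite mulr0 addr0 Hp.
Qed.

(** Entrywise multiplication in the basis h; the adjoint actions of diagonal matrices, of the group
    and of the Lie algebra, have this form. *)
Definition weight (R : fieldType) n (h : 'M[R]_n) (f : 'I_n -> 'I_n -> R)
    (X : 'M[R]_n) : 'M[R]_n :=
  invmx h *m (\matrix_(i, j) (f i j * (h *m X *m invmx h) i j)) *m h.

Section Weights.
Variables (R : fieldType) (n : nat) (h : 'M[R]_n).
Hypothesis hu : h \in unitmx.

Lemma weightE f X i j :
  (h *m weight h f X *m invmx h) i j = f i j * (h *m X *m invmx h) i j.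
Proof. by rewrite /weight !mulmxA mulmxV // mul1mx mulmxK // [LHS]mxE. Qed.

Lemma conj_inj (X Y : 'M[R]_n) :
  (forall i j, (h *m X *m invmx h) i j = (h *m Y *m invmx h) i j) -> X = Y.
Proof.
move=> H; have E : h *m X *m invmx h = h *m Y *m invmx h by apply/matrixP.
have := congr1 (fun A => invmx h *m A *m h) E.
by rewrite !mulmxA !mulVmx // !mul1mx !mulmxKV.
Qed.

Lemma conjD (X Y : 'M[R]_n) i j : (h *m (X + Y) *m invmx h) i j =
  (h *m X *m invmx h) i j + (h *m Y *m invmx h) i j.
Proof. by rewrite mulmxDr mulmxDl [LHS]mxE. Qed.

Lemma conjZ c (X : 'M[R]_n) i j : (h *m (c *: X) *m invmx h) i j =
  c * (h *m X *m invmx h) i j.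
Proof. by rewrite -scalemxAr -scalemxAl [LHS]mxE. Qed.

Lemma conj_cdiag (x : 'rV[R]_n) i j : (h *m cdiag h x *m invmx h) i j = x 0 i *+ (i == j).
Proof. by rewrite /cdiag !mulmxA mulmxV // mul1mx mulmxK // mxE. Qed.

Lemma conjMcdiag (x : 'rV[R]_n) X i j :
  (h *m (cdiag h x *m X) *m invmx h) i j = x 0 i * (h *m X *m invmx h) i j.
Proof.
by rewrite /cdiag !mulmxA mulmxV // mul1mx -!mulmxA mul_diag_mx [LHS]mxE !mulmxA.
Qed.

Lemma conjMcdiagr (x : 'rV[R]_n) X i j :
  (h *m (X *m cdiag h x) *m invmx h) i j = (h *m X *m invmx h) i j * x 0 j.
Proof.
by rewrite /cdiag !mulmxA mulmxK // mul_mx_diag [LHS]mxE.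
Qed.

Lemma invmx_cdiag (x : 'rV[R]_n) : (forall i, x 0 i != 0) ->
  invmx (cdiag h x) = cdiag h (\row_i (x 0 i)^-1).
Proof.
move=> x0; have xu : cdiag h x \in unitmx.
  by rewrite unitmxE det_cdiag // unitfE; apply/prodf_neq0.
rewrite -[RHS](mulKmx xu) cdiagM //.
have -> : rv_mul x (\row_j (x 0 j)^-1) = const_mx 1.
  by apply/rowP => j; rewrite !mxE divff.
by rewrite cdiag1 // mulmx1.
Qed.

Lemma weight_Ad (x : 'rV[R]_n) X : (forall i, x 0 i != 0) ->
  cdiag h x *m X *m invmx (cdiag h x) = weight h (fun i j => x 0 i / x 0 j) X.
Proof.
move=> x0; apply: conj_inj => i j.
by rewrite weightE invmx_cdiag // conjMcdiagr conjMcdiag [X in _ * X]mxE mulrAC.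
Qed.

End Weights.

Section LieAlgebra.
Variables (R : realType) (n : nat).
Implicit Types X Y Z : 'M[R]_n.

Lemma psum2 X : psum X 2 = 1 + X.
Proof. by rewrite /psum !big_ord_recl big_ord0 /= !invr1 !scale1r expr0 expr1 addr0. Qed.

Lemma psum3 X : psum X 3 = 1 + X + 2%:R^-1 *: (X *m X).
Proof.
by rewrite /psum !big_ord_recl big_ord0 /= !invr1 !scale1r expr0 expr1 addr0 addrA.
Qed.

Lemma expmx_remainderZ X d (s : R) : (0 < d)%N -> 0 <= s <= 1 ->
  l1 (expmx (s *: X) - psum (s *: X) d) <=
    n%:R * n%:R * (l1 X ^+ d * expR (l1 X)) * s ^+ d.
Proof.
move=> d0 /andP[s0 s1]; apply: le_trans (expmx_remainder _ d0) _.
rewrite l1Z ger0_norm // exprMn -!mulrA.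
apply: ler_wpM2l => //; apply: ler_wpM2l => //; rewrite [leRHS]mulrA [leRHS]mulrC.
apply: ler_wpM2l; first exact: exprn_ge0.
apply: ler_wpM2l; first by rewrite exprn_ge0 // l1_ge0.
by rewrite ler_expR ler_piMl // l1_ge0.
Qed.

Lemma expmx_deriv0 X :
  mcvg (fun m => m.+1%:R *: (expmx (m.+1%:R^-1 *: X) - 1%:M)) X.
Proof.
apply: (@mcvg_l1 _ _ _ (fun=> X) _ (n%:R * n%:R * (l1 X ^+ 2 * expR (l1 X)))); last first.
  exact: (@mcvg_cst R n n X).
move=> m; set M : R := m.+1%:R; have M0 : 0 < M by rewrite ltr0n.
have M01 : 0 <= M^-1 <= 1 by rewrite invr_ge0 ltW // invf_le1 // ler1n.
have -> : M *: (expmx (M^-1 *: X) - 1%:M) - X =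
    M *: (expmx (M^-1 *: X) - psum (M^-1 *: X) 2).
  by rewrite psum2 opprD addrA [RHS]scalerBr [X in _ = _ - X]scalerA divff ?lt0r_neq0 // scale1r.
rewrite l1Z ger0_norm ?(ltW M0) //.
have HX := expmx_remainderZ X (isT : 0 < 2)%N M01.
apply: (le_trans (ler_wpM2l (ltW M0) HX)).
rewrite le_eqVlt; apply/orP; left; apply/eqP; field; exact: lt0r_neq0.
Qed.

Variable G : set 'M[R]_n.
Hypothesis G1 : G 1%:M.
Hypothesis GM : forall g k, G g -> G k -> G (g *m k).
Hypothesis GV : forall g, G g -> G (invmx g).
Hypothesis Gu : forall g, G g -> g \in unitmx.
Hypothesis Gcl : forall u l, mcvg u l -> (forall k, G (u k)) -> G l.

Notation lie := (lie_algebra G).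

Lemma lieZ c X : lie X -> lie (c *: X).
Proof. by move=> HX t; rewrite scalerA; apply: HX. Qed.

Lemma GX g k : G g -> G (g ^+ k).
Proof. by move=> Gg; elim: k => [|k IH]; [rewrite expr0|rewrite exprS; apply: GM]. Qed.

(** The powers (exp (X / m) exp (Y / m))^m tend to exp (X + Y), and G is closed under limits. *)
Lemma lieD X Y : lie X -> lie Y -> lie (X + Y).
Proof.
move=> HX HY t; rewrite scalerDr; move: (t *: X) (t *: Y) (lieZ t HX) (lieZ t HY).
move=> {HX HY}X {}Y HX HY.
pose a := n%:R * n%:R * (l1 X ^+ 2 * expR (l1 X)).
pose b := n%:R * n%:R * (l1 Y ^+ 2 * expR (l1 Y)).
have a0 : 0 <= a by rewrite !mulr_ge0 ?exprn_ge0 ?l1_ge0 ?expR_ge0.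
have b0 : 0 <= b by rewrite !mulr_ge0 ?exprn_ge0 ?l1_ge0 ?expR_ge0.
pose g m := expmx (m.+1%:R^-1 *: X) *m expmx (m.+1%:R^-1 *: Y).
apply: (Gcl (u := fun m => g m ^+ m.+1)); last first.
  by move=> m; apply: GX; apply: GM; [exact: HX|exact: HY].
apply: (@compound_cvg _ _ _ _ (l1 X * l1 Y +
  (a * (l1 (1 : 'M[R]_n) + l1 Y + b) + (l1 (1 : 'M[R]_n) + l1 X) * b))) => m.
rewrite /g; set M : R := m.+1%:R; have M0 : 0 < M by rewrite ltr0n.
have M01 : 0 <= M^-1 <= 1 by rewrite invr_ge0 ltW // invf_le1 // ler1n.
have [Mp M1] := andP M01.
have := expmx_remainderZ X (isT : 0 < 2)%N M01; rewrite psum2 -/a => HE.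
have := expmx_remainderZ Y (isT : 0 < 2)%N M01; rewrite psum2 -/b => HF.
set A := expmx _ in HE *; set B := expmx _ in HF *.
set U := M^-1 *: X in HE *; set V := M^-1 *: Y in HF *.
have lU : l1 U = l1 X * M^-1 by rewrite l1Z ger0_norm // mulrC.
have lV : l1 V = l1 Y * M^-1 by rewrite l1Z ger0_norm // mulrC.
have -> : A *m B - 1 - M^-1 *: (X + Y) =
    U *m V + ((A - (1 + U)) *m B + (1 + U) *m (B - (1 + V))).
  rewrite scalerDr -/U -/V !(mulmxDl, mulmxDr, mulmxN, mulNmx, mul1mx, mulmx1, opprD).
  move: (A *m B) (U *m V) (U *m B) => P Q W; clearbody A B U V.
  by apply/matrixP => i j; rewrite !mxE; ring.
have M2 : M^-1 ^+ 2 <= M^-1 by rewrite expr2 ler_piMl.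
have HB : l1 B <= l1 (1 : 'M[R]_n) + l1 Y + b.
  have -> : B = (1 + V) + (B - (1 + V)) by rewrite addrC subrK.
  apply: le_trans (l1D _ _) _; apply: lerD.
    apply: le_trans (l1D _ _) _; rewrite lerD2l lV ler_piMr ?l1_ge0 //.
  by apply: le_trans HF _; rewrite ler_piMr // exprn_ile1.
have HU : l1 (1 + U) <= l1 (1 : 'M[R]_n) + l1 X.
  by apply: le_trans (l1D _ _) _; rewrite lerD2l lU ler_piMr ?l1_ge0.
apply: le_trans (l1D _ _) _; rewrite mulrDl; apply: lerD.
  apply: le_trans (l1M _ _) _; rewrite lU lV le_eqVlt; apply/orP; left; apply/eqP.
  by field; exact: lt0r_neq0.
apply: le_trans (l1D _ _) _; rewrite mulrDl; apply: lerD.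
  apply: le_trans (l1M _ _) _; rewrite mulrAC.
  by apply: ler_pM => //; rewrite ?l1_ge0 // -exprVn.
apply: le_trans (l1M _ _) _; rewrite -mulrA.
by apply: ler_pM => //; rewrite ?l1_ge0 // -exprVn.
Qed.

Lemma lieN X : lie X -> lie (- X).
Proof. by move=> HX; rewrite -scaleN1r; apply: lieZ. Qed.

Lemma lie0 : lie 0.
Proof. by move=> t; rewrite scaler0 expmx0. Qed.

Lemma lie_Ad g X : G g -> lie X -> lie (g *m X *m invmx g).
Proof.
move=> Gg HX t; rewrite scalemxAl scalemxAr expmx_conj; last exact: Gu.
by apply: GM; [apply: GM|apply: GV].
Qed.

(** Ad of [cdiag h x] multiplies the coordinate (i, j) by x_i / x_j, and polynomials in Ad preserve
    the Lie algebra. On the finitely many ratios phi is a polynomial. *)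
Lemma lie_weight h (x : 'rV[R]_n) (phi : R -> R) X : h \in unitmx ->
  (forall i, x 0 i != 0) -> G (cdiag h x) -> lie X ->
  lie (weight h (fun i j => phi (x 0 i / x 0 j)) X).
Proof.
move=> hu x0 Gx HX.
have [p Hp] := interpolation [seq x 0 ij.1 / x 0 ij.2 | ij : 'I_n * 'I_n] phi.
have -> : weight h (fun i j => phi (x 0 i / x 0 j)) X =
    weight h (fun i j => p.[x 0 i / x 0 j]) X.
  apply: (conj_inj hu) => i j; rewrite !weightE //; congr (_ * _).
  by rewrite Hp //; apply/fintype.imageP; exists (i, j).
elim/poly_ind: p {Hp} => [|p c IH].
  have -> : weight h (fun i j => (0 : {poly R}).[x 0 i / x 0 j]) X = 0.
    apply: (conj_inj hu) => i j; rewrite weightE // horner0 mul0r.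
    by rewrite mulmx0 mul0mx mxE.
  exact: lie0.
have -> : weight h (fun i j => (p * 'X + c%:P).[x 0 i / x 0 j]) X =
    cdiag h x *m weight h (fun i j => p.[x 0 i / x 0 j]) X *m invmx (cdiag h x)
    + c *: X.
  apply: (conj_inj hu) => i j; rewrite weight_Ad // conjD conjZ !weightE //.
  by rewrite !hornerE /=; ring.
by apply: lieD; [apply: lie_Ad|apply: lieZ].
Qed.

(** A subspace of maximal dimension inside L cannot be enlarged by an element of L, so it is L. *)
Lemma lie_vspaceP (L : set 'M[R]_n) : L 0 ->
  (forall X Y, L X -> L Y -> L (X + Y)) -> (forall c X, L X -> L (c *: X)) ->
  exists V : {vspace 'M[R]_n}, forall X, X \in V <-> L X.
Proof.
move=> L0 LD LZ.
pose good r := `[< exists V : {vspace 'M[R]_n}, (forall X, X \in V -> L X) /\ \dim V = r >].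
have ex : exists r, good r.
  exists 0%N; apply/asboolP; exists 0%VS; split; last exact: dimv0.
  by move=> X; rewrite memv0 => /eqP->.
have bnd r : good r -> (r <= \dim {: 'M[R]_n})%N.
  by move=> /asboolP[V [_ <-]]; apply: dimvS; apply: subvf.
have [r /asboolP[V [VL Vr]] rmax] := ex_maxnP ex bnd.
exists V => X; split; first exact: VL.
move=> LX; have /asboolP/rmax : exists V' : {vspace 'M[R]_n},
    (forall X, X \in V' -> L X) /\ \dim V' = \dim (V + <[X]>)%VS.
  exists (V + <[X]>)%VS; split=> // Y /memv_addP[A AV [B /vlineP[c ->] ->]].
  by apply: LD; [exact: VL|exact: LZ].
rewrite -Vr => le_r; have /eqP VE : V == (V + <[X]>)%VS.
  by rewrite eqEdim addvSl.
by rewrite VE; apply: (subvP (addvSr V <[X]>%VS)); exact: memv_line.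
Qed.

End LieAlgebra.

Lemma lie_tr (R : realType) n (G : set 'M[R]_n) X :
  (forall g, G g -> G g^T) -> lie_algebra G X -> lie_algebra G X^T.
Proof. by move=> GT HX t; rewrite -[t *: _]linearZ /= -expmx_tr; apply: GT. Qed.

(* Monomial relations among the integral powers of d persist for real powers. *)
Lemma zero_locus_power (R : realType) n (E : nzRingType) (f : E -> R)
    (P : seq (mxpol E n)) (h : 'M[R]_n) (d : 'rV[R]_n) (t : R) :
  h \in unitmx -> (forall i, 0 < d 0 i) ->
  (forall k, zero_locus f P (cdiag h (\row_i d 0 i ^+ k))) ->
  zero_locus f P (cdiag h (\row_i expR (t * ln (d 0 i)))).
Proof.
move=> hu d0 HP.
apply: (@zero_locus_cdiag _ _ _ _ _ _ [set x | exists k : nat, x = \row_i d 0 i ^+ k]).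
- by exists (\row_i d 0 i ^+ 0), 0%N.
- move=> _ _ [k ->] [l ->]; exists (k + l)%N; apply/rowP => i.
  by rewrite !mxE exprD.
- by move=> _ [k ->] i; rewrite mxE expf_neq0 // lt0r_neq0.
- by move=> _ [k ->].
move=> m m' Hm; have /Hm : [set x | exists k : nat, x = \row_i d 0 i ^+ k] d.
  by exists 1%N; apply/rowP => i; rewrite mxE expr1.
suff E' m0 : mon m0 (\row_i expR (t * ln (d 0 i))) = expR (t * ln (mon m0 d)).
  by rewrite !E' => ->.
have -> : ln (mon m0 d) = \sum_i (m0 i)%:R * ln (d 0 i).
  rewrite /mon; have : forall r : seq 'I_n, 0 < \prod_(i <- r) d 0 i ^+ m0 i /\
      ln (\prod_(i <- r) d 0 i ^+ m0 i) = \sum_(i <- r) (m0 i)%:R * ln (d 0 i).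
    elim=> [|i r [r0 IH]]; first by rewrite !big_nil ln1.
    rewrite !big_cons; have di : 0 < d 0 i ^+ m0 i by rewrite exprn_gt0.
    by rewrite mulr_gt0 // lnM ?posrE // lnXn // IH mulr_natl.
  by move=> /(_ (index_enum _))[].
rewrite mulr_sumr expR_sum; apply: eq_bigr => i _.
by rewrite mxE -expRM_natl; congr expR; ring.
Qed.

(** * Maximizing a trace over orthogonal points *)

Lemma le_mul_small (R : realFieldType) (a K : R) :
  (forall t, 0 < t -> t <= 1 -> a <= K * t) -> a <= 0.
Proof.
move=> H; rewrite leNgt; apply/negP => a0.
have K0 : 0 < K by have := H 1 ltr01 (lexx _); rewrite mulr1; apply: lt_le_trans.
pose t := Num.min 1 (a / (2 * K)).
have t0 : 0 < t by rewrite lt_min ltr01 divr_gt0 // mulr_gt0.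
have t1 : t <= 1 by rewrite ge_min lexx.
have := H t t0 t1; apply/negP; rewrite -ltNge.
apply: (@le_lt_trans _ _ (a / 2)); last by rewrite ltr_pdivrMr //; lra.
apply: (@le_trans _ _ (K * (a / (2 * K)))); first by rewrite ler_pM2l // ge_min lexx orbT.
rewrite le_eqVlt; apply/orP; left; apply/eqP; field; exact: lt0r_neq0.
Qed.

Lemma tr_l1 (R : realFieldType) n (A : 'M[R]_n) : `|\tr A| <= l1 A.
Proof.
apply: le_trans (ler_norm_sum _ _ _) _; apply: ler_sum => i _.
by rewrite (bigD1 i) //= lerDl; apply: sumr_ge0.
Qed.

Lemma tr_skew (R : comNzRingType) n (Z : 'M[R]_n) (s : R) :
  Z^T = - Z -> (s *: Z)^T = - (s *: Z).
Proof. by move=> ZT; rewrite linearZ /= ZT scalerN. Qed.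

Lemma trmx_quadratic (R : comNzRingType) n (U : 'M[R]_n) (c : R) : U^T = - U ->
  (1 + U + c *: (U *m U))^T = 1 - U + c *: (U *m U).
Proof.
move=> UT; rewrite !linearD /= linearZ /= trmx1 trmx_mul UT.
by rewrite mulmxN mulNmx opprK.
Qed.

Lemma gram_expansion (R : fieldType) n (U Y : 'M[R]_n) (c : R) :
  (1 + U + c *: (U *m U)) *m Y *m (1 - U + c *: (U *m U)) =
  Y + (U *m Y - Y *m U) +
  (c *: (U *m U *m Y) + c *: (Y *m U *m U) - U *m Y *m U) +
  (c *: (U *m Y *m U *m U) - c *: (U *m U *m Y *m U) +
   (c * c) *: (U *m U *m Y *m U *m U)).
Proof.
rewrite !(mulmxDl, mulmxDr, mulmxN, mulNmx, mul1mx, mulmx1, =^~ scalemxAl, =^~ scalemxAr).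
rewrite !mulmxA !scalerA.
move: (U *m U *m Y *m U *m U) (U *m U *m Y *m U) (U *m Y *m U *m U) => A1 A2 A3.
move: (U *m U *m Y) (Y *m U *m U) (U *m Y *m U) (U *m Y) (Y *m U) => A4 A5 A6 A7 A8.
by apply/matrixP => i j; rewrite !mxE; ring.
Qed.

Lemma l1_tr (R : realFieldType) n (A : 'M[R]_n) : l1 A^T = l1 A.
Proof.
by rewrite /l1 exchange_big; do 2!apply: eq_bigr => ? _; rewrite mxE.
Qed.

Lemma trace_expansion (R : realType) n (Z Y H : 'M[R]_n) : Z^T = - Z ->
  exists K, forall s, 0 < s -> s <= 1 ->
  `|\tr (expmx (s *: Z) *m Y *m (expmx (s *: Z))^T *m H) - (\tr (Y *m H) +
      s * \tr ((Z *m Y - Y *m Z) *m H) + s ^+ 2 *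
      (2^-1 * \tr ((Z *m (Z *m Y - Y *m Z) - (Z *m Y - Y *m Z) *m Z) *m H)))|
  <= K * s ^+ 3.
Proof.
move=> ZT; pose z := l1 Z; pose y := l1 Y; have z0 : 0 <= z := l1_ge0 _.
have y0 : 0 <= y := l1_ge0 _.
pose e := n%:R * n%:R * (z ^+ 3 * expR z).
have e0 : 0 <= e by rewrite !mulr_ge0 ?exprn_ge0 ?expR_ge0.
pose q := l1 (1 : 'M[R]_n) + z + 2^-1 * (z * z).
have q0 : 0 <= q by rewrite !addr_ge0 ?mulr_ge0 ?l1_ge0.
(* Here e bounds the Taylor remainder divided by s^3 and q the Taylor polynomial of degree 2. The
   first two terms come from the remainder on either side, the others from the degrees 3 and 4 of
   [gram_expansion], the last with s <= 1. *)
exists ((e * y * (q + e) + q * y * e +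
  (2^-1 * (z * y * z * z) + 2^-1 * (z * z * y * z) +
   2^-1 * 2^-1 * (z * z * y * z * z))) * l1 H) => s s0 s1.
have s01 : 0 <= s <= 1 by rewrite ltW.
set U := s *: Z; have lU : l1 U = s * z by rewrite l1Z ger0_norm // ltW.
have UT : U^T = - U by apply: tr_skew.
pose c : R := 2^-1; set A := expmx U.
pose Q := 1 + U + c *: (U *m U); pose E := A - Q.
have QT : Q^T = 1 - U + c *: (U *m U) by exact: trmx_quadratic.
have lE : l1 E <= e * s ^+ 3.
  have := expmx_remainderZ Z (isT : 0 < 3)%N s01; rewrite psum3; exact.
have AE : A = Q + E by rewrite /E addrC subrK.
have s2_1 : s ^+ 2 <= 1 by rewrite exprn_ile1 // ltW.
have s3_0 : 0 <= s ^+ 3 by rewrite exprn_ge0 // ltW.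
have lQ : l1 Q <= q.
  rewrite /Q /q; apply: le_trans (l1D _ _) _; apply: lerD.
    apply: le_trans (l1D _ _) _; rewrite lerD2l lU.
    by rewrite ler_piMl.
  rewrite l1Z ger0_norm ?invr_ge0 //; apply: ler_wpM2l; first by rewrite invr_ge0.
  apply: le_trans (l1M _ _) _; rewrite lU mulrACA -expr2.
  by rewrite ler_piMl // mulr_ge0.
have lA : l1 A <= q + e.
  rewrite AE; apply: le_trans (l1D _ _) _; apply: lerD => //.
  by apply: le_trans lE _; rewrite ler_piMr // exprn_ile1 // ltW.
clearbody e q.
pose R3 := c *: (U *m Y *m U *m U) - c *: (U *m U *m Y *m U) +
   (c * c) *: (U *m U *m Y *m U *m U).
pose D := Z *m (Z *m Y - Y *m Z) - (Z *m Y - Y *m Z) *m Z.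
have AYA : A *m Y *m A^T = Y + s *: (Z *m Y - Y *m Z) + s ^+ 2 *: (c *: D) +
    (E *m Y *m A^T + Q *m Y *m E^T + R3).
  have -> : A *m Y *m A^T = Q *m Y *m Q^T + (E *m Y *m A^T + Q *m Y *m E^T).
    rewrite {1}AE mulmxDl mulmxDl addrC [in RHS]addrCA; congr (_ + _).
    by rewrite AE linearD /= mulmxDr.
  rewrite {1}QT {1}/Q gram_expansion -/R3.
  have -> : U *m Y - Y *m U = s *: (Z *m Y - Y *m Z).
    by rewrite scalerBr scalemxAl scalemxAr.
  have -> : c *: (U *m U *m Y) + c *: (Y *m U *m U) - U *m Y *m U = s ^+ 2 *: (c *: D).
    rewrite /D /U !(mulmxBl, mulmxBr, =^~ scalemxAl, =^~ scalemxAr) !mulmxA.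
    rewrite !scalerA; move: (Z *m Z *m Y) (Y *m Z *m Z) (Z *m Y *m Z) => A1 A2 A3.
    by apply/matrixP => i j; rewrite !mxE /c; field.
  by rewrite -[LHS]addrA [R3 + _]addrC.
have mulS (a b a' b' : R) (X W : 'M[R]_n) : l1 X <= a -> l1 W <= b -> l1 (X *m W) <= a * b.
  by move=> Xa Wb; apply: le_trans (l1M _ _) _; apply: ler_pM; rewrite ?l1_ge0.
pose rem := E *m Y *m A^T + Q *m Y *m E^T + R3.
have -> : \tr (A *m Y *m A^T *m H) - (\tr (Y *m H) +
      s * \tr ((Z *m Y - Y *m Z) *m H) + s ^+ 2 * (2^-1 * \tr (D *m H))) = \tr (rem *m H).
  rewrite AYA -/rem; clearbody rem D.
  move: (Z *m Y - Y *m Z) => W; rewrite !mulmxDl -!scalemxAl !mxtraceD !mxtraceZ -/c.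
  by apply/eqP; rewrite subr_eq; apply/eqP; rewrite addrC.
apply: le_trans (tr_l1 _) _; apply: le_trans (l1M _ _) _.
rewrite [leRHS]mulrAC; apply: ler_wpM2r; first exact: l1_ge0.
rewrite !mulrDl /rem; apply: le_trans (l1D _ _) _; apply: lerD.
  apply: le_trans (l1D _ _) _; apply: lerD.
    have := mulS _ _ 0 0 _ _ (mulS _ _ 0 0 _ _ lE (lexx y)) (_ : l1 A^T <= q + e).
    rewrite l1_tr => /(_ lA) H1; apply: le_trans H1 _.
    by rewrite le_eqVlt; apply/orP; left; apply/eqP; ring.
  have := mulS _ _ 0 0 _ _ (mulS _ _ 0 0 _ _ lQ (lexx y)) (_ : l1 E^T <= e * s ^+ 3).
  rewrite l1_tr => /(_ lE) H1; apply: le_trans H1 _.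
  by rewrite le_eqVlt; apply/orP; left; apply/eqP; ring.
have lUz : l1 U <= s * z by rewrite lU.
have c0 : 0 <= c by rewrite invr_ge0.
have UU := mulS _ _ 0 0 _ _ lUz lUz.
have UY := mulS _ _ 0 0 _ _ lUz (lexx y).
have UUY := mulS _ _ 0 0 _ _ UU (lexx y).
have UUYU := mulS _ _ 0 0 _ _ UUY lUz.
rewrite /R3; apply: le_trans (l1D _ _) _; apply: lerD.
  apply: le_trans (l1D _ _) _; rewrite l1N; apply: lerD; rewrite l1Z ger0_norm // -/c.
    apply: le_trans (ler_wpM2l c0 (mulS _ _ 0 0 _ _ (mulS _ _ 0 0 _ _ UY lUz) lUz)) _.
    by rewrite le_eqVlt; apply/orP; left; apply/eqP; ring.
  apply: le_trans (ler_wpM2l c0 UUYU) _.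
  by rewrite le_eqVlt; apply/orP; left; apply/eqP; ring.
rewrite l1Z ger0_norm ?mulr_ge0 // -/c.
apply: le_trans (ler_wpM2l (mulr_ge0 c0 c0) (mulS _ _ 0 0 _ _ UUYU lUz)) _.
have -> : c * c * (s * z * (s * z) * y * (s * z) * (s * z)) =
    (c * c * (z * z * y * z * z) * s ^+ 3) * s by ring.
apply: ler_piMr => //; apply: mulr_ge0 => //.
by rewrite !mulr_ge0.
Qed.

(* First and second order conditions at t = 0. *)
Lemma max_conditions (R : realType) n (Z Y H : 'M[R]_n) : Z^T = - Z ->
  (forall t, \tr (expmx (t *: Z) *m Y *m (expmx (t *: Z))^T *m H) <= \tr (Y *m H)) ->
  \tr ((Z *m Y - Y *m Z) *m H) = 0 /\
  \tr ((Z *m (Z *m Y - Y *m Z) - (Z *m Y - Y *m Z) *m Z) *m H) <= 0.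
Proof.
move=> ZT Hmax.
pose a := \tr ((Z *m Y - Y *m Z) *m H).
pose b := \tr ((Z *m (Z *m Y - Y *m Z) - (Z *m Y - Y *m Z) *m Z) *m H).
have a_le0 : forall W, W^T = - W ->
    (forall t, \tr (expmx (t *: W) *m Y *m (expmx (t *: W))^T *m H) <= \tr (Y *m H)) ->
    \tr ((W *m Y - Y *m W) *m H) <= 0.
  move=> W WT WH; have [K HK] := trace_expansion Y H WT.
  pose a' := \tr ((W *m Y - Y *m W) *m H).
  pose b' := \tr ((W *m (W *m Y - Y *m W) - (W *m Y - Y *m W) *m W) *m H).
  apply: (@le_mul_small _ _ (`|K| + `|2^-1 * b'|)) => s s0 s1.
  have := HK s s0 s1; rewrite ler_norml => /andP[h1 _].
  have h2 := WH s; have sb : - `|2^-1 * b'| <= 2^-1 * b' by rewrite lerNl -normrN ler_norm.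
  rewrite -(ler_pM2l s0).
  have s2 : 0 <= s ^+ 2 by rewrite exprn_ge0 // ltW.
  have h3 := ler_wpM2l s2 sb.
  have h4 : K * s ^+ 3 <= `|K| * s ^+ 2.
    apply: (@le_trans _ _ (`|K| * s ^+ 3)).
      by apply: ler_wpM2r; [exact: exprn_ge0 (ltW s0)|exact: ler_norm].
    by apply: ler_wpM2l => //; rewrite exprS; apply: ler_piMl.
  have arith (X T a1 w w1 k k1 : R) : - (k * s ^+ 3) <= X - (T + s * a1 + s ^+ 2 * w) ->
      X <= T -> s ^+ 2 * - w1 <= s ^+ 2 * w -> k * s ^+ 3 <= k1 * s ^+ 2 ->
      s * a1 <= s * ((k1 + w1) * s).
    by rewrite !expr2; lra.
  exact: (arith _ _ _ _ _ _ _ h1 h2 h3 h4).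
have aN : \tr ((- Z *m Y - Y *m - Z) *m H) = - a.
  by rewrite mulNmx mulmxN -opprD mulNmx raddfN.
(* The one-sided bound is applied to Z and to - Z, which generate the same one-parameter group. *)
have a0 : a = 0.
  have aw : a <= 0 := a_le0 _ ZT Hmax.
  have NZT : (- Z)^T = - - Z by rewrite -{2}ZT; apply/matrixP => i j; rewrite !mxE.
  have aw' := a_le0 _ NZT; rewrite aN oppr_le0 in aw'.
  apply/eqP; rewrite eq_le aw; apply: aw' => t.
  by rewrite scalerN -scaleNr; exact: Hmax.
split=> //; have [K HK] := trace_expansion Y H ZT.
rewrite -/b; suff: 2^-1 * b <= 0 by rewrite pmulr_rle0 // invr_gt0.
apply: (@le_mul_small _ _ K) => s s0 s1.
have := HK s s0 s1; rewrite ler_norml => /andP[h1 _].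
have h2 := Hmax s; have s2 : 0 < s ^+ 2 by rewrite exprn_gt0.
rewrite -(ler_pM2l s2); move: h1 h2; rewrite -/a -/b a0.
by move: (\tr _) (\tr _) (2^-1 * b) => X T w; rewrite mulr0 addr0 !exprS expr0 !mulr1; lra.
Qed.

Lemma peval_continuous (R : realType) n (E : nzRingType) (f : E -> R) (p : mxpol E n) :
  continuous (fun v : 'rV[R]_(n * n) => peval f p (vec_mx v)).
Proof.
have -> : (fun v : 'rV[R]_(n * n) => peval f p (vec_mx v)) =
    (fun v => \sum_(m <- mpoly.msupp p) f (mpoly.mcoeff m p) *
       \prod_(i < n * n) v 0 i ^+ (mpoly.fun_of_multinom m i)).
  by apply/funext => v; rewrite /peval /mpoly.mmap /mpoly.mmap1 vec_mxK.
apply: (@continuous_big R _ +%R 0 xpredT _ _ _ (fun m (v : 'rV[R]_(n * n)) =>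
  f (mpoly.mcoeff m p) * \prod_(i < n * n) v 0 i ^+ (mpoly.fun_of_multinom m i))).
  exact: add_continuous.
move=> m _ v; apply: continuousM; first exact: cst_continuous.
move: v; apply: (@continuous_big R _ *%R 1 xpredT _ _ _ (fun i (v : 'rV[R]_(n * n)) =>
  v 0 i ^+ (mpoly.fun_of_multinom m i))).
  exact: mul_continuous.
move=> i _ v; apply: (@continuous_comp _ _ _ (fun v : 'rV[R]_(n * n) => v 0 i)
  (fun x : R => x ^+ (mpoly.fun_of_multinom m i))); first exact: coord_continuous.
exact: exprn_continuous.
Qed.

Lemma orthogonal_entry (R : realFieldType) n (k : 'M[R]_n) i j :
  k *m k^T = 1%:M -> `|k i j| <= 1.
Proof.
move=> /matrixP/(_ i i); rewrite !mxE eqxx mulr1n => H.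
rewrite -(@ler_sqr _ `|k i j| 1) ?nnegrE // expr1n -normrX ger0_norm ?sqr_ge0 //.
rewrite -H (bigD1 j) //= mxE -expr2 lerDl; apply: sumr_ge0 => l _.
by rewrite mxE -expr2 sqr_ge0.
Qed.

(** Orthogonal matrices have entries of absolute value at most 1, so these points form a compact
    set, on which a term is continuous. Matrices are flattened to row vectors, where products of
    compact sets are at hand. *)
Lemma orthogonal_max (R : realType) n (E : nzRingType) (f : E -> R)
    (P : seq (mxpol E n)) (t : sterm R n) :
  zero_locus f P 1%:M ->
  exists k, [/\ zero_locus f P k, k *m k^T = 1%:M &
    forall k', zero_locus f P k' -> k' *m k'^T = 1%:M ->
      sval_ idfun (fun=> k') (fun=> 0) t <= sval_ idfun (fun=> k) (fun=> 0) t].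
Proof.
move=> P1.
pose ort (ij : 'I_n * 'I_n) : sterm R n :=
  SAdd (SEnt (MMul (MVar _ _ 0) (MTr (MVar _ _ 0))) ij.1 ij.2)
       (SCst n (- (1%:M : 'M[R]_n) ij.1 ij.2)).
pose A : set 'rV[R]_(n * n) :=
  \bigcap_(p in [set p | p \in P]) [set v | peval f p (vec_mx v) = 0] `&`
  \bigcap_(ij in setT) [set v | peval idfun (spolm (ort ij)) (vec_mx v) = 0].
have AP v : A v <-> zero_locus f P (vec_mx v) /\ vec_mx v *m (vec_mx v)^T = 1%:M.
  split=> -[h1 h2]; split=> //.
    apply/matrixP => i j; have := h2 (i, j) I; rewrite /mkset peval_spolm /=.
    by move=> /eqP; rewrite subr_eq0 => /eqP.
  by move=> ij _; rewrite /mkset peval_spolm /= h2 subrr.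
have Acl : closed A.
  apply: closedI; apply: closed_bigI => p _; apply: (@preimage_closed _ _ _ [set 0]);
    [move=> v _|exact: closed_eq|move=> v _|exact: closed_eq]; exact: peval_continuous.
have Acpt : compact A.
  apply: (@subclosed_compact _ A [set v | forall i, `[(-1 : R), 1]%classic (v ord0 i)]) => //.
    by apply: (@rV_compact _ _ (fun=> `[(-1 : R), 1]%classic)) => _; apply: segment_compact.
  move=> v /AP[_ vo] k; case/mxvec_indexP: k => i j.
  rewrite -(vec_mxK v) mxvecE /= in_itv /= -ler_norml.
  exact: orthogonal_entry.
have A1 : A (mxvec 1%:M) by apply/AP; rewrite mxvecK trmx1 mulmx1.
have [|v /set_mem/AP[vP vo] vmax] := @compact_EVT_max _ R
  (fun v => peval idfun (spolm t) (vec_mx v)) A (ex_intro _ _ A1) Acpt.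
  by apply: continuous_subspaceT; exact: peval_continuous.
exists (vec_mx v); split=> // k' k'P k'o.
have /vmax : mxvec k' \in A by apply/mem_set/AP; rewrite mxvecK.
by rewrite !peval_spolm mxvecK.
Qed.

(** * Transfer of the group structure *)

Section Formulas.
Variables (K : rcfType) (n : nat) (h : 'M[K]_n).

Definition FZero (P : seq (mxpol K n)) (t : mterm K n) : mform K n :=
  FConj P (fun p => FEq (SPol p t) (SCst n 0)).

Definition FPos (b : nat) : mform K n :=
  FConj (enum 'I_n) (fun i => FLt (SCst n 0) (eterm h b i i)).

(** A disjunction over D, expressed by the indexed conjunction [FConj] and two negations. *)
Definition FSa (D : sa_data K n) (t : mterm K n) : mform K n :=
  FNot (FConj D (fun c => FNot (FAnd (FZero c.1 t)
    (FConj c.2 (fun q => FLt (SCst n 0) (SPol q t)))))).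

Variables (L : rcfType) (f : {rmorphism K -> L}) (r : nat -> 'M[L]_n) (s : nat -> L).

Lemma fsem_zero P t : fsem f r s (FZero P t) <-> zero_locus f P (mval f r t).
Proof. by split=> H p /H /=; rewrite rmorph0. Qed.

Lemma fsem_pos b : fsem f r s (FPos b) <-> forall i, 0 < dv (map_mx f h) (r b) 0 i.
Proof.
split=> H i; last by move=> _; rewrite /fsem sval_eterm_diag /= rmorph0; exact: H.
by have := H i (mem_enum _ i); rewrite /fsem sval_eterm_diag /= rmorph0.
Qed.

Lemma fsem_sa D t : fsem f r s (FSa D t) <-> sa_set f D (mval f r t).
Proof.
split=> [/= H|[c cD [c1 c2]] /(_ c cD)].
  apply: contrapT => H'; apply: H => c cD [/fsem_zero c1 c2]; apply: H'.
  by exists c => //; split=> // q /c2 /=; rewrite rmorph0.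
by apply; split; [apply/fsem_zero|move=> q /c2 /=; rewrite rmorph0].
Qed.

End Formulas.

(** Equals A over every extension, see [A_extE], but is given by a formula from the start. *)
Definition torus_pos (K : rcfType) n (PS : seq (mxpol K n)) (h : 'M[K]_n)
    (L : rcfType) (f : {rmorphism K -> L}) : set 'M[L]_n :=
  [set s | zero_locus f PS s /\ forall i, 0 < dv (map_mx f h) s 0 i].

Lemma fsem_pos_torus (K : rcfType) n (PS : seq (mxpol K n)) (h : 'M[K]_n)
    (L : rcfType) (f : {rmorphism K -> L}) r s b :
  fsem f r s (FAnd (FZero PS (MVar K n b)) (FPos h b)) <-> torus_pos PS h f (r b).
Proof.
split=> -[].
  by move=> /(@fsem_zero _ _ _ f) H1 /(@fsem_pos _ _ _ _ f) H2; split.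
by move=> H1 H2; split; [apply/(@fsem_zero _ _ _ f)|apply/(@fsem_pos _ _ _ _ f)].
Qed.

Record split_frame (K : rcfType) n (PG PS : seq (mxpol K n)) (h : 'M[K]_n) : Prop :=
  SplitFrame {
    frame_semisimple : connected_semisimple_in_SL PG;
    frame_self_adjoint : self_adjoint PG;
    frame_maximal : maximal_split_torus PS PG;
    frame_symmetric : forall s, geom_points PS s -> s = s^T;
    frame_unit : h \in unitmx;
    frame_diag : forall s, geom_points PS s ->
      is_diag_mx (map_mx (real_complex K) h *m s *m invmx (map_mx (real_complex K) h))
  }.

Section Transfer.
Local Opaque peval.
Variables (K : rcfType) (n : nat) (PG PS : seq (mxpol K n)).
Notation rc := (real_complex K).
Notation C := (K[i]).
Variable h : 'M[K]_n.
Hypothesis T : split_frame PG PS h.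
Notation hG := (frame_semisimple T).
Notation hGT := (frame_self_adjoint T).
Notation hS := (frame_maximal T).
Notation hST := (frame_symmetric T).
Notation hu := (frame_unit T).
Notation hd := (frame_diag T).
Variables (L : rcfType) (f : {rmorphism K -> L}).
Notation GL := (zero_locus f PG).
Notation SL := (zero_locus f PS).
Notation hL := (map_mx f h).
Notation Sp := (torus_pos PS h f).
Notation v0 := (MVar K n 0).
Notation v1 := (MVar K n 1).
Notation v2 := (MVar K n 2).

Lemma frame_map_unit : hL \in unitmx. Proof. by rewrite map_unitmx; exact: hu. Qed.

(** The pattern of the next lemmas: a fact about K[i]-points holds for K-points and, being a
    first-order sentence, passes from K to L. *)
Lemma points_det g : GL g -> \det g = 1.
Proof.
have [_ H _ _] := hG.
have : fsem f (fun=> 0) (fun=> 0) (FAllM 0 (FImp (FZero PG v0) (FEq (SDet v0) (SCst n 1)))).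
  apply/MQE.transfer => {}g /fsem_zero /real_geom /H; rewrite /= det_map_mx.
  by move=> /eqP; rewrite fmorph_eq1 => /eqP.
by move=> /(_ g) H' Gg; rewrite -(rmorph1 f); apply: H'; apply/fsem_zero.
Qed.

Lemma points1 : GL 1%:M.
Proof.
have [[H _ _ _] _ _ _] := hG.
have : fsem f (fun=> 0) (fun=> 0) (FZero PG (MCst 1%:M)).
  by apply/MQE.transfer/fsem_zero/real_geom; rewrite /= !map_mx1.
by move=> /fsem_zero; rewrite /= map_mx1.
Qed.

Lemma pointsM g k : GL g -> GL k -> GL (g *m k).
Proof.
have [[_ _ H _] _ _ _] := hG.
have : fsem f (fun=> 0) (fun=> 0) (FAllM 0 (FAllM 1 (FImp (FZero PG v0)
    (FImp (FZero PG v1) (FZero PG (MMul v0 v1)))))).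
  apply/MQE.transfer => {}g {}k /fsem_zero/real_geom Hg /fsem_zero/real_geom Hk.
  by apply/fsem_zero/real_geom; rewrite /= map_mxM; exact: (H _ _ Hg Hk).
move=> /(_ g k) H' Hg Hk; apply/(fsem_zero f (upd (upd (fun=> 0) 0 g) 1 k) (fun=> 0) PG (MMul v0 v1)).
by apply: H'; apply/fsem_zero.
Qed.

Lemma points_unit g : GL g -> g \in unitmx.
Proof. by move=> /points_det H; rewrite unitmxE H unitr1. Qed.

Lemma pointsT g : GL g -> GL g^T.
Proof.
have : fsem f (fun=> 0) (fun=> 0) (FAllM 0 (FImp (FZero PG v0) (FZero PG (MTr v0)))).
  apply/MQE.transfer => {}g /fsem_zero/real_geom /hGT.
  by rewrite map_trmx => /real_geom H; apply/fsem_zero.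
move=> /(_ g) H Hg; apply/(fsem_zero f (upd (fun=> 0) 0 g) (fun=> 0) PG (MTr v0)).
by apply: H; apply/fsem_zero.
Qed.

Lemma invmx_det1 (D : comUnitRingType) m (g : 'M[D]_m) : \det g = 1 -> invmx g = \adj g.
Proof. by move=> d1; rewrite /invmx unitmxE d1 unitr1 invr1 scale1r. Qed.

Lemma pointsV g : GL g -> GL (invmx g).
Proof.
have [[_ _ _ H] Hdet _ _] := hG.
have : fsem f (fun=> 0) (fun=> 0) (FAllM 0 (FImp (FZero PG v0) (FZero PG (MAdj v0)))).
  apply/MQE.transfer => {}g /fsem_zero/real_geom Hg; apply/fsem_zero/real_geom.
  have := H _ Hg; rewrite (invmx_det1 (Hdet _ Hg)) -map_mx_adj; exact.
move=> /(_ g) H' Hg; rewrite (invmx_det1 (points_det Hg)).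
apply/(fsem_zero f (upd (fun=> 0) 0 g) (fun=> 0) PG (MAdj v0)).
by apply: H'; apply/fsem_zero.
Qed.

Lemma torus_sub s : SL s -> GL s.
Proof.
have [_ SG _] := hS.
have : fsem f (fun=> 0) (fun=> 0) (FAllM 0 (FImp (FZero PS v0) (FZero PG v0))).
  by apply/MQE.transfer => g /fsem_zero/real_geom Hg; apply/fsem_zero/real_geom/SG.
move=> /(_ s) H Hs; apply/(fsem_zero f (upd (fun=> 0) 0 s) (fun=> 0) PG v0).
by apply: H; apply/fsem_zero.
Qed.

Lemma torus_symmetric s : SL s -> s^T = s.
Proof.
have : fsem f (fun=> 0) (fun=> 0) (FAllM 0 (FImp (FZero PS v0) (FEqM (MTr v0) v0))).
  apply/MQE.transfer => g /fsem_zero/real_geom/hST; rewrite map_trmx => /map_mx_inj.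
  by move=> H; rewrite /= /upd /= -H.
by move=> /(_ s) H Hs; apply: H; apply/fsem_zero.
Qed.

Lemma torus_diag s : SL s -> is_diag_mx (hL *m s *m invmx hL).
Proof.
pose p i j : mform K n := FImp (FZero PS v0) (FEq (eterm h 0 i j) (SCst n 0)).
move=> Hs; apply/is_diag_mxP => i j ij.
have : fsem f (fun=> 0) (fun=> 0) (FAllM 0 (p i j)).
  apply/MQE.transfer => g /fsem_zero/real_geom/hd/is_diag_mxP/(_ i j ij).
  rewrite -map_invmx -!map_mxM [LHS]mxE => /eqP; rewrite fmorph_eq0 => /eqP.
  by rewrite /fsem sval_eterm /= map_mx_id.
move=> /(_ s) H; rewrite -(rmorph0 f).
rewrite -[LHS](sval_eterm h f (upd (fun=> 0) 0 s) (fun=> 0) 0%N i j).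
by apply: H; apply/fsem_zero.
Qed.

Lemma torus1 : SL 1%:M.
Proof.
have [[[H _ _ _] _ _] _ _] := hS.
have : fsem f (fun=> 0) (fun=> 0) (FZero PS (MCst 1%:M)).
  by apply/MQE.transfer/fsem_zero/real_geom; rewrite /= !map_mx1.
by move=> /fsem_zero; rewrite /= map_mx1.
Qed.

Lemma torusM g k : SL g -> SL k -> SL (g *m k).
Proof.
have [[[_ _ H _] _ _] _ _] := hS.
have : fsem f (fun=> 0) (fun=> 0) (FAllM 0 (FAllM 1 (FImp (FZero PS v0)
    (FImp (FZero PS v1) (FZero PS (MMul v0 v1)))))).
  apply/MQE.transfer => {}g {}k /fsem_zero/real_geom Hg /fsem_zero/real_geom Hk.
  by apply/fsem_zero/real_geom; rewrite /= map_mxM; exact: (H _ _ Hg Hk).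
move=> /(_ g k) H' Hg Hk; apply/(fsem_zero f (upd (upd (fun=> 0) 0 g) 1 k) (fun=> 0) PS (MMul v0 v1)).
by apply: H'; apply/fsem_zero.
Qed.

Lemma torusV g : SL g -> SL (invmx g).
Proof.
have [[[_ _ _ H] _ _] SG _] := hS; have [_ Hdet _ _] := hG.
have : fsem f (fun=> 0) (fun=> 0) (FAllM 0 (FImp (FZero PS v0) (FZero PS (MAdj v0)))).
  apply/MQE.transfer => {}g /fsem_zero/real_geom Hg; apply/fsem_zero/real_geom.
  have := H _ Hg; rewrite (invmx_det1 (Hdet _ (SG _ Hg))) -map_mx_adj; exact.
move=> /(_ g) H' Hg; rewrite (invmx_det1 (points_det (torus_sub Hg))).
apply/(fsem_zero f (upd (fun=> 0) 0 g) (fun=> 0) PS (MAdj v0)).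
by apply: H'; apply/fsem_zero.
Qed.

Lemma torus_cdiag s : SL s -> s = cdiag hL (dv hL s).
Proof. by move=> Ss; rewrite dvK ?frame_map_unit //; exact: torus_diag. Qed.

Lemma torus_neq0 s i : SL s -> dv hL s 0 i != 0.
Proof.
by move=> Ss; move: i; apply: (@cdiag_neq0 _ _ hL); rewrite ?frame_map_unit // -torus_cdiag //; apply/points_det/torus_sub.
Qed.

Lemma torus_pos_sub s : Sp s -> SL s. Proof. by case. Qed.

Lemma torus_pos_cdiag s : Sp s -> s = cdiag hL (dv hL s).
Proof. by move=> /torus_pos_sub/torus_cdiag. Qed.

Lemma torus_pos1 : Sp 1%:M.
Proof.
split; first exact: torus1.
by move=> i; rewrite -(cdiag1 frame_map_unit) cdiagK ?frame_map_unit // mxE.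
Qed.

Lemma torus_posM s t : Sp s -> Sp t -> Sp (s *m t).
Proof.
move=> [Ss s0] [St t0]; split; first exact: torusM.
by move=> i; rewrite (dvM frame_map_unit (torus_diag Ss) (torus_diag St)) [ltRHS]mxE mulr_gt0.
Qed.

Lemma dvS_inv s i : SL s -> dv hL (invmx s) 0 i = (dv hL s 0 i)^-1.
Proof.
move=> Ss; apply: (mulIf (torus_neq0 i Ss)); rewrite mulVf; last exact: torus_neq0.
have := dvM frame_map_unit (torus_diag (torusV Ss)) (torus_diag Ss) => /rowP/(_ i).
rewrite mulVmx; last exact/points_unit/torus_sub.
by rewrite -(cdiag1 frame_map_unit) cdiagK ?frame_map_unit // mxE [in RHS]mxE => <-.
Qed.

Lemma torus_posV s : Sp s -> Sp (invmx s).
Proof.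
by move=> [Ss s0]; split=> [|i]; [exact: torusV|rewrite dvS_inv // invr_gt0].
Qed.

Notation FSp b := (FAnd (FZero PS (MVar K n b)) (FPos h b)).

(** Maximality of S in first-order form. The finitely many elements in [centralizer_gram] have
    positive coordinates, so they may be replaced by the whole definable set [torus_pos]. *)
Lemma gram_torus_pos g : GL g -> (forall s, Sp s -> g *m s = s *m g) -> Sp (g^T *m g).
Proof.
have [sl [slS sl_sep]] := separating_elements hG hS hu hd.
have : fsem f (fun=> 0) (fun=> 0) (FAllM 0 (FImp (FZero PG v0) (FImp
    (FAllM 1 (FImp (FSp 1) (FEqM (MMul v0 v1) (MMul v1 v0))))
    (FAllM 2 (FImp (FEqM v2 (MMul (MTr v0) v0)) (FSp 2)))))).
  apply/MQE.transfer => {}g Gg gs q qE; apply/(@fsem_pos_torus _ _ _ _ _ idfun).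
  change (q = g^T *m g) in qE; change (torus_pos PS h (idfun : {rmorphism K -> K}) q).
  rewrite {}qE; move: Gg => /(@fsem_zero _ _ _ idfun) Gg.
  have [] := @centralizer_gram K n PG PS hG hGT hS hST h hu hd sl slS sl_sep g Gg.
    move=> s /slS[sS [d sE d0]]; apply: gs.
    apply/(@fsem_pos_torus _ _ _ _ _ idfun).
    change (torus_pos PS h (idfun : {rmorphism K -> K}) s); split=> // i.
    have E : dv h s 0 i = d 0 i by rewrite sE (cdiagK hu).
    by rewrite map_mx_id // E.
  by move=> H1 H2; split=> // i; rewrite map_mx_id.
move=> /(_ g) H Gg gs.
apply/(@fsem_pos_torus _ _ _ _ _ f (upd (upd (fun=> 0) 0 g) 2 (g^T *m g)) (fun=> 0) 2).
apply: H => //; first exact/(@fsem_zero _ _ _ f (upd (fun=> 0) 0 g)).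
by move=> s /(@fsem_pos_torus _ _ _ _ _ f) Ss; exact: (gs _ Ss).
Qed.

(** That a description D and the formula p define the same set is a sentence over K, so D cannot
    matter over L. *)
Lemma sa_ext_fsem (p : mform K n) : sa_ext f [set g | fsem idfun (upd (fun=> 0) 0 g) (fun=> 0) p]
  = [set g : 'M[L]_n | fsem f (upd (fun=> 0) 0 g) (fun=> 0) p].
Proof.
apply/seteqP; split=> g /=.
  move=> [D XD Dg].
  have : fsem f (fun=> 0) (fun=> 0) (FAllM 0 (FImp (FSa D v0) p)).
    apply/MQE.transfer => {Dg}g /(@fsem_sa _ _ _ idfun) /= Dg.
    suff : [set g | fsem idfun (upd (fun=> 0) 0 g) (fun=> 0) p] g by [].
    by rewrite XD.
  by move=> /(_ g); apply; apply/fsem_sa.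
have [D HD] := MQE.fsem_sa_set p; move=> Hg; exists D; last exact/HD.
by apply/seteqP; split=> k /(HD K idfun k).
Qed.

End Transfer.

(** * The component of the identity of the torus *)

Section Component.
Local Opaque peval.
Variables (K : rcfType) (n : nat) (PG PS : seq (mxpol K n)) (h : 'M[K]_n).
Hypothesis T : split_frame PG PS h.
Variables (R : realType) (iR : {rmorphism K -> R}).
Notation SpR := (torus_pos PS h iR).
Notation SpK := (torus_pos PS h (idfun : {rmorphism K -> K})).
Notation hR := (map_mx iR h).
Notation hR_unit := (frame_map_unit T iR).

Lemma torus_pos_pow x t : SpR x -> SpR (cdiag hR (\row_i expR (t * ln (dv hR x 0 i)))).
Proof.
move=> [Sx x0]; split; last by move=> i; rewrite (cdiagK hR_unit) mxE expR_gt0.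
apply: zero_locus_power => // [|k]; first exact: hR_unit.
elim: k => [|k IH].
  have -> : \row_i dv hR x 0 i ^+ 0 = const_mx 1 by apply/rowP => i; rewrite !mxE.
  by rewrite (cdiag1 hR_unit); exact: (torus1 T).
have -> : \row_i dv hR x 0 i ^+ k.+1 = rv_mul (dv hR x) (\row_i dv hR x 0 i ^+ k).
  by apply/rowP => i; rewrite [LHS]mxE [RHS]mxE [X in _ * X]mxE exprS.
rewrite -(cdiagM hR_unit); apply: (torusM T _ IH).
by rewrite -(torus_cdiag T Sx).
Qed.

Lemma torus_pos_sqrt (L : rcfType) (f : {rmorphism K -> L}) x : torus_pos PS h f x ->
  exists2 y, torus_pos PS h f y & y *m y = x.
Proof.
pose FSp b : mform K n := FAnd (FZero PS (MVar K n b)) (FPos h b).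
have : fsem f (fun=> 0) (fun=> 0) (FAllM 0 (FImp (FSp 0%N)
    (FExM 1 (FAnd (FSp 1%N) (FEqM (MMul (MVar K n 1) (MVar K n 1)) (MVar K n 0)))))).
  (* From L down to K and up to R, where real powers exist; all statements proved over R take this
     detour. *)
  apply/MQE.transfer; apply: (MQE.transfer iR _).1 => {}x.
  move=> /(@fsem_pos_torus _ _ _ _ _ iR) Sx; have := torus_pos_pow 2^-1 Sx.
  set y := cdiag _ _ => Sy; exists y; split.
    exact/(@fsem_pos_torus _ _ _ _ _ iR).
  change (y *m y = x); rewrite {1 2}/y (cdiagM hR_unit) [RHS](torus_pos_cdiag T Sx).
  congr (cdiag _ _); apply/rowP => i; have [_ /(_ i) x0] := Sx.
  rewrite [LHS]mxE [X in X * _]mxE [X in _ * X]mxE -expRD -mulrDl.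
  rewrite -[RHS](lnK x0); congr expR; by field.
move=> /(_ x) H Sx; have [|y [/(@fsem_pos_torus _ _ _ _ _ f) Sy yE]] := H.
  exact/(@fsem_pos_torus _ _ _ _ _ f).
by exists y; [exact: Sy|exact: yE].
Qed.

Definition torus_path x y (t : R) : 'M[R]_n :=
  cdiag hR (\row_i expR ((1 - t) * ln (dv hR x 0 i) + t * ln (dv hR y 0 i))).

Lemma torus_pathP x y t : SpR x -> SpR y -> SpR (torus_path x y t).
Proof.
move=> Sx Sy; have := torus_posM T (torus_pos_pow (1 - t) Sx) (torus_pos_pow t Sy).
rewrite (cdiagM hR_unit) /torus_path; set v := rv_mul _ _; set w := \row_i _.
suff -> : v = w by [].
by apply/rowP => i; rewrite /v /w [LHS]mxE [RHS]mxE [X in X * _]mxE [X in _ * X]mxE expRD.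
Qed.

Lemma torus_path01 x y : SpR x -> SpR y -> torus_path x y 0 = x /\ torus_path x y 1 = y.
Proof.
move=> Sx Sy; split; [rewrite [RHS](torus_pos_cdiag T Sx)|rewrite [RHS](torus_pos_cdiag T Sy)];
  congr (cdiag _ _); apply/rowP => i; rewrite [LHS]mxE.
  by have [_ /(_ i) z0] := Sx; rewrite (subr0 (1 : R)) mul1r mul0r addr0 lnK.
by have [_ /(_ i) z0] := Sy; rewrite (subrr (1 : R)) mul1r mul0r add0r lnK.
Qed.

Lemma torus_path_continuous x y i j : continuous (fun t => torus_path x y t i j).
Proof.
pose u k t : R := expR ((1 - t) * ln (dv hR x 0 k) + t * ln (dv hR y 0 k)).
have uc k : continuous (u k).
  move=> t; apply: (@continuous_comp _ _ _
    (fun t : R => (1 - t) * ln (dv hR x 0 k) + t * ln (dv hR y 0 k)) expR);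
    last exact: continuous_expR.
  apply: continuousD; apply: continuousM; try exact: cst_continuous; last exact: cvg_id.
  by apply: continuousB; [exact: cst_continuous|exact: cvg_id].
have -> : (fun t => torus_path x y t i j) =
    (fun t => \sum_k (invmx hR) i k * u k t * hR k j).
  apply/funext => t; rewrite /torus_path /cdiag mul_mx_diag [LHS]mxE.
  by apply: eq_bigr => k _; rewrite [X in X * _]mxE [X in _ * X * _]mxE.
apply: (@continuous_big R _ +%R 0 xpredT _ _ _ (fun k t => (invmx hR) i k * u k t * hR k j)).
  exact: add_continuous.
move=> k _ t; apply: (continuousM (s := fun t => invmx hR i k * u k t) (t := fun=> hR k j));
  last exact: cst_continuous.
by apply: (continuousM (s := fun=> invmx hR i k) (t := u k)); [exact: cst_continuous|exact: uc].
Qed.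

Definition FNear (a b : nat) (c : nat) : mform K n :=
  FConj (enum {: 'I_n * 'I_n}) (fun ij =>
    FAnd (FLt (SAdd (SEnt (MVar K n a) ij.1 ij.2) (SOpp (SEnt (MVar K n b) ij.1 ij.2))) (SVar c))
         (FLt (SAdd (SEnt (MVar K n b) ij.1 ij.2) (SOpp (SEnt (MVar K n a) ij.1 ij.2))) (SVar c))).

Lemma fsem_near (L : rcfType) (f : {rmorphism K -> L}) r s a b c :
  fsem f r s (FNear a b c) <-> forall i j, `|r a i j - r b i j| < s c.
Proof.
split=> H.
  move=> i j; have [/= h1 h2] := H (i, j) (mem_enum _ _).
  by rewrite ltr_norml h1 andbT ltrNl opprB.
by move=> [i j] _; have := H i j; rewrite /= ltr_norml ltrNl opprB => /andP[].
Qed.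

(* D is open relative to the set of positive elements of the torus. *)
Definition FOpen (D : sa_data K n) : mform K n :=
  FAllM 0 (FImp (FSa D (MVar K n 0)) (FExS 0 (FAnd (FLt (SCst n 0) (SVar 0))
    (FAllM 1 (FImp (FAnd (FZero PS (MVar K n 1)) (FPos h 1))
       (FImp (FNear 0 1 0) (FSa D (MVar K n 1)))))))).

Lemma fsem_open (L : rcfType) (f : {rmorphism K -> L}) r s D :
  fsem f r s (FOpen D) <-> forall x, sa_set f D x -> exists2 e, 0 < e &
    forall y, torus_pos PS h f y -> (forall i j, `|x i j - y i j| < e) -> sa_set f D y.
Proof.
split=> H x.
  move=> Dx; have [|e [/= e0 He]] := H x; first exact/(@fsem_sa _ _ _ f).
  rewrite rmorph0 in e0; exists e => // y Sy xy.
  apply/(@fsem_sa _ _ _ f (upd (upd r 0 x) 1 y) (upd s 0 e) D (MVar K n 1)).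
  by apply: He; [exact/(@fsem_pos_torus _ _ _ _ _ f)|exact/(@fsem_near _ f (upd (upd r 0 x) 1 y) (upd s 0 e) 0 1 0)].
move=> /(@fsem_sa _ _ _ f) /H [e e0 He]; exists e; split.
  by rewrite /= rmorph0.
move=> y /(@fsem_pos_torus _ _ _ _ _ f) Sy /(@fsem_near _ f) xy.
by apply/(@fsem_sa _ _ _ f); exact: He.
Qed.

(** A path from x to y would cut the real line into two disjoint nonempty open sets. *)
Lemma torus_pos_connectedR (X Y : set 'M[R]_n) : SpR `<=` X `|` Y -> X `&` Y = set0 ->
  (forall x, X x -> exists2 e, 0 < e &
     forall y, SpR y -> (forall i j, `|x i j - y i j| < e) -> X y) ->
  (forall x, Y x -> exists2 e, 0 < e &
     forall y, SpR y -> (forall i j, `|x i j - y i j| < e) -> Y y) ->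
  forall x y, SpR x -> SpR y -> X x -> Y y -> False.
Proof.
move=> SXY XY0 Xo Yo x y Sx Sy Xx Yy; pose g := torus_path x y.
have Sg t : SpR (g t) by exact: torus_pathP.
have gopen (Z : set 'M[R]_n) : (forall x, Z x -> exists2 e, 0 < e &
     forall y, SpR y -> (forall i j, `|x i j - y i j| < e) -> Z y) -> open [set t | Z (g t)].
  move=> Zo; rewrite openE => t /= /Zo[e e0 He].
  have : \forall u \near t, forall ij : 'I_n * 'I_n, `|g t ij.1 ij.2 - g u ij.1 ij.2| < e.
    apply: (@filter_forall R ('I_n * 'I_n)%type (fun ij u => `|g t ij.1 ij.2 - g u ij.1 ij.2| < e) (nbhs t) (nbhs_filter t)) => -[i j] /=.
    by have /cvgrPdist_lt := @torus_path_continuous x y i j t; exact.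
  by apply: filterS => u Hu; apply: He => // i j; exact: (Hu (i, j)).
have [g0 g1] := torus_path01 Sx Sy.
have gc : [set t | Y (g t)] = ~` [set t | X (g t)].
  apply/seteqP; split=> t /=.
    by move=> Yt Xt; have : (X `&` Y) (g t) by []; rewrite XY0.
  by case: (SXY _ (Sg t)).
have XT : [set t | X (g t)] = [set: R].
  apply: (proj2 (connected_intervalP [set: R])) => //.
  - by exists 0; rewrite /= /g g0.
  - by exists [set t | X (g t)]; rewrite ?setTI //; exact: gopen.
  - exists [set t | X (g t)]; rewrite ?setTI // -(setCK [set t | X (g t)]) -gc.
    exact/open_closedC/gopen.
have : [set: R] 1 by [].
rewrite -XT /= => X1; have : (X `&` Y) (g 1) by split=> //; rewrite /g g1.
by rewrite XY0.
Qed.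

(** The first piece is relatively open as the complement of the relatively closed second one. The
    form with e is the one that [FOpen] expresses. *)
Lemma sa_setK_pos (X : set 'M[K]_n) D1 D2 : X = SpK ->
  sa_set idfun D1 `|` sa_set idfun D2 = X -> sa_set idfun D1 `&` sa_set idfun D2 = set0 ->
  (exists2 Z, closed Z & sa_set idfun D2 = X `&` Z) ->
  forall x, sa_set idfun D1 x -> exists2 e, 0 < e &
    forall y, SpK y -> (forall i j, `|x i j - y i j| < e) -> sa_set idfun D1 y.
Proof.
move=> XE D12 D0 [Z Zc DZ] x Dx.
have nZx : (~` Z) x.
  move=> Zx; have : (sa_set idfun D1 `&` sa_set idfun D2) x.
    by split=> //; rewrite DZ -D12; split=> //; left.
  by rewrite D0.
have /nbhs_ballP[e /= e0 He] : nbhs x (~` Z) by apply: open_nbhs_nbhs; split=> //; exact: closed_openC.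
exists e => // y Sy xy; have nZy : (~` Z) y by apply: He; split=> // i j; exact: xy.
have : X y by rewrite XE.
rewrite -D12 => -[//|]; rewrite DZ => -[_ Zy]; exact: False_ind (nZy Zy).
Qed.

(** K may be totally disconnected, as the real algebraic numbers are, so paths in K are of no help.
    A semialgebraic separation is transferred to R together with its openness, and there it is
    impossible. *)
Lemma torus_pos_connected : sa_connected SpK.
Proof.
move=> C1 C2 [D1 E1] [D2 E2]; rewrite {}E1 {}E2 => Z1 Z2 D12 D0.
apply: contrapT => /not_orP[n1 n2].
have [x Sx D1x] : exists2 x, SpK x & sa_set idfun D1 x.
  apply: contrapT => H; apply: n2; rewrite -D12; apply/seteqP; split=> [y|y [Dy|//]]; first by right.
  by exfalso; apply: H; exists y => //; rewrite -D12; left.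
have [y Sy D2y] : exists2 y, SpK y & sa_set idfun D2 y.
  apply: contrapT => H; apply: n1; rewrite -D12; apply/seteqP; split=> [z|z [//|Dz]]; first by left.
  by exfalso; apply: H; exists z => //; rewrite -D12; right.
have mapS z : SpK z -> SpR (map_mx iR z).
  move=> [Sz z0]; split.
    exact: (zero_locus_map idfun iR PS z).2.
  by move=> i; rewrite map_dv [ltRHS]mxE MQE.rmorph_gt0; have := z0 i; rewrite map_mx_id.
have mapD D z : sa_set idfun D z -> sa_set iR D (map_mx iR z).
  move=> Dz; have : fsem iR (fun=> 0) (fun=> 0) (FSa D (MCst z)).
    by apply/MQE.transfer/(@fsem_sa _ _ _ idfun); rewrite /= map_mx_id.
  by move=> /(@fsem_sa _ _ _ iR).
have openR D : (forall x, sa_set idfun D x -> exists2 e, 0 < e &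
    forall y, SpK y -> (forall i j, `|x i j - y i j| < e) -> sa_set idfun D y) ->
    forall x, sa_set iR D x -> exists2 e, 0 < e &
    forall y, SpR y -> (forall i j, `|x i j - y i j| < e) -> sa_set iR D y.
  move=> Ho; apply/(fsem_open iR (fun=> 0) (fun=> 0)); apply/MQE.transfer.
  exact/(fsem_open idfun).
apply: (@torus_pos_connectedR (sa_set iR D1) (sa_set iR D2) _ _ _ _ (map_mx iR x) (map_mx iR y)).
- have : fsem iR (fun=> 0) (fun=> 0) (FAllM 0 (FImp (FAnd (FZero PS (MVar K n 0)) (FPos h 0))
      (FOr (FSa D1 (MVar K n 0)) (FSa D2 (MVar K n 0))))).
    apply/MQE.transfer => z /(@fsem_pos_torus _ _ _ _ _ idfun) Sz.
    have : SpK z by []. rewrite -D12 => -[Dz|Dz]; [left|right]; exact/(@fsem_sa _ _ _ idfun).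
  move=> H z Sz; have [|/(@fsem_sa _ _ _ iR) Dz|/(@fsem_sa _ _ _ iR) Dz] := H z; by [left|right|exact/(@fsem_pos_torus _ _ _ _ _ iR)].
- have : fsem iR (fun=> 0) (fun=> 0) (FAllM 0 (FNot (FAnd (FSa D1 (MVar K n 0)) (FSa D2 (MVar K n 0))))).
    apply/MQE.transfer => z -[/(@fsem_sa _ _ _ idfun) H1 /(@fsem_sa _ _ _ idfun) H2].
    by have : (sa_set idfun D1 `&` sa_set idfun D2) z by []; rewrite D0.
  move=> H; apply/seteqP; split=> // z [H1 H2]; apply: (H z).
  by split; exact/(@fsem_sa _ _ _ iR).
- by apply: openR; apply: (@sa_setK_pos SpK D1 D2).
- by apply: openR; apply: (@sa_setK_pos SpK D2 D1) => //; rewrite 1?setUC 1?setIC.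
- exact: mapS.
- exact: mapS.
- exact: mapD.
- exact: mapD.
Qed.

Lemma dv_continuous i : continuous (fun g : 'M[K]_n => dv h g 0 i).
Proof.
have -> : (fun g : 'M[K]_n => dv h g 0 i) =
    (fun g : 'M[K]_n => \sum_k (\sum_l h i l * g l k) * invmx h k i).
  by apply/funext => g; rewrite !mxE; apply: eq_bigr => k _; rewrite mxE.
apply: (@continuous_big K _ +%R 0 xpredT _ _ _
  (fun k (g : 'M[K]_n) => (\sum_l h i l * g l k) * invmx h k i)).
  exact: add_continuous.
move=> k _ g; apply: continuousM; last exact: cst_continuous.
move: g; apply: (@continuous_big K _ +%R 0 xpredT _ _ _ (fun l (g : 'M[K]_n) => h i l * g l k)).
  exact: add_continuous.
move=> l _ g; apply: continuousM; first exact: cst_continuous.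
exact: coord_continuous.
Qed.

(** Diagonal coordinates never vanish on S, so the conditions that all are >= 0 and that some is <=
    0 cut C into two disjoint relatively closed parts; 1 lies in the first. *)
Lemma sa_component_torus :
  sa_component (zero_locus idfun PS) 1%:M = SpK.
Proof.
have sa_form (p : mform K n) (X : set 'M[K]_n) :
    (forall g, X g <-> fsem idfun (upd (fun=> 0) 0 g) (fun=> 0) p) -> semialgebraic X.
  move=> XP; have [D HD] := MQE.fsem_sa_set p; exists D.
  by apply/seteqP; split=> g; [move/XP/(HD K idfun g)|move/(HD K idfun g)/XP].
apply/seteqP; split=> y; last first.
  move=> Sy; exists SpK; split=> //.
  - apply: (sa_form (FAnd (FZero PS (MVar K n 0)) (FPos h 0))) => g.
    by split=> [Sg|/(@fsem_pos_torus _ _ _ _ _ idfun)]; first exact/(@fsem_pos_torus _ _ _ _ _ idfun).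
  - exact: torus_pos_connected.
  - by move=> g [].
  - exact: (torus_pos1 T idfun).
move=> [C [[D CD] Ccon CS C1 Cy]].
have cle g : zero_locus idfun PS g -> forall i, dv h g 0 i != 0.
  by move=> Sg i; have := @torus_neq0 _ _ _ _ _ T _ idfun g i Sg; rewrite map_mx_id.
pose Z1 : set 'M[K]_n := \bigcap_(i in setT) [set g | 0 <= dv h g 0 i].
pose Z2 : set 'M[K]_n := \bigcup_(i in setT) [set g | dv h g 0 i <= 0].
have Z1c : closed Z1.
  apply: closed_bigI => i _; apply: (@preimage_closed _ _ (fun g : 'M[K]_n => dv h g 0 i) [set x | 0 <= x]).
    by move=> g _; exact: dv_continuous.
  exact: closed_ge.
have Z2c : closed Z2.
  apply: closed_bigcup; [exact: finite_finset|] => i _.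
  apply: (@preimage_closed _ _ (fun g : 'M[K]_n => dv h g 0 i) [set x | x <= 0]).
    by move=> g _; exact: dv_continuous.
  exact: closed_le.
have fp i g : fsem idfun (upd (fun=> 0) 0 g) (fun=> 0) (FLt (SCst n 0) (eterm h 0 i i)) <-> 0 < dv h g 0 i.
  by rewrite /fsem sval_eterm_diag /= map_mx_id.
have fn i g : fsem idfun (upd (fun=> 0) 0 g) (fun=> 0) (FLt (eterm h 0 i i) (SCst n 0)) <-> dv h g 0 i < 0.
  by rewrite /fsem sval_eterm_diag /= map_mx_id.
have CP g : C g <-> fsem idfun (upd (fun=> 0) 0 g) (fun=> 0) (FSa D (MVar K n 0)).
  by rewrite CD; split=> [H|/(@fsem_sa _ _ _ idfun)//]; exact/(@fsem_sa _ _ _ idfun).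
have CZ : C `<=` Z1 `|` Z2.
  move=> g _; have [H|H] := pselect (Z1 g); [by left|right].
  apply: contrapT => H2; apply: H => i _ /=; rewrite leNgt; apply/negP => gi.
  by apply: H2; exists i => //=; exact: ltW.
have [||||||E|E] := Ccon (C `&` Z1) (C `&` Z2).
- apply: (sa_form (FAnd (FSa D (MVar K n 0)) (FConj (enum 'I_n) (fun i =>
    FNot (FLt (eterm h 0 i i) (SCst n 0)))))) => g.
  split=> -[/CP H1 H2]; split=> // i _.
    by move=> /fn; rewrite ltNge => /negP; apply; exact: (H2 i I).
  rewrite /= leNgt; apply/negP => gi; apply: (H2 i); first exact: mem_enum.
  exact/fn.
- apply: (sa_form (FAnd (FSa D (MVar K n 0)) (FNot (FConj (enum 'I_n) (fun i =>
    FLt (SCst n 0) (eterm h 0 i i)))))) => g.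
  split=> -[/CP H1].
    move=> [i _ gi]; split=> // H2; have /fp := H2 i (mem_enum _ i).
    by rewrite ltNge => /negP; apply; exact: gi.
  move=> H2; split=> //; apply: contrapT => H3; apply: H2 => i _; apply/fp.
  by rewrite ltNge; apply/negP => gi; apply: H3; exists i.
- by exists Z1.
- by exists Z2.
- by rewrite -setIUr; apply/setIidl.
- apply/seteqP; split=> // g [[Cg g1] [_ [i _ gi]]].
  have := cle g (CS _ Cg) i; rewrite eq_le => /negP; apply.
  by rewrite gi; exact: g1.
- split; first exact: CS.
  move=> i; rewrite map_mx_id //; have : (C `&` Z1) y by rewrite E.
  by move=> [_ /(_ i I)]; rewrite /= le_eqVlt eq_sym (negbTE (cle _ (CS _ Cy) i)).
- have : (C `&` Z2) 1%:M by rewrite E.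
  move=> [_ [i _]] /=; have [_ /(_ i)] := torus_pos1 T idfun.
  by rewrite map_mx_id // ltNge => /negP.
Qed.

Lemma A_extE (L : rcfType) (f : {rmorphism K -> L}) : A_ext f PS = torus_pos PS h f.
Proof.
rewrite /A_ext sa_component_torus.
have E (M : rcfType) (u : {rmorphism K -> M}) : torus_pos PS h u =
    [set g | fsem u (upd (fun=> 0) 0 g) (fun=> 0) (FAnd (FZero PS (MVar K n 0)) (FPos h 0))].
  apply/seteqP; split=> g.
    by move=> H; have := (@fsem_pos_torus _ _ PS h _ u (upd (fun=> 0) 0 g) (fun=> 0) 0%N).2 H.
  by move=> /(@fsem_pos_torus _ _ _ _ _ u).
by rewrite !E; exact: sa_ext_fsem.
Qed.

End Component.

(** * Cartan decomposition over the reals *)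

Section RealTorus.
Local Opaque peval.
Variables (K : rcfType) (n : nat) (PG PS : seq (mxpol K n)) (h : 'M[K]_n).
Hypothesis T : split_frame PG PS h.
Variables (R : realType) (iR : {rmorphism K -> R}).
Notation SpR := (torus_pos PS h iR).
Notation G := (zero_locus iR PG).
Notation hR := (map_mx iR h).
Notation hR_unit := (frame_map_unit T iR).
Notation fa := (frak_a iR PS).

(** X is the limit of m (exp (X / m) - 1), whose off-diagonal coordinates are 0. *)
Lemma lie_torus_diag X : lie_algebra SpR X -> X = cdiag hR (dv hR X).
Proof.
move=> HX; rewrite dvK ?hR_unit //; apply/is_diag_mxP => i j ij.
pose u m : 'M[R]_n := m.+1%:R *: (expmx (m.+1%:R^-1 *: X) - 1%:M).
have uX : mcvg u X by exact: expmx_deriv0.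
have := mcvgM (mcvgM (@mcvg_cst R _ _ hR) uX) (@mcvg_cst R _ _ (invmx hR)).
move=> /(_ i j) /cvg_lim <- //.
rewrite (_ : (fun _ => _) = fun=> 0); first exact: lim_cst.
apply/funext => m; rewrite /u conjZ mulmxBr mulmxBl mulmx1 mulmxV ?hR_unit //.
have [/(torus_diag T)/is_diag_mxP/(_ i j ij) E _] := HX (m.+1%:R^-1).
have e1 : (1%:M : 'M[R]_n) i j = 0 by rewrite mxE -val_eqE /= (negbTE ij).
by rewrite [X in _ * X]mxE E [X in _ + X]mxE e1 subr0 mulr0.
Qed.

Lemma lie_torusD X Y : lie_algebra SpR X -> lie_algebra SpR Y -> lie_algebra SpR (X + Y).
Proof.
move=> HX HY t; have := torus_posM T (HX t) (HY t).
rewrite (lie_torus_diag HX) (lie_torus_diag HY); move: (dv hR X) (dv hR Y) => x y.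
have cdZ z : t *: cdiag hR z = cdiag hR (t *: z).
  by rewrite /cdiag linearZ /= -scalemxAr -scalemxAl.
have -> : cdiag hR x + cdiag hR y = cdiag hR (x + y).
  by rewrite /cdiag linearD /= mulmxDr mulmxDl.
rewrite !cdZ !expmx_cdiag ?hR_unit // (cdiagM hR_unit).
rewrite (_ : rv_mul _ _ = map_mx expR (t *: (x + y))) //.
by apply/rowP => i; rewrite [RHS]mxE [LHS]mxE [X in X * _]mxE [X in _ * X]mxE -expRD !mxE mulrDr.
Qed.

(** The Lie algebra of A is a subspace, so [xget] does not return its dummy value. *)
Lemma frak_aE X : X \in fa <-> lie_algebra SpR X.
Proof.
rewrite /frak_a /lie_vspace (A_extE T iR).
have [|||V VP] := @lie_vspaceP R n (lie_algebra SpR).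
- by move=> t; rewrite scaler0 expmx0; exact: (torus_pos1 T).
- exact: lie_torusD.
- by move=> c Y HY t; rewrite scalerA; exact: HY.
exact: (xgetPex (P := [set V : {vspace 'M[R]_n} | forall X, X \in V <-> lie_algebra SpR X])
  0%VS (ex_intro _ V VP)).
Qed.

Lemma frak_a_cdiag X : X \in fa -> X = cdiag hR (dv hR X).
Proof. by move=> /frak_aE/lie_torus_diag. Qed.

Lemma frak_a_exp X t : X \in fa -> SpR (expmx (t *: X)).
Proof. by move=> /frak_aE; apply. Qed.

Lemma frak_a_sym X : X \in fa -> X^T = X.
Proof.
move=> /frak_aE HX; apply: (mcvg_unique (mcvgT (@expmx_deriv0 R n X))).
have -> : (fun m => (m.+1%:R *: (expmx (m.+1%:R^-1 *: X) - 1%:M))^T) =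
    fun m => m.+1%:R *: (expmx (m.+1%:R^-1 *: X) - 1%:M).
  apply/funext => m; have [/(torus_symmetric T) + _] := HX (m.+1%:R^-1).
  by move=> E; rewrite linearZ /= linearB /= trmx1 E.
exact: expmx_deriv0.
Qed.

Lemma torus_log s : SpR s -> exists2 X, X \in fa & expmx X = s.
Proof.
move=> Ss; exists (cdiag hR (\row_i ln (dv hR s 0 i))).
  apply/frak_aE => t; rewrite /cdiag scalemxAl scalemxAr -linearZ -/(cdiag _ _).
  rewrite expmx_cdiag ?hR_unit //; have := torus_pos_pow T t Ss.
  rewrite (_ : map_mx _ _ = \row_i expR (t * ln (dv hR s 0 i))) //.
  by apply/rowP => i; rewrite !mxE.
rewrite expmx_cdiag ?hR_unit // [RHS](torus_pos_cdiag T Ss); congr (cdiag _ _).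
by apply/rowP => i; have [_ /(_ i) z0] := Ss; rewrite [LHS]mxE [X in expR X]mxE lnK.
Qed.

Lemma zero_locus_limit u l : mcvg u l -> (forall k, G (u k)) -> G l.
Proof. exact: mcvg_zero_locus. Qed.

Lemma frak_a_lie X : X \in fa -> lie_algebra G X.
Proof. by move=> /frak_aE HX t; apply: (torus_sub T); have [] := HX t. Qed.

(* [H, X] has coordinates (H_i - H_j) X_ij = ln (e^H_i / e^H_j) X_ij. *)
Lemma lie_weight_exp H (phi : R -> R) X : H \in fa -> lie_algebra G X ->
  lie_algebra G (weight hR (fun i j => phi (dv hR H 0 i - dv hR H 0 j)) X).
Proof.
move=> Hfa HX; pose x := map_mx expR (dv hR H).
have -> : weight hR (fun i j => phi (dv hR H 0 i - dv hR H 0 j)) X =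
    weight hR (fun i j => (phi \o @ln R) (x 0 i / x 0 j)) X.
  apply: (conj_inj hR_unit) => i j; rewrite !weightE ?hR_unit //; congr (_ * _).
  by rewrite /x [in RHS]mxE [X in _ / X]mxE /= -expRB expRK.
apply: (@lie_weight R n G (points1 T iR) (@pointsM _ _ _ _ _ T _ iR) (@pointsV _ _ _ _ _ T _ iR)
   (@points_unit _ _ _ _ _ T _ iR) zero_locus_limit) HX; first exact: hR_unit.
  by move=> i; rewrite mxE lt0r_neq0 // expR_gt0.
rewrite -expmx_cdiag ?hR_unit // -frak_a_cdiag //.
by have := frak_a_lie Hfa 1; rewrite scale1r.
Qed.

Lemma conj_bracket H X i j : H \in fa -> (hR *m (H *m X - X *m H) *m invmx hR) i j =
  (dv hR H 0 i - dv hR H 0 j) * (hR *m X *m invmx hR) i j.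
Proof.
move=> Hfa; rewrite {1 2}(frak_a_cdiag Hfa) -[- (X *m _)]scaleN1r conjD conjZ.
by rewrite conjMcdiag ?conjMcdiagr ?hR_unit //; ring.
Qed.

Lemma lie_bracket H X : H \in fa -> lie_algebra G X -> lie_algebra G (H *m X - X *m H).
Proof.
move=> Hfa /(lie_weight_exp id Hfa); congr (lie_algebra _ _).
by apply: (conj_inj hR_unit) => i j; rewrite conj_bracket // weightE // hR_unit.
Qed.

End RealTorus.

Lemma cdiag_exp_diag (R : realType) n (w : 'M[R]_n) (m : 'rV[R]_n) t : w \in unitmx ->
  expmx (t *: cdiag w m) = cdiag w (\row_i expR (t * m 0 i)).
Proof.
move=> wu; rewrite /cdiag scalemxAl scalemxAr -linearZ -/(cdiag _ _) expmx_cdiag //.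
by congr (cdiag _ _); apply/rowP => i; rewrite !mxE.
Qed.

Lemma symmetric_cdiag (K : rcfType) n (A : 'M[K]_n) : A^T = A ->
  exists2 w : 'M[K]_n, w \in unitmx & A = cdiag w (dv w A).
Proof.
move=> /symmetric_diagonalizable[w wu /= H]; exists w => //.
by rewrite dvK // -similar_diagE.
Qed.

(** By interpolation at the eigenvalues the matrix on the right is a polynomial in the symmetric
    matrix [cdiag w x]. *)
Lemma symmetric_fun (R : fieldType) n (w : 'M[R]_n) (x : 'rV[R]_n) (phi : R -> R) :
  w \in unitmx -> (cdiag w x)^T = cdiag w x ->
  (cdiag w (\row_i phi (x 0 i)))^T = cdiag w (\row_i phi (x 0 i)).
Proof.
move=> wu xT; have [p Hp] := interpolation [seq x 0 i | i : 'I_n] phi.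
have -> : \row_i phi (x 0 i) = \row_i p.[x 0 i].
  by apply/rowP => i; rewrite !mxE Hp //; apply/fintype.imageP; exists i.
elim/poly_ind: p {Hp} => [|p c IH].
  have -> : \row_i (0 : {poly R}).[x 0 i] = 0 by apply/rowP => i; rewrite !mxE horner0.
  by rewrite /cdiag linear0 mulmx0 mul0mx trmx0.
have -> : cdiag w (\row_i (p * 'X + c%:P).[x 0 i]) =
    cdiag w (\row_i p.[x 0 i]) *m cdiag w x + c *: 1%:M.
  rewrite (cdiagM wu) -(cdiag1 wu) /cdiag scalemxAl scalemxAr -linearZ -mulmxDl -mulmxDr -linearD.
  congr (_ *m diag_mx _ *m _); apply/rowP => i.
  by rewrite [LHS]mxE hornerMXaddC !mxE mulr1.
by rewrite linearD linearZ /= trmx1 trmx_mul xT IH (cdiag_comm wu).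
Qed.

Lemma tr_sqr_ge0 (R : realDomainType) n (A : 'M[R]_n) : 0 <= \tr (A *m A^T).
Proof.
by apply: sumr_ge0 => i _; rewrite mxE sumr_ge0 // => j _; rewrite mxE -expr2 sqr_ge0.
Qed.

Lemma tr_sqr_eq0 (R : realDomainType) n (A : 'M[R]_n) : \tr (A *m A^T) = 0 -> A = 0.
Proof.
have p i : 0 <= (A *m A^T) i i.
  by rewrite mxE sumr_ge0 // => j _; rewrite mxE -expr2 sqr_ge0.
move=> /eqP; rewrite psumr_eq0; last by move=> i _; exact: p.
move=> /allP H; apply/matrixP => i j; have := H i (mem_index_enum _) => /=.
rewrite mxE psumr_eq0; last by move=> k _; rewrite mxE -expr2 sqr_ge0.
move=> /allP/(_ j (mem_index_enum _)) /=; rewrite mxE mulf_eq0 orbb => /eqP->.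
by rewrite mxE.
Qed.

(** The values of D on a basis form a matrix with independent rows, hence with a right inverse. For
    the simple roots this yields the interior point H0 of the chamber. *)
Lemma dual_basis_vector (R : fieldType) (V : vectType R) (D : seq 'Hom(V, R^o)) :
  free D -> exists v : V, forall a, a \in D -> a v = 1.
Proof.
move=> Dfree; pose d := \dim {: V}.
pose b := vbasis {: V}.
pose M : 'M[R]_(size D, d) := \matrix_(i, j) (D`_i (b`_j) : R).
have Mfree : row_free M.
  rewrite -kermx_eq0; apply/rowV0P => u /sub_kermxP uM.
  have /freeP F : free (in_tuple D) by [].
  apply/rowP => i; rewrite mxE; apply: (F (fun i => u 0 i)).
  apply/lfunP => v; rewrite sum_lfunE lfunE /=.
  rewrite (eq_bigr (fun i => \sum_j coord b j v * (u 0 i * M i j))).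
    rewrite exchange_big big1 // => j _; rewrite -mulr_sumr.
    by have /rowP/(_ j) := uM; rewrite !mxE => ->; rewrite mulr0.
  move=> i' _; rewrite {1}(coord_vbasis (memvf v)) linear_sum; apply: eq_bigr => j _.
  rewrite linearZ /=; congr (_ * _); rewrite mxE.
  exact: (@scale_lfunE R V R^o).
pose c : 'cV[R]_d := pinvmx M *m const_mx 1.
exists (\sum_j c j 0 *: b`_j) => a /(nthP 0)[i iD <-].
have := congr1 (fun A => (A *m const_mx 1 : 'cV[R]_(size D)) (Ordinal iD) 0) (mulmxVp Mfree).
rewrite -mulmxA -/c mul1mx mxE [in RHS]mxE => <-.
rewrite linear_sum; apply: eq_bigr => j _; rewrite linearZ /= [M _ _]mxE.
exact: mulrC.
Qed.

Lemma trace_bracket (R : comNzRingType) n (Z Y H : 'M[R]_n) :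
  \tr ((Z *m Y - Y *m Z) *m H) = \tr (Z *m (Y *m H - H *m Y)).
Proof.
have trB (A B : 'M[R]_n) : \tr (A - B) = \tr A - \tr B by exact: raddfB.
rewrite mulmxBl mulmxBr !trB mulmxA; congr (_ - _).
by rewrite -mulmxA mxtrace_mulC mulmxA.
Qed.

Section RealCartan.
Local Opaque peval.
Variables (K : rcfType) (n : nat) (PG PS : seq (mxpol K n)) (h : 'M[K]_n).
Hypothesis T : split_frame PG PS h.
Variables (R : realType) (iR : {rmorphism K -> R}).
Variable Delta : seq (dual_space (frak_a iR PS)).
Hypothesis hDelta : root_basis (root_system iR PG PS) Delta.
Notation SpR := (torus_pos PS h iR).
Notation G := (zero_locus iR PG).
Notation hR := (map_mx iR h).
Notation hR_unit := (frame_map_unit T iR).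
Notation fa := (frak_a iR PS).
Notation lieG := (lie_algebra G).

Lemma lieGD X Y : lieG X -> lieG Y -> lieG (X + Y).
Proof.
apply: (@lieD R n G (points1 T iR) (@pointsM _ _ _ _ _ T _ iR)).
exact: (@zero_locus_limit _ _ PG R iR).
Qed.

Lemma lieGN X : lieG X -> lieG (- X).
Proof. exact: lieN. Qed.

Lemma lieG_Ad k X : G k -> lieG X -> lieG (k *m X *m invmx k).
Proof.
exact: (@lie_Ad R n G (@pointsM _ _ _ _ _ T _ iR) (@pointsV _ _ _ _ _ T _ iR)
   (@points_unit _ _ _ _ _ T _ iR)).
Qed.

Lemma lieG_tr X : lieG X -> lieG X^T.
Proof. by apply: lie_tr => g; exact: (pointsT T). Qed.

Lemma exp_skew_orthogonal (Z : 'M[R]_n) : Z^T = - Z -> expmx Z *m (expmx Z)^T = 1%:M.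
Proof. by move=> ZT; rewrite expmx_tr ZT expmxN. Qed.

(** The logarithm is taken in an eigenbasis w. Natural powers of g g^T lie in G, so by
    [zero_locus_power] all its real powers exp (t X) do. *)
Lemma gram_log g : G g -> exists X, [/\ X^T = X, lieG X & expmx X = g *m g^T].
Proof.
move=> Gg; set q := g *m g^T; have qT : q^T = q by rewrite /q trmx_mul trmxK.
have [w wu qE] := symmetric_cdiag qT; set d := dv w q in qE.
have d0 i : 0 < d 0 i.
  apply: (@gram_eigenvalue_gt0 _ _ w g^T d i wu); last by rewrite trmxK -/q.
  by rewrite unitmx_tr; exact: (points_unit T Gg).
have Gq : G q by apply: (pointsM T Gg); exact: (pointsT T Gg).
exists (cdiag w (\row_i ln (d 0 i))); split.
- by apply: symmetric_fun => //; rewrite -qE.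
- move=> t; rewrite cdiag_exp_diag //.
  have := @zero_locus_power R n _ iR PG w d t wu d0 _.
  rewrite (_ : \row_i expR (t * (\row_i ln (d 0 i)) 0 i) = \row_i expR (t * ln (d 0 i))).
    apply; elim=> [|k IH].
      rewrite (_ : \row_i _ = const_mx 1); first by rewrite (cdiag1 wu); exact: (points1 T).
      by apply/rowP => i; rewrite !mxE.
    rewrite (_ : \row_i _ = rv_mul d (\row_i d 0 i ^+ k)).
      by rewrite -(cdiagM wu) -qE; exact: (pointsM T Gq IH).
    by apply/rowP => i; rewrite [LHS]mxE [RHS]mxE [X in _ * X]mxE exprS.
  by apply/rowP => i; rewrite !mxE.
- rewrite expmx_cdiag // [RHS]qE; congr (cdiag _ _).
  by apply/rowP => i; rewrite [LHS]mxE [X in expR X]mxE (lnK (d0 i)).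
Qed.

Lemma trace_max (X H : 'M[R]_n) : exists k, [/\ G k, k *m k^T = 1%:M &
  forall k', G k' -> k' *m k'^T = 1%:M ->
    \tr (k' *m X *m k'^T *m H) <= \tr (k *m X *m k^T *m H)].
Proof.
pose t : sterm R n := SSum (enum 'I_n) (fun i =>
  SEnt (MMul (MMul (MMul (MVar _ _ 0) (MCst X)) (MTr (MVar _ _ 0))) (MCst H)) i i).
have tE k : sval_ idfun (fun=> k) (fun=> 0) t = \tr (k *m X *m k^T *m H).
  rewrite sval_SSum big_enum; apply: eq_bigr => i _ /=.
  by rewrite !map_mx_id.
have [k [Gk ko kmax]] := orthogonal_max t (points1 T iR).
exists k; split=> // k' Gk' k'o; have := kmax k' Gk' k'o.
by rewrite !tE.
Qed.

(** The bracket Z of H and Y is itself an admissible skew direction, and in this direction the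
    first-order condition reads tr (Z Z^T) = 0. *)
Lemma commutes_of_max (H Y : 'M[R]_n) : H \in fa -> Y^T = Y -> lieG Y ->
  (forall Z, Z^T = - Z -> lieG Z -> forall t,
     \tr (expmx (t *: Z) *m Y *m (expmx (t *: Z))^T *m H) <= \tr (Y *m H)) ->
  H *m Y - Y *m H = 0.
Proof.
move=> Hfa YT HY Hmax; set Z := H *m Y - Y *m H; have HT := frak_a_sym T Hfa.
have ZT : Z^T = - Z by rewrite /Z linearB /= !trmx_mul YT HT opprB.
have lZ : lieG Z := lie_bracket T Hfa HY.
have [H1 _] := max_conditions ZT (Hmax Z ZT lZ).
by apply: tr_sqr_eq0; rewrite ZT {2}/Z opprB -trace_bracket.
Qed.

(* X' is the component of X along the functional H |-> H_i - H_j. *)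
Lemma lie_weight_all X (i j : 'I_n) : lieG X ->
  exists X', [/\ lieG X', (hR *m X' *m invmx hR) i j = (hR *m X *m invmx hR) i j &
    forall H, H \in fa -> H *m X' - X' *m H = (dv hR H 0 i - dv hR H 0 j) *: X'].
Proof.
move=> HX; pose b := vbasis fa.
have dvE (c : 'I_(\dim fa) -> R) k : dv hR (\sum_l c l *: b`_l) 0 k = \sum_l c l * dv hR b`_l 0 k.
  rewrite mxE; elim: (index_enum _) => [|l r IH].
    by rewrite !big_nil mulmx0 mul0mx mxE.
  by rewrite !big_cons conjD conjZ IH [dv _ _ _ _]mxE.
suff [X' [lX' Xij Xb]] : exists X', [/\ lieG X',
    (hR *m X' *m invmx hR) i j = (hR *m X *m invmx hR) i j &
    forall l, l \in enum 'I_(\dim fa) -> forall a c, (hR *m X' *m invmx hR) a c != 0 ->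
      dv hR b`_l 0 a - dv hR b`_l 0 c = dv hR b`_l 0 i - dv hR b`_l 0 j].
  exists X'; split=> // H Hfa; apply: (conj_inj hR_unit) => a c.
  rewrite (conj_bracket T) // conjZ; have [->|Xn0] := eqVneq ((hR *m X' *m invmx hR) a c) 0.
    by rewrite !mulr0.
  congr (_ * _); rewrite (coord_vbasis Hfa) !dvE -!sumrB; apply: eq_bigr => l _.
  by rewrite -!mulrBr; congr (_ * _); apply: Xb => //; exact: mem_enum.
elim: (enum 'I_(\dim fa)) => [|l r [X' [lX' Xij Xb]]]; first by exists X.
have bfa : b`_l \in fa by apply: vbasis_mem; apply: mem_nth; rewrite size_tuple.
(* The indicator of one eigenvalue projects to an eigenspace of ad b_l; the basis vectors of [fa]
   are treated one after another. *)
pose phi (x : R) : R := (x == dv hR b`_l 0 i - dv hR b`_l 0 j)%:R.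
exists (weight hR (fun a c => phi (dv hR b`_l 0 a - dv hR b`_l 0 c)) X'); split.
- exact: (lie_weight_exp T).
- by rewrite weightE ?hR_unit // /phi eqxx mul1r.
move=> l'; rewrite inE => /orP[/eqP->|l'r] a c; rewrite weightE ?hR_unit //.
  rewrite /phi; have [//|_] := eqVneq (dv hR b`_l 0 a - dv hR b`_l 0 c)
    (dv hR b`_l 0 i - dv hR b`_l 0 j).
  by rewrite mulr0n mul0r eqxx.
by rewrite mulf_eq0 negb_or => /andP[_]; exact: Xb.
Qed.

Lemma coord_functional (i : 'I_n) : exists beta : dual_space fa, forall H : subvs_of fa,
  beta H = dv hR (vsval H) 0 i.
Proof.
pose u (H : subvs_of fa) : R^o := dv hR (vsval H) 0 i.
have ulin : linear u.
  by move=> c A B; rewrite /u linearP /= ![dv _ _ _ _]mxE conjD conjZ.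
pose U : {linear subvs_of fa -> R^o} := HB.pack u (GRing.isLinear.Build _ _ _ _ u ulin).
by exists (linfun U) => H; rewrite lfunE.
Qed.

(* H0 is strictly inside the chamber, so no root vanishes on it. *)
Lemma root_on_interior (H0 : subvs_of fa) (beta : dual_space fa) :
  (forall alpha, alpha \in Delta -> alpha H0 = 1) -> root_system iR PG PS beta ->
  beta H0 != 0.
Proof.
have [_ _ Hbasis] := hDelta; move=> H01 broot; have [b0 _] := broot.
have [c bE] := Hbasis _ broot.
have S0 : (\sum_(i < size Delta) Delta`_i *+ c i : dual_space fa) H0 = (\sum_i c i)%:R.
  rewrite sum_lfunE natr_sum; apply: eq_bigr => i _.
  have -> : (Delta`_i *+ c i) H0 = Delta`_i H0 *+ c i.
    by elim: (c i) => [|m IH]; rewrite ?mulr0n ?zero_lfunE // !mulrS add_lfunE IH.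
  by rewrite H01 // mem_nth.
apply/eqP => bH; have c0 : (\sum_i c i)%N = 0%N.
  apply/eqP; rewrite -(pnatr_eq0 R) -S0.
  by case: bE bH => ->; rewrite ?opp_lfunE => /eqP; rewrite ?oppr_eq0.
have S00 : \sum_(i < size Delta) Delta`_i *+ c i = 0 :> dual_space fa.
  apply: big1 => i _; move/eqP: c0; rewrite sum_nat_eq0 => /forallP/(_ i) /= /eqP->.
  exact: mulr0n.
have bz : beta = 0 by case: bE => ->; rewrite S00 //; exact: oppr0.
by move/eqP: b0; apply; apply/funext => v; rewrite bz; exact: zero_lfunE.
Qed.

(** If H_i differs from H_j for some H, the component of Y at (i, j) is a root vector for the root H
    |-> H_i - H_j. This root is nonzero at H0, so Y would not commute with H0. *)
Lemma commutes_frak_a (H0 : subvs_of fa) (Y : 'M[R]_n) :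
  (forall alpha, alpha \in Delta -> alpha H0 = 1) -> lieG Y ->
  vsval H0 *m Y - Y *m vsval H0 = 0 ->
  forall i j, (hR *m Y *m invmx hR) i j != 0 ->
  forall H, H \in fa -> dv hR H 0 i = dv hR H 0 j.
Proof.
move=> H01 HY comm0 i j Yij H Hfa; apply/eqP; rewrite -subr_eq0; apply: contraT => Hij.
have [X [lX Xij XH]] := lie_weight_all i j HY.
have [bi biE] := coord_functional i; have [bj bjE] := coord_functional j.
pose beta : dual_space fa := bi - bj.
have betaE H' : beta H' = dv hR (vsval H') 0 i - dv hR (vsval H') 0 j.
  by rewrite add_lfunE opp_lfunE biE bjE.
have broot : root_system iR PG PS beta.
  split.
    apply: contraNneq Hij => b0; have := betaE (vsproj _ H).
    by rewrite vsprojK // b0 => <-.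
  exists X; split=> //.
    by apply: contraNneq Yij => X0; rewrite -Xij X0 mulmx0 mul0mx mxE.
  by move=> H'; rewrite betaE; apply: XH; exact: subvsP.
have := root_on_interior H01 broot; rewrite betaE => /negP[].
have := conj_bracket T Y i j (subvsP H0); rewrite comm0 mulmx0 mul0mx mxE => /esym/eqP.
by rewrite mulf_eq0 (negbTE Yij) orbF.
Qed.

(** With e = exp (t Y / 2) one has exp (t Y) = e^T e, and e commutes with A; so [gram_torus_pos],
    that is maximality, applies. *)
Lemma commuting_in_frak_a (Y : 'M[R]_n) : Y^T = Y -> lieG Y ->
  (forall i j, (hR *m Y *m invmx hR) i j != 0 ->
     forall H, H \in fa -> dv hR H 0 i = dv hR H 0 j) ->
  Y \in fa.
Proof.
move=> YT HY Yfa; have [w wu] := symmetric_cdiag YT; move: (dv w Y) => mu YE.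
apply/(frak_aE T) => t.
have -> : expmx (t *: Y) = (expmx ((t / 2) *: Y))^T *m expmx ((t / 2) *: Y).
  rewrite expmx_tr linearZ /= YT YE !cdiag_exp_diag // (cdiagM wu); congr (cdiag _ _).
  by apply/rowP => i; rewrite !mxE -expRD -mulrDl -splitr.
apply: (gram_torus_pos T); first exact: HY.
move=> s Ss; have [H Hfa HE] := torus_log T Ss.
have su : s \in unitmx := points_unit T (torus_sub T (proj1 Ss)).
suff sY : s *m Y *m invmx s = Y.
  have := expmx_conj ((t / 2) *: Y) su; rewrite -scalemxAr -scalemxAl sY => /(congr1 (mulmx^~ s)).
  by rewrite mulmxKV.
rewrite -[RHS](mulmxK su); congr (_ *m _); apply: (conj_inj hR_unit) => i j.
rewrite (torus_pos_cdiag T Ss) conjMcdiag ?hR_unit // conjMcdiagr ?hR_unit // mulrC.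
have [->|Yij] := eqVneq ((hR *m Y *m invmx hR) i j) 0; first by rewrite !mul0r.
congr (_ * _); have sE : dv hR s = map_mx expR (dv hR H).
  by rewrite -HE {1}(frak_a_cdiag T Hfa) expmx_cdiag ?hR_unit // cdiagK ?hR_unit.
by rewrite sE [LHS]mxE [RHS]mxE (Yfa _ _ Yij _ Hfa).
Qed.

(** For a root vector E put Z = E - E^T and W = E + E^T; then H Z - Z H = alpha(H) W on [fa]. The
    second-order condition along Z becomes - alpha(Y) tr (W W^T) <= 0. If W were 0, E would be skew,
    and the brackets of H0 with E and E^T would force E = - E. *)
Lemma chamber_of_max (H0 : subvs_of fa) (Y : 'M[R]_n) (Yfa : Y \in fa) (alpha : dual_space fa) :
  alpha H0 = 1 -> root_system iR PG PS alpha ->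
  (forall Z, Z^T = - Z -> lieG Z -> forall t,
     \tr (expmx (t *: Z) *m Y *m (expmx (t *: Z))^T *m vsval H0) <= \tr (Y *m vsval H0)) ->
  0 <= alpha (vsproj _ Y).
Proof.
move=> aH0 [_ [E [En0 lE HE]]] Hmax; set y := alpha _.
pose Z := E - E^T; pose W := E + E^T.
have ZT : Z^T = - Z by rewrite /Z raddfB /= trmxK opprB.
have lZ : lieG Z by exact: (lieGD lE (lieGN (lieG_tr lE))).
have brT H : H \in fa -> forall c, H *m E - E *m H = c *: E ->
    H *m E^T - E^T *m H = - (c *: E^T).
  move=> Hfa c /(congr1 trmx); rewrite raddfB /= !trmx_mul (frak_a_sym T Hfa) linearZ /= => <-.
  by rewrite opprB.
have brZ H : H \in fa -> forall c, H *m E - E *m H = c *: E -> H *m Z - Z *m H = c *: W.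
  move=> Hfa c Hc; have Hc' := brT H Hfa c Hc.
  rewrite /Z /W mulmxBr mulmxBl scalerDr -[c *: E^T]opprK -Hc' -Hc !opprD !opprK.
  move: (H *m E) (E *m H) (H *m E^T) (E^T *m H) => A B C D.
  by apply/matrixP => i j; rewrite !mxE; ring.
have H0Z : vsval H0 *m Z - Z *m vsval H0 = W.
  by rewrite (brZ _ (subvsP H0) _ (HE H0)) aH0 scale1r.
have YZ : Y *m Z - Z *m Y = y *: W.
  by apply: (brZ _ Yfa); have := HE (vsproj _ Y); rewrite vsprojK.
have [_] := max_conditions ZT (Hmax Z ZT lZ).
have -> : Z *m Y - Y *m Z = - (y *: W) by rewrite -YZ opprB.
have WT : W^T = W by rewrite /W raddfD /= trmxK addrC.
have -> : Z *m - (y *: W) - - (y *: W) *m Z = y *: (W *m Z - Z *m W).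
  by rewrite mulmxN mulNmx opprK -scalemxAl -scalemxAr scalerBr addrC.
rewrite -scalemxAl mxtraceZ trace_bracket.
have -> : Z *m vsval H0 - vsval H0 *m Z = - W by rewrite -H0Z opprB.
rewrite mulmxN -{2}WT; have -> : \tr (- (W *m W^T)) = - \tr (W *m W^T) by exact: raddfN.
rewrite mulrN oppr_le0 => Hle; rewrite leNgt; apply/negP => y0.
have W0 : \tr (W *m W^T) = 0.
  apply/eqP; rewrite eq_le tr_sqr_ge0 andbT leNgt; apply/negP => tp.
  by move: Hle; rewrite leNgt nmulr_rlt0 // tp.
have EE : E^T = - E by apply/eqP; rewrite -addr_eq0 addrC -/W; apply/eqP/tr_sqr_eq0.
have := brT _ (subvsP H0) _ (HE H0); rewrite EE aH0 scale1r mulmxN mulNmx.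
have := HE H0; rewrite aH0 scale1r.
move: (vsval H0 *m E) (E *m vsval H0) => A B e1 e2; case/eqP: En0; apply/matrixP => i j.
have := congr1 (fun M : 'M[R]_n => M i j) e1; have := congr1 (fun M : 'M[R]_n => M i j) e2.
by rewrite !mxE; lra.
Qed.

Lemma real_cartan g : G g -> exists k Y, [/\ G k, k *m k^T = 1%:M, Y \in fa,
  k *m (g *m g^T) *m k^T = expmx Y &
  forall alpha, alpha \in Delta -> 0 <= alpha (vsproj _ Y)].
Proof.
move=> Gg; have [X [XT lX XE]] := gram_log Gg.
have [/basis_free Dfree Droot _] := hDelta.
have [H0 H01] := dual_basis_vector Dfree.
have [k [Gk ko kmax]] := trace_max X (vsval H0).
pose Y := k *m X *m k^T.
have kV : k^T = invmx k by rewrite -[RHS]mul1mx -(mulmx1C ko) mulmxK // (points_unit T Gk).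
have YT : Y^T = Y by rewrite /Y !trmx_mul trmxK XT mulmxA.
have lY : lieG Y by rewrite /Y kV; exact: lieG_Ad.
have Ymax Z : Z^T = - Z -> lieG Z -> forall t,
    \tr (expmx (t *: Z) *m Y *m (expmx (t *: Z))^T *m vsval H0) <= \tr (Y *m vsval H0).
  move=> ZT lZ t; have tZT := tr_skew t ZT.
  set e := expmx (t *: Z).
  have eko : (e *m k) *m (e *m k)^T = 1%:M.
    by rewrite trmx_mul mulmxA -(mulmxA e) ko mulmx1 exp_skew_orthogonal.
  have := kmax _ (pointsM T (lZ t) Gk) eko; rewrite trmx_mul.
  by rewrite (_ : e *m k *m X *m (k^T *m e^T) = e *m Y *m e^T) // /Y !mulmxA.
have Yfa : Y \in fa.
  have comm := commutes_of_max (subvsP H0) YT lY Ymax.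
  exact: (commuting_in_frak_a YT lY (commutes_frak_a H01 lY comm)).
exists k, Y; split=> //.
  by rewrite -XE /Y kV expmx_conj // (points_unit T Gk).
move=> alpha aD; apply: (chamber_of_max Yfa (H01 _ aD) (Droot _ aD) Ymax).
Qed.

End RealCartan.

(** * Characters *)

Lemma sval_SMul (E : nzRingType) n (L : comNzRingType) (f : E -> L) r s (t u : sterm E n) :
  sval_ f r s (SMul t u) = sval_ f r s t * sval_ f r s u.
Proof. by []. Qed.

Section Characters.
Local Opaque peval.
Variables (K : rcfType) (n : nat) (PG PS : seq (mxpol K n)) (h : 'M[K]_n).
Hypothesis T : split_frame PG PS h.
Variables (R : realType) (iR : {rmorphism K -> R}).
Notation SpR := (torus_pos PS h iR).
Notation hR := (map_mx iR h).
Notation hR_unit := (frame_map_unit T iR).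
Notation fa := (frak_a iR PS).

(* s_i / s_j in diagonal coordinates, since adj s = s^-1 on the torus. *)
Definition ratio_term (ij : 'I_n * 'I_n) : sterm K n :=
  SMul (eterm h 0 ij.1 ij.1) (eterm_adj h 0 ij.2 ij.2).

Lemma sval_ratio (L : fieldType) (f : {rmorphism K -> L}) r s ij : \det (r 0%N) = 1 ->
  is_diag_mx (map_mx f h *m r 0%N *m invmx (map_mx f h)) ->
  sval_ f r s (ratio_term ij) = dv (map_mx f h) (r 0%N) 0 ij.1 / dv (map_mx f h) (r 0%N) 0 ij.2.
Proof.
move=> d1 rd; rewrite -(sval_eterm_diag h f r s) -(@sval_eterm_adj _ _ h _ f r s) //.
exact: (frame_unit T).
Qed.

Lemma sval_ratio_pos (L : rcfType) (f : {rmorphism K -> L}) r s ij :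
  torus_pos PS h f (r 0%N) ->
  sval_ f r s (ratio_term ij) = dv (map_mx f h) (r 0%N) 0 ij.1 / dv (map_mx f h) (r 0%N) 0 ij.2.
Proof.
by move=> [Sr _]; apply: sval_ratio; [exact: (points_det T (torus_sub T Sr))|exact: (torus_diag T Sr)].
Qed.

Lemma dv_expmx H i : H \in fa -> dv hR (expmx H) 0 i = expR (dv hR H 0 i).
Proof.
move=> Hfa; rewrite {1}(frak_a_cdiag T Hfa) expmx_cdiag ?hR_unit // cdiagK ?hR_unit //.
by rewrite mxE.
Qed.

Lemma frak_a_expmx H : H \in fa -> SpR (expmx H).
Proof. by move=> /(frak_a_exp T 1); rewrite scale1r. Qed.

(** Any nonzero coordinate (i, j) of a root vector shows the eigenvalue H_i - H_j of ad H. *)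
Lemma root_coordinates alpha : root_system iR PG PS alpha -> exists ij : 'I_n * 'I_n,
  forall H : subvs_of fa, alpha H = dv hR (vsval H) 0 ij.1 - dv hR (vsval H) 0 ij.2.
Proof.
move=> [_ [X [Xn0 _ HX]]].
have [i [j Xij]] : exists i j, (hR *m X *m invmx hR) i j != 0.
  apply: contrapT => H; case/eqP: Xn0; apply: (conj_inj hR_unit) => i j.
  rewrite mulmx0 mul0mx [RHS]mxE; apply/eqP; apply: contrapT => /negP Hij.
  by apply: H; exists i, j.
exists (i, j) => H; have := conj_bracket T X i j (subvsP H).
by rewrite HX conjZ => /(mulIf Xij).
Qed.

Lemma ratio_character (alpha : dual_space fa) ij :
  (forall H : subvs_of fa, alpha H = dv hR (vsval H) 0 ij.1 - dv hR (vsval H) 0 ij.2) ->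
  character_of alpha (spolm (ratio_term ij)).
Proof.
move=> aE; have [[[torus1 _ torusM _] _ _] SG _] := frame_maximal T.
have [_ points_det _ _] := frame_semisimple T.
have hCu : map_mx (real_complex K) h \in unitmx by rewrite map_unitmx (frame_unit T).
have pE s : geom_points PS s -> peval (real_complex K) (spolm (ratio_term ij)) s =
    dv (map_mx (real_complex K) h) s 0 ij.1 / dv (map_mx (real_complex K) h) s 0 ij.2.
  move=> Ss; rewrite peval_spolm sval_ratio //; first exact: (points_det _ (SG _ Ss)).
  exact: (frame_diag T Ss).
split.
- by rewrite (pE _ torus1) -(cdiag1 hCu) cdiagK // !mxE divr1.
- move=> s t Ss St; rewrite (pE _ Ss) (pE _ St) (pE _ (torusM _ _ Ss St)).
  rewrite (dvM hCu (frame_diag T Ss) (frame_diag T St)).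
  by rewrite [X in X / _]mxE [X in _ / X]mxE invfM mulrACA.
- move=> H; rewrite peval_spolm sval_ratio_pos; last exact: frak_a_expmx (subvsP H).
  by rewrite !dv_expmx ?subvsP // aE expRB.
Qed.

(** Both polynomials equal e^alpha on exp ([fa]), which is all of A over R; equality on A then
    transfers. *)
Lemma character_unique (alpha : dual_space fa) p p' (L : rcfType) (f : {rmorphism K -> L}) a :
  character_of alpha p -> character_of alpha p' -> torus_pos PS h f a ->
  peval f p a = peval f p' a.
Proof.
move=> [_ _ Hp] [_ _ Hp'] Sa.
have : fsem f (fun=> 0) (fun=> 0) (FAllM 0 (FImp (FAnd (FZero PS (MVar K n 0)) (FPos h 0))
    (FEq (SPol p (MVar K n 0)) (SPol p' (MVar K n 0))))).
  apply/MQE.transfer; apply: (MQE.transfer iR _).1 => s /(@fsem_pos_torus _ _ _ _ _ iR).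
  move=> /(torus_log T)[H Hfa HE].
  change (expmx H = s) in HE; change (peval iR p s = peval iR p' s).
  by rewrite -HE -[H](vsprojK Hfa) Hp Hp'.
by move=> /(_ a); apply; apply/(@fsem_pos_torus _ _ _ _ _ f).
Qed.

Lemma chiE (F : rcfType) (iF : {rmorphism K -> F}) (alpha : dual_space fa) p a :
  character_of alpha p -> torus_pos PS h iF a -> chi iF alpha a = peval iF p a.
Proof.
move=> ap Sa; rewrite /chi.
set X := [set _ | _]; have /(xgetPex 0) [p' ap' ->] : exists c, X c.
  by exists (peval iF p a), p.
exact: character_unique ap' ap Sa.
Qed.

Lemma chi_ratio (F : rcfType) (iF : {rmorphism K -> F}) (alpha : dual_space fa) ij a :
  (forall H : subvs_of fa, alpha H = dv hR (vsval H) 0 ij.1 - dv hR (vsval H) 0 ij.2) ->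
  torus_pos PS h iF a ->
  chi iF alpha a = dv (map_mx iF h) a 0 ij.1 / dv (map_mx iF h) a 0 ij.2.
Proof.
by move=> /ratio_character ap Sa; rewrite (chiE ap Sa) peval_spolm sval_ratio_pos.
Qed.

(** The bound c is quantified inside the sentence, so after transfer it may be infinitely large over
    K. *)
Lemma torus_unbounded (L : rcfType) (f : {rmorphism K -> L}) i j a0 (c : L) :
  torus_pos PS h f a0 -> dv (map_mx f h) a0 0 i != dv (map_mx f h) a0 0 j ->
  exists2 a, torus_pos PS h f a & c * dv (map_mx f h) a 0 i < dv (map_mx f h) a 0 j.
Proof.
pose FSp b : mform K n := FAnd (FZero PS (MVar K n b)) (FPos h b).
have : fsem f (fun=> 0) (fun=> 0) (FAllM 0 (FAllS 0 (FImp (FSp 0%N)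
   (FImp (FNot (FEq (eterm h 0 i i) (eterm h 0 j j)))
     (FExM 1 (FAnd (FSp 1%N) (FLt (SMul (SVar 0) (eterm h 1 i i)) (eterm h 1 j j)))))))).
  apply/MQE.transfer; apply: (MQE.transfer iR _).1 => {c}s c /(@fsem_pos_torus _ _ _ _ _ iR) Ss.
  move=> sij0; have sij : dv hR s 0 i <> dv hR s 0 j.
    by move=> E; apply: sij0; rewrite /fsem !sval_eterm_diag.
  have [s0 si] : (forall k, 0 < dv hR s 0 k) /\ ln (dv hR s 0 j) - ln (dv hR s 0 i) != 0.
    split; first by case: Ss.
    rewrite subr_eq0; apply/eqP => lij; apply: sij.
    by have [_ s0] := Ss; rewrite -(lnK (s0 i)) -(lnK (s0 j)) lij.
  (* This exponent makes the ratio of the two coordinates equal to e^|c| >= 1 + |c| > c. *)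
  have := torus_pos_pow T (`|c| / (ln (dv hR s 0 j) - ln (dv hR s 0 i))) Ss.
  set t := _ / _; set y := cdiag _ _ => Sy; exists y; split.
    exact/(@fsem_pos_torus _ _ _ _ _ iR).
  suff : c * dv hR y 0 i < dv hR y 0 j.
    by rewrite /fsem sval_SMul !sval_eterm_diag.
  rewrite /y (cdiagK hR_unit) mxE [ltRHS]mxE -ltr_pdivlMr ?expR_gt0 // -expRB -mulrBr.
  rewrite /t divfK //; apply: lt_le_trans (expR_ge1Dx _).
  by rewrite (le_lt_trans (ler_norm c)) // ltrDr ltr01.
move=> /(_ a0 c) H Sa aij; have [||a [/(@fsem_pos_torus _ _ _ _ _ f) Sa' Ha]] := H.
- exact/(@fsem_pos_torus _ _ _ _ _ f).
- by rewrite /fsem !sval_eterm_diag => /eqP; apply/negP.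
exists a; first exact: Sa'.
by move: Ha; rewrite /fsem sval_SMul !sval_eterm_diag.
Qed.

End Characters.

(** * Cartan decomposition over F *)

Section CartanTransfer.
Local Opaque peval.
Variables (K : rcfType) (n : nat) (PG PS : seq (mxpol K n)) (h : 'M[K]_n).
Hypothesis T : split_frame PG PS h.
Variables (R : realType) (iR : {rmorphism K -> R}).
Variable Delta : seq (dual_space (frak_a iR PS)).
Hypothesis hDelta : root_basis (root_system iR PG PS) Delta.
Notation SpR := (torus_pos PS h iR).
Notation hR := (map_mx iR h).
Notation hR_unit := (frame_map_unit T iR).
Notation fa := (frak_a iR PS).

(* The pairs (i, j) such that s_i / s_j is the character of a simple root. *)
Definition simple_pairs : seq ('I_n * 'I_n) :=
  [seq p <- enum {: 'I_n * 'I_n} | `[< exists2 alpha : dual_space fa, alpha \in Delta &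
     forall H : subvs_of fa, alpha H = dv hR (vsval H) 0 p.1 - dv hR (vsval H) 0 p.2 >]].
Notation ps := simple_pairs.

Lemma simple_pairsP p : p \in ps -> exists2 alpha : dual_space fa, alpha \in Delta &
  forall H : subvs_of fa, alpha H = dv hR (vsval H) 0 p.1 - dv hR (vsval H) 0 p.2.
Proof. by rewrite mem_filter => /andP[/asboolP]. Qed.

Lemma simple_pair alpha : alpha \in Delta -> exists2 p, p \in ps &
  forall H : subvs_of fa, alpha H = dv hR (vsval H) 0 p.1 - dv hR (vsval H) 0 p.2.
Proof.
move=> aD; have [_ Droot _] := hDelta; have [p pE] := root_coordinates T (Droot _ aD).
exists p => //; rewrite mem_filter mem_enum andbT; apply/asboolP.
by exists alpha.
Qed.

Definition chamber_ge (L : rcfType) (f : {rmorphism K -> L}) (a : 'M[L]_n) :=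
  forall p, p \in ps -> dv (map_mx f h) a 0 p.2 <= dv (map_mx f h) a 0 p.1.

Definition FChamber b : mform K n :=
  FConj ps (fun p => FNot (FLt (eterm h b p.1 p.1) (eterm h b p.2 p.2))).

Lemma fsem_chamber (L : rcfType) (f : {rmorphism K -> L}) r s b :
  fsem f r s (FChamber b) <-> chamber_ge f (r b).
Proof.
split=> H p pps; have := H p pps; rewrite /fsem !sval_eterm_diag leNgt => /negP; exact.
Qed.

Lemma cartan (L : rcfType) (f : {rmorphism K -> L}) g : zero_locus f PG g ->
  exists k a, [/\ zero_locus f PG k, k *m k^T = 1%:M, torus_pos PS h f a, chamber_ge f a &
    k *m (g *m g^T) *m k^T = a *m a].
Proof.
pose FSp b : mform K n := FAnd (FZero PS (MVar K n b)) (FPos h b).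
pose v b := MVar K n b.
have : fsem f (fun=> 0) (fun=> 0) (FAllM 0 (FImp (FZero PG (v 0%N))
   (FExM 1 (FExM 2 (FAnd (FZero PG (v 1%N)) (FAnd (FEqM (MMul (v 1%N) (MTr (v 1%N))) (MCst 1%:M))
     (FAnd (FSp 2%N) (FAnd (FChamber 2) (FEqM (MMul (MMul (v 1%N) (MMul (v 0%N) (MTr (v 0%N)))) (MTr (v 1%N)))
       (MMul (v 2%N) (v 2%N))))))))))).
  apply/MQE.transfer; apply: (MQE.transfer iR _).1 => {}g /(@fsem_zero _ _ _ iR) Gg.
  have [k [Y [Gk ko Yfa YE Ych]]] := real_cartan T hDelta Gg.
  (* The Gram matrix g g^T is conjugate to the square of the Cartan factor, hence half of Y. *)
  have Y2fa : 2^-1 *: Y \in fa by rewrite memvZ.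
  pose a := expmx (2^-1 *: Y); have Sa : SpR a := frak_a_expmx T Y2fa.
  exists k, a; split; first exact/(@fsem_zero _ _ _ iR).
  split; first by change (k *m k^T = map_mx iR 1%:M); rewrite map_mx1.
  split; first exact/(@fsem_pos_torus _ _ _ _ _ iR).
  split.
    apply/fsem_chamber => p /simple_pairsP[alpha aD pE]; change (dv hR a 0 p.2 <= dv hR a 0 p.1).
    rewrite /a !(dv_expmx T _ Y2fa) ler_expR -subr_ge0.
    have := pE (vsproj fa (2^-1 *: Y)); rewrite vsprojK // => <-.
    by rewrite linearZ linearZ /= mulr_ge0 ?invr_ge0 ?ler0n // Ych.
  change (k *m (g *m g^T) *m k^T = a *m a); rewrite YE /a (frak_a_cdiag T Yfa).
  rewrite cdiag_exp_diag ?hR_unit // expmx_cdiag ?hR_unit // (cdiagM hR_unit); congr (cdiag _ _).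
  move: (dv _ _) => mu; apply/rowP => i; rewrite !mxE -expRD; congr expR.
  by field.
move=> /(_ g) H Gg; have [|k [a [H1 [H2 [H3 [H4 H5]]]]]] := H.
  exact/(@fsem_zero _ _ _ f).
exists k, a; split.
- by move: H1 => /(@fsem_zero _ _ _ f).
- by rewrite -(map_mx1 f); exact: H2.
- by move: H3 => /(@fsem_pos_torus _ _ _ _ _ f).
- by move: H4 => /fsem_chamber.
- exact: H5.
Qed.

(** The functionals H |-> H_i are real combinations of simple roots, which are nonnegative on the
    chamber. M exceeds the sum of the absolute values of all coefficients; being a natural number
    independent of L, it makes the bound a first-order sentence. *)
Lemma chamber_bound : exists M, forall (L : rcfType) (f : {rmorphism K -> L}) a,
  torus_pos PS h f a -> chamber_ge f a -> forall i, dv (map_mx f h) a 0 i <=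
    (\prod_(p <- ps) (dv (map_mx f h) a 0 p.1 / dv (map_mx f h) a 0 p.2)) ^+ M.
Proof.
have [Dbasis _ _] := hDelta.
have [lam lamE] := choice (@coord_functional K n PS h R iR).
pose c i k : R := coord (in_tuple Delta) k (lam i).
pose x := \sum_i \sum_k `|c i k|.
have x0 : 0 <= x by apply: sumr_ge0 => i _; apply: sumr_ge0.
have [M xM] : exists M : nat, x <= M%:R.
  by exists (Num.bound x); apply: ltW; apply: archi_boundP.
exists M => L f a Sa Ca i.
pose FSp b : mform K n := FAnd (FZero PS (MVar K n b)) (FPos h b).
have : fsem f (fun=> 0) (fun=> 0) (FAllM 0 (FImp (FSp 0%N) (FImp (FChamber 0)
    (FNot (FLt (SExp (SProd ps (fun p => ratio_term h p)) M) (eterm h 0 i i)))))).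
  apply/MQE.transfer; apply: (MQE.transfer iR _).1 => {Sa Ca}s /(@fsem_pos_torus _ _ _ _ _ iR) Ss.
  move=> /fsem_chamber Cs; change (chamber_ge iR s) in Cs; change (SpR s) in Ss.
  rewrite /fsem sval_SExp sval_SProd sval_eterm_diag.
  change (upd (fun=> 0) 0 s 0%N) with s; apply/negP; rewrite -leNgt.
  rewrite (eq_bigr (fun p => dv hR s 0 p.1 / dv hR s 0 p.2)); last first.
    by move=> p _; rewrite (sval_ratio_pos T).
  have [H Hfa HE] := torus_log T Ss.
  pose H' := vsproj fa H; have H'E : vsval H' = H by rewrite vsprojK.
  pose ht (p : 'I_n * 'I_n) := dv hR H 0 p.1 - dv hR H 0 p.2.
  have ht0 p : p \in ps -> 0 <= ht p.
    by move=> pps; rewrite subr_ge0 -ler_expR -!(dv_expmx T _ Hfa) HE; exact: Cs.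
  have -> : \prod_(p <- ps) (dv hR s 0 p.1 / dv hR s 0 p.2) = expR (\sum_(p <- ps) ht p).
    by rewrite expR_sum; apply: eq_bigr => p _; rewrite -HE !(dv_expmx T _ Hfa) expRB.
  rewrite -expRM_natl -{1}HE (dv_expmx T _ Hfa) ler_expR.
  have -> : dv hR H 0 i = \sum_k c i k * Delta`_k H'.
    rewrite -{1}H'E -lamE {1}(coord_span (X := in_tuple Delta) (v := lam i)); last first.
      by rewrite (span_basis Dbasis) memvf.
    by rewrite sum_lfunE; apply: eq_bigr => k _; exact: (@scale_lfunE R (subvs_of fa) R^o).
  set S := \sum_(p <- ps) _; have S0 : 0 <= S by rewrite /S big_seq; apply: sumr_ge0.
  apply: (@le_trans _ _ (\sum_k `|c i k| * S)).
    apply: ler_sum => k _; have kD : Delta`_k \in Delta by rewrite mem_nth.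
    have [p pps pE] := simple_pair kD; rewrite pE H'E -/(ht p).
    apply: (@le_trans _ _ (`|c i k| * ht p)).
      by apply: ler_wpM2r; [exact: ht0|exact: ler_norm].
    apply: ler_wpM2l => //; rewrite /S (big_rem p) //= lerDl big_seq sumr_ge0 // => q qr.
    by apply: ht0; exact: mem_rem qr.
  rewrite -mulr_suml; apply: ler_wpM2r => //; apply: le_trans xM.
  by rewrite /x (bigD1 i) //= lerDl; apply: sumr_ge0 => i' _; apply: sumr_ge0.
move=> /(_ a) H; rewrite leNgt; apply/negP => Hlt; apply: H.
- exact/(@fsem_pos_torus _ _ _ _ _ f).
- exact/(@fsem_chamber _ f).
rewrite /fsem sval_SExp sval_SProd sval_eterm_diag.
rewrite (eq_bigr (fun p => dv (map_mx f h) a 0 p.1 / dv (map_mx f h) a 0 p.2)) //.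
by move=> p _; exact: (sval_ratio_pos T).
Qed.

End CartanTransfer.

(** * The convex subring *)

Section ConvexSubring.
Variables (F : rcfType) (O : {pred F}).
Hypothesis hO : convex_subring O.

Lemma O1 : 1 \in O. Proof. by have [[]] := hO. Qed.
Lemma OB x y : x \in O -> y \in O -> x - y \in O.
Proof. by have [[_ H _] _ _] := hO; exact: H. Qed.
Lemma OM x y : x \in O -> y \in O -> x * y \in O.
Proof. by have [[_ _ H] _ _] := hO; exact: H. Qed.
Lemma O0 : 0 \in O. Proof. by rewrite -(subrr (1 : F)); apply: OB; exact: O1. Qed.
Lemma ON x : x \in O -> - x \in O.
Proof. by move=> xO; rewrite -sub0r; apply: OB => //; exact: O0. Qed.
Lemma OD x y : x \in O -> y \in O -> x + y \in O.
Proof. by move=> xO yO; rewrite -[y]opprK; apply: OB => //; exact: ON. Qed.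
Lemma Osum (I : Type) (r : seq I) (P : pred I) (f : I -> F) :
  (forall i, P i -> f i \in O) -> \sum_(i <- r | P i) f i \in O.
Proof. by move=> H; elim/big_ind: _ => //; [exact: O0|exact: OD]. Qed.
Lemma Oprod (I : Type) (r : seq I) (P : pred I) (f : I -> F) :
  (forall i, P i -> f i \in O) -> \prod_(i <- r | P i) f i \in O.
Proof. by move=> H; elim/big_ind: _ => //; [exact: O1|exact: OM]. Qed.
Lemma OX x m : x \in O -> x ^+ m \in O.
Proof. by move=> xO; elim: m => [|m IH]; [rewrite expr0; exact: O1|rewrite exprS; exact: OM]. Qed.
Lemma Onat m : m%:R \in O.
Proof. by elim: m => [|m IH]; [exact: O0|rewrite -natr1; apply: OD => //; exact: O1]. Qed.

Lemma O_ge0_le x y : 0 <= x -> x <= y -> y \in O -> x \in O.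
Proof. by have [_ H _] := hO; move=> x0 xy yO; apply: (H 0 y x) => //; exact: O0. Qed.

Lemma O_norm_le x y : `|x| <= y -> y \in O -> x \in O.
Proof.
have [_ H _] := hO; rewrite ler_norml => /andP[h1 h2] yO.
by apply: (H (- y) y x) => //; exact: ON.
Qed.

Lemma O_norm x : x \in O -> `|x| \in O.
Proof. by move=> xO; case: (ger0P x) => _; [|exact: ON]. Qed.

(** By convexity, since |x| <= 1 + x^2. *)
Lemma O_sqr x : x ^+ 2 \in O -> x \in O.
Proof.
move=> xO; apply: (@O_norm_le x (1 + x ^+ 2)); last by apply: OD => //; exact: O1.
have := sqr_ge0 (`|x| - 1); rewrite -(real_normK (num_real x)).
by move: `|x| (normr_ge0 x) => y y0; rewrite !expr2; nra.
Qed.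

(** K embeds in the archimedean field R, so x is bounded by a natural number, and O is convex. *)
Lemma O_archimedean (K : rcfType) (R : realType) (iR : {rmorphism K -> R})
    (iF : {rmorphism K -> F}) x : iF x \in O.
Proof.
have le_morph (L : rcfType) (f : {rmorphism K -> L}) u w : (f u <= f w) = (u <= w).
  by rewrite !leNgt -subr_gt0 -rmorphB MQE.rmorph_gt0 subr_gt0.
have [m xm] : exists m : nat, `|iR x| <= m%:R.
  by exists (Num.bound `|iR x|); apply: ltW; apply: archi_boundP.
apply: (@O_norm_le _ m%:R); last exact: Onat.
move: xm; rewrite !ler_norml -!(rmorph_nat iR) -!(rmorph_nat iF) -!rmorphN.
by rewrite !le_morph.
Qed.

Definition Omx m n (A : 'M[F]_(m, n)) := forall i j, A i j \in O.

Lemma OmxM m n p (A : 'M[F]_(m, n)) (B : 'M[F]_(n, p)) : Omx A -> Omx B -> Omx (A *m B).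
Proof. by move=> HA HB i j; rewrite mxE; apply: Osum => k _; exact: OM. Qed.

Lemma OmxT m n (A : 'M[F]_(m, n)) : Omx A -> Omx A^T.
Proof. by move=> HA i j; rewrite mxE. Qed.

Lemma Odet n (A : 'M[F]_n) : Omx A -> \det A \in O.
Proof.
move=> HA; apply: Osum => s _; apply: OM; last exact: Oprod.
by apply: OX; apply: ON; exact: O1.
Qed.

Lemma Omx_inv n (A : 'M[F]_n) : \det A = 1 -> Omx A -> Omx (invmx A).
Proof.
move=> d1 HA i j; rewrite invmx_det1 // mxE; apply: OM; first by apply: OX; apply: ON; exact: O1.
by apply: Odet => a b; rewrite !mxE.
Qed.

Lemma Omx_orthogonal n (k : 'M[F]_n) : k *m k^T = 1%:M -> Omx k.
Proof. by move=> ko i j; apply: (@O_norm_le _ 1); [exact: orthogonal_entry|exact: O1]. Qed.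

(** Diagonal entries of b b^T are sums of squares and so dominate the square of each entry of b. *)
Lemma Omx_gram n (b : 'M[F]_n) : Omx (b *m b^T) -> Omx b.
Proof.
move=> H i j; apply: O_sqr; apply: (O_ge0_le (sqr_ge0 _) _ (H i i)).
rewrite mxE (bigD1 j) //= mxE -expr2 lerDl; apply: sumr_ge0 => l _.
by rewrite mxE -expr2 sqr_ge0.
Qed.

Lemma O_unitsV u : O_units O u -> O_units O u^-1.
Proof. by move=> [u0 uO vO]; split; rewrite ?invr_eq0 // invrK. Qed.

Lemma coset_zeroP N : coset_opp (val_coset O N) = coset_zero O <-> O_units O N.
Proof.
have uM u w : O_units O u -> O_units O w -> O_units O (u * w).
  move=> [u0 uO vO] [w0 wO xO]; split; rewrite ?mulf_neq0 ?invfM //; exact: OM.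
split=> H.
  have : coset_zero O 1.
    by exists 1; rewrite ?mulr1 //; split; rewrite ?oner_neq0 ?invr1 //; exact: O1.
  rewrite -H => -[x [u Uu <-] /eqP]; rewrite invr_eq1 => /eqP Nu.
  have [u0 _ _] := Uu; have -> : N = u^-1 by rewrite -[LHS](mulfK u0) Nu mul1r.
  exact: O_unitsV.
apply/seteqP; split=> [_ [_ [u Uu <-] <-]|_ [u Uu <-]].
  by exists (N * u)^-1; rewrite ?mul1r //; apply/O_unitsV/uM.
exists u^-1; last by rewrite invrK mul1r.
have [N0 _ _] := H; exists (N^-1 * u^-1); last by rewrite mulVKf.
by apply: uM; exact: O_unitsV.
Qed.

End ConvexSubring.

(** * The stabilizer of the apartment *)

Section Stabilizer.
Local Opaque peval.
Variables (K : rcfType) (R : realType) (F : rcfType).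
Variables (iR : {rmorphism K -> R}) (iF : {rmorphism K -> F}).
Variables (O : {pred F}) (n : nat) (PG PS : seq (mxpol K n)) (h : 'M[K]_n).
Variable Delta : seq (dual_space (frak_a iR PS)).
Hypothesis hO : convex_subring O.
Hypothesis T : split_frame PG PS h.
Hypothesis hDelta : root_basis (root_system iR PG PS) Delta.
Notation A := (torus_pos PS h iF).
Notation G := (zero_locus iF PG).
Notation hF := (map_mx iF h).
Notation hF_unit := (frame_map_unit T iF).
Notation fa := (frak_a iR PS).
Notation Sigma := (root_system iR PG PS).

Lemma A_FE : A_F iF PS = A.
Proof. exact: (A_extE T iR iF). Qed.

Lemma Omx_hF : Omx O hF /\ Omx O (invmx hF).
Proof.
by rewrite -map_invmx; split=> i j; rewrite mxE; exact: (O_archimedean hO iR iF).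
Qed.

(** The entries of h and of its inverse come from K, which O contains. *)
Lemma Omx_conj x : Omx O (hF *m x *m invmx hF) <-> Omx O x.
Proof.
have [h1 h2] := Omx_hF; split=> H; last by apply: OmxM => //; exact: OmxM.
have -> : x = invmx hF *m (hF *m x *m invmx hF) *m hF.
  by rewrite !mulmxA mulVmx ?hF_unit // mul1mx mulmxKV ?hF_unit.
by apply: OmxM => //; exact: OmxM.
Qed.

Lemma Omx_torus a : A a -> Omx O a <-> forall i, dv hF a 0 i \in O.
Proof.
move=> Aa; rewrite -Omx_conj; split=> H; first by move=> i; rewrite mxE.
move=> i j; rewrite {1}(torus_pos_cdiag T Aa) conj_cdiag ?hF_unit //.
by case: (i == j); rewrite ?mulr1n ?mulr0n //; exact: O0.
Qed.

Lemma Omx_torus_sqr a : A a -> Omx O (a *m a) -> Omx O a.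
Proof.
move=> Aa /(Omx_torus (torus_posM T Aa Aa)) H; apply/(Omx_torus Aa) => i.
apply: (O_sqr hO); have := H i; rewrite (dvM hF_unit (torus_diag T (proj1 Aa)) (torus_diag T (proj1 Aa))).
by rewrite [X in X \in _ -> _]mxE expr2.
Qed.

(** The coordinates have product 1, so the inverse of one is the product of the others. *)
Lemma dv_inv_O a i : A a -> (forall k, dv hF a 0 k \in O) -> (dv hF a 0 i)^-1 \in O.
Proof.
move=> Aa aO; have d1 : \prod_k dv hF a 0 k = 1.
  by rewrite -(det_cdiag hF_unit) -(torus_pos_cdiag T Aa); exact: (points_det T (torus_sub T (proj1 Aa))).
have -> : (dv hF a 0 i)^-1 = \prod_(k | k != i) dv hF a 0 k.
  have i0 := torus_neq0 T i (proj1 Aa).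
  by apply: (mulfI i0); rewrite divff // -[LHS]d1 [LHS](bigD1 i).
by apply: (Oprod hO) => k _.
Qed.

Lemma chi_root alpha a : Sigma alpha -> A a -> exists p : 'I_n * 'I_n,
  (forall H : subvs_of fa, alpha H = dv (map_mx iR h) (vsval H) 0 p.1
     - dv (map_mx iR h) (vsval H) 0 p.2) /\
  chi iF alpha a = dv hF a 0 p.1 / dv hF a 0 p.2.
Proof.
by move=> /(root_coordinates T)[p pE] Aa; exists p; split; rewrite // (chi_ratio T pE Aa).
Qed.

Lemma A_plusE a : A_plus iF Delta a <-> A a /\ chamber_ge h Delta iF a.
Proof.
have [_ Droot _] := hDelta; rewrite /A_plus /= A_FE; split=> -[Aa H]; split=> //.
  move=> p /simple_pairsP[alpha aD pE]; have := H alpha aD.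
  rewrite (chi_ratio T pE Aa) ler_pdivlMr ?mul1r //.
  by have [_] := Aa; exact.
move=> alpha aD; have [p pps pE] := simple_pair T hDelta aD.
rewrite (chi_ratio T pE Aa) ler_pdivlMr ?mul1r; first exact: H.
by have [_] := Aa; exact.
Qed.

(** Every root is determined by a pair (i, j). Finiteness makes the product in [N_F] a genuine
    product over all roots. *)
Lemma root_system_finite : finite_set Sigma.
Proof.
pose X (p : 'I_n * 'I_n) : set (dual_space fa) := [set alpha |
  forall H : subvs_of fa, alpha H = dv (map_mx iR h) (vsval H) 0 p.1
     - dv (map_mx iR h) (vsval H) 0 p.2].
apply: (@sub_finite_set _ _ (\bigcup_(p in setT) X p)).
  by move=> alpha /(root_coordinates T)[p pE]; exists p.
apply: bigcup_finite; first exact: finite_finset.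
move=> p _; have [->|/set0P[alpha aX]] := eqVneq (X p) set0; first exact: finite_set0.
apply: (@sub_finite_set _ _ [set alpha]); last exact: finite_set1.
by move=> beta bX; apply/lfunP => H; rewrite aX bX.
Qed.

(** All factors of N are at least 1, so its inverse is in O by convexity and only N in O is at
    stake. Conversely each factor is a ratio of coordinates of a. *)
Lemma N_F_unit a : A a -> chamber_ge h Delta iF a ->
  O_units O (N_F iR iF PG PS a) <-> Omx O a.
Proof.
move=> Aa Ca; rewrite (Omx_torus Aa) /N_F fsbig_finite; last exact: root_system_finite.
have pos i : 0 < dv hF a 0 i by have [_] := Aa; exact.
have chi_gt0 alpha : Sigma alpha -> 0 < chi iF alpha a.
  by move=> aS; have [p [_ ->]] := chi_root aS Aa; rewrite divr_gt0.
have max_ge1 alpha : Sigma alpha -> 1 <= Num.max (chi iF alpha a) (chi iF alpha a)^-1.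
  by move=> aS; rewrite le_max invf_ge1 ?le_total //; exact: chi_gt0.
set s := (X in \prod_(alpha <- X) _).
have sP alpha : alpha \in s <-> Sigma alpha.
  by rewrite in_fset_set; [rewrite inE|exact: root_system_finite].
have N1 (r : seq (dual_space fa)) : {subset r <= s} ->
    1 <= \prod_(alpha <- r) Num.max (chi iF alpha a) (chi iF alpha a)^-1.
  move=> rs; rewrite big_seq; elim/big_ind: _ => // [x y|alpha ar].
    by move=> x1 y1; rewrite -[1]mulr1 ler_pM.
  by apply: max_ge1; apply/sP; exact: rs.
split=> [[_ NO _] i|aO].
  have chiO alpha : alpha \in Delta -> chi iF alpha a \in O.
    move=> aD; have [_ Droot _] := hDelta.
    apply: (O_ge0_le hO (ltW (chi_gt0 _ (Droot _ aD))) _ NO).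
    have as_ : alpha \in s by apply/sP; exact: Droot.
    rewrite (big_rem alpha) //=; apply: (@le_trans _ _ (Num.max (chi iF alpha a) (chi iF alpha a)^-1)).
      by rewrite le_max lexx.
    rewrite ler_peMr //; first by apply: le_trans (max_ge1 _ (Droot _ aD)).
    by apply: N1 => beta; exact: mem_rem.
  have [M HM] := chamber_bound T hDelta.
  apply: (O_ge0_le hO (ltW (pos i)) (HM F iF a Aa Ca i)); apply: (OX hO).
  rewrite big_seq; apply: (Oprod hO) => p /simple_pairsP[alpha aD pE].
  by rewrite -(chi_ratio T pE Aa); exact: chiO.
have fO alpha : alpha \in s -> Num.max (chi iF alpha a) (chi iF alpha a)^-1 \in O.
  move=> /sP aS; have [p [_ ->]] := chi_root aS Aa.
  by rewrite maxEle; case: ifP => _; rewrite ?invfM ?invrK; apply: (OM hO) => //;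
    exact: dv_inv_O.
have N1' := N1 s (fun _ H => H).
split; first by rewrite gt_eqF // (lt_le_trans ltr01).
  by rewrite big_seq; apply: (Oprod hO).
apply: (O_ge0_le hO _ _ (O1 hO)); first by rewrite invr_ge0 (le_trans ler01).
by rewrite invf_le1 // (lt_le_trans ltr01).
Qed.

Lemma torus_sym a : A a -> a^T = a.
Proof. by move=> [Sa _]; exact: (torus_symmetric T Sa). Qed.

Lemma K_F_sub k : K_F iF PG k -> G k /\ k *m k^T = 1%:M.
Proof. by case. Qed.

Lemma orthogonal_K_F k : G k -> k *m k^T = 1%:M -> K_F iF PG k.
Proof. by move=> Gk ko; split=> //; exact: (points_det T Gk). Qed.

Lemma cartan_decomposition g : G g -> exists k a k',
  [/\ K_F iF PG k, K_F iF PG k', A a, chamber_ge h Delta iF a & g = k *m a *m k'].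
Proof.
move=> Gg; have [k1 [a [Gk ko Aa Ca E]]] := cartan T hDelta Gg.
have Ga := torus_sub T (proj1 Aa); have au := points_unit T Ga.
have aT := torus_sym Aa; have kT : k1^T *m k1 = 1%:M by exact: mulmx1C.
(* The last factor is forced by the product, and E makes it orthogonal. *)
exists k1^T, a, (invmx a *m k1 *m g); split=> //.
- by apply: orthogonal_K_F; [exact: (pointsT T)|rewrite trmxK].
- apply: orthogonal_K_F; first exact: (pointsM T (pointsM T (pointsV T Ga) Gk) Gg).
  rewrite !trmx_mul trmx_inv aT.
  have -> : invmx a *m k1 *m g *m (g^T *m (k1^T *m invmx a)) =
      invmx a *m (k1 *m (g *m g^T) *m k1^T) *m invmx a by rewrite !mulmxA.
  by rewrite E mulmxA mulVmx // mul1mx mulmxV.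
- by rewrite !mulmxA mulmxK // kT mul1mx.
Qed.

Lemma base_pointE y : base_point iF O PG Delta y <-> X_F iF PG y /\ Omx O y.
Proof.
suff H : X_F iF PG y -> dist_F iF O PG Delta 1%:M y = coset_zero O <-> Omx O y.
  by split=> -[yX]; move: (H yX) => E /E.
move=> [g Gg gE]; rewrite /dist_F (coset_zeroP hO) /delta_F.
set X := [set a | _]; have [a Xa] : exists a, X a.
  have [k [a [k' [Kk Kk' Aa Ca gkak]]]] := cartan_decomposition Gg.
  exists a; split; first exact/A_plusE.
  exists 1%:M, g, k, k'; split; split=> //.
  - exact: (points1 T iF).
  - by rewrite /act_F !mul1mx trmx1.
  - by rewrite invmx1 mul1mx.
(* Whichever a is returned by [xget], its defining conditions give y = u a^2 u^T with u = g1 k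
   orthogonal, so y and a^2 have entries in O simultaneously. *)
have {a Xa} := xgetPex 1%:M (ex_intro _ a Xa); move: (xget _ _) => a.
move=> [/A_plusE[Aa Ca] [g1 [g2 [k [k' [[G1_ G2 E1 E2] [/K_F_sub[Gk ko] /K_F_sub[Gk' ko'] E]]]]]]].
rewrite (N_F_unit Aa Ca).
have yE : y = (g1 *m k) *m (a *m a) *m (g1 *m k)^T.
  have g2E : g2 = g1 *m k *m a *m k'.
    by rewrite -(mulKVmx (points_unit T G1_) g2) E !mulmxA.
  rewrite E2 /act_F mulmx1 g2E trmx_mul [(_ *m a)^T]trmx_mul (torus_sym Aa).
  by rewrite !mulmxA -(mulmxA _ k') ko' mulmx1.
have o1 : g1 *m g1^T = 1%:M by rewrite [RHS]E1 /act_F mulmx1.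
have gko : (g1 *m k) *m (g1 *m k)^T = 1%:M.
  by rewrite trmx_mul mulmxA -(mulmxA g1) ko mulmx1.
have gkO := Omx_orthogonal hO gko; have gkTO := OmxT gkO.
split=> [aO|yO].
  by rewrite yE; apply: (OmxM hO) => //; apply: (OmxM hO) => //; exact: (OmxM hO).
apply: (Omx_torus_sqr Aa).
have -> : a *m a = (g1 *m k)^T *m y *m (g1 *m k).
  have := mulmx1C gko; rewrite yE; move: (g1 *m k) => u uu.
  by rewrite !mulmxA uu mul1mx -!mulmxA uu mulmx1.
by apply: (OmxM hO) => //; exact: (OmxM hO).
Qed.

Lemma T_FE g : T_F iF PG PS g <-> G g /\ forall a, A a -> g *m a = a *m g.
Proof. by rewrite /T_F /centralizer_in /= A_FE. Qed.

Lemma conj_torus_unbounded g : G g -> (forall a, A a -> Omx O (invmx a *m g *m a)) ->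
  forall a, A a -> g *m a = a *m g.
Proof.
move=> Gg gO a Aa; apply: (conj_inj hF_unit) => i j.
rewrite {1 2}(torus_pos_cdiag T Aa) conjMcdiag ?hF_unit // conjMcdiagr ?hF_unit // mulrC.
set x := (hF *m g *m invmx hF) i j; have [->|x0] := eqVneq x 0; first by rewrite !mulr0.
congr (_ * _); apply/eqP; rewrite eq_sym; apply: contraT => aij.
have [_ _ [w wO]] := hO.
(* Conjugation by b multiplies the entry x by b_j / b_i; this choice pushes its absolute value above
   |w|, where w is not in O. *)
have [b Ab Hb] := torus_unbounded T iR (`|w| / `|x|) Aa aij.
case/negP: wO; have := (Omx_conj _).2 (gO b Ab) i j.
have [b0 bi] : 0 < dv hF b 0 j /\ 0 < dv hF b 0 i by have [_ H] := Ab.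
rewrite {1 2}(torus_pos_cdiag T Ab) invmx_cdiag ?hF_unit //; last by move=> k; exact: (torus_neq0 T k (proj1 Ab)).
rewrite conjMcdiagr ?hF_unit // conjMcdiag ?hF_unit // [X in X * _ * _]mxE -/x => xO.
have {}xO := O_norm hO xO.
apply: (O_norm_le hO _ xO); apply: ltW.
rewrite !normrM normfV (gtr0_norm b0) (gtr0_norm bi) -mulrA ltr_pdivlMl //.
rewrite -ltr_pdivrMl ?normr_gt0 //; by rewrite mulrA mulrAC [_ * `|w|]mulrC.
Qed.

Lemma stabilizer_sub g : pointwise_stabilizer iF PG (apartment iF O PG Delta) g ->
  O_points O (T_F iF PG PS) g.
Proof.
move=> [Gg gstab].
have base1 : base_point iF O PG Delta 1%:M.
  apply/base_pointE; split.
    by exists 1%:M; rewrite ?/act_F ?mul1mx ?trmx1 ?mulmx1 //; exact: (points1 T iF).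
  by move=> i j; rewrite mxE; exact: Onat.
(* The point g a.Id lies in the class a.o. Moved back by a^-1 it is the Gram matrix of a^-1 g a, to
   which [Omx_gram] applies. *)
have gO a : A a -> Omx O (invmx a *m g *m a).
  move=> Aa; have au := points_unit T (torus_sub T (proj1 Aa)); have aT := torus_sym Aa.
  have /gstab E : apartment iF O PG Delta (bact a (base_point iF O PG Delta)).
    by exists a; rewrite ?A_FE.
  have : bact g (bact a (base_point iF O PG Delta)) (act_F g (act_F a 1%:M)).
    by exists (act_F a 1%:M) => //; exists 1%:M.
  rewrite E => -[y /base_pointE[_ yO] yE].
  apply: (Omx_gram hO); rewrite (_ : _ *m _ = y) //.
  have -> : y = invmx a *m act_F a y *m (invmx a)^T.
    by rewrite /act_F trmx_inv aT !mulmxA mulVmx // mul1mx mulmxK.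
  by rewrite yE /act_F !trmx_mul trmx_inv aT mulmx1 !mulmxA.
split; last by have := gO _ (torus_pos1 T iF); rewrite invmx1 mul1mx mulmx1.
by apply/T_FE; split=> //; exact: conj_torus_unbounded.
Qed.

(** As g commutes with A, it is enough that g and its inverse map the class o into itself; the
    inverse has entries in O because the determinant is 1. *)
Lemma sub_stabilizer g : O_points O (T_F iF PG PS) g ->
  pointwise_stabilizer iF PG (apartment iF O PG Delta) g.
Proof.
move=> [/T_FE[Gg gA] gO]; split=> // _ [a + <-]; rewrite A_FE => Aa.
have act_base k : G k -> Omx O k -> forall y, base_point iF O PG Delta y ->
    base_point iF O PG Delta (act_F k y).
  move=> Gk kO y /base_pointE[[u Gu_ uE] yO]; apply/base_pointE; split.
    exists (k *m u); first exact: (pointsM T Gk Gu_).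
    by rewrite -uE /act_F trmx_mul !mulmxA.
  by apply: (OmxM hO); [exact: (OmxM hO)|exact: OmxT].
have actM k l y : act_F (F := F) k (act_F l y) = act_F (k *m l) y :> 'M[F]_n.
  by rewrite /act_F trmx_mul !mulmxA.
have gu := points_unit T Gg; rewrite /bact; apply/seteqP; split=> z.
  move=> [_ [y yB <-] <-]; exists (act_F g y); first exact: act_base.
  by rewrite !actM gA.
move=> [y yB <-]; exists (act_F a (act_F (invmx g) y)).
  exists (act_F (invmx g) y) => //; apply: act_base => //; first exact: (pointsV T Gg).
  exact: (Omx_inv hO (points_det T Gg)).
by rewrite !actM gA // -mulmxA mulmxV // mulmx1.
Qed.

Lemma T_F_decomposition : O_points O (T_F iF PG PS) =
  [set a *m m | a in O_points O (A_F iF PS) & m in M_F iF PG PS].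
Proof.
apply/seteqP; split=> [g [/T_FE[Gg gA] gO]|_ [a [+ aO] [m [[Gm mo mdet] mA] <-]]].
  have Aq := gram_torus_pos T Gg gA.
  have [a Aa aq] := torus_pos_sqrt T iR Aq.
  have Ga := torus_sub T (proj1 Aa); have au := points_unit T Ga; have aT := torus_sym Aa.
  have aO : Omx O a.
    apply: (Omx_torus_sqr Aa); rewrite aq; apply: (OmxM hO) => //; exact: OmxT.
  (* Commutation turns a^2 = g^T g into the orthogonality of a^-1 g. *)
  have agE : invmx a *m g = g *m invmx a.
    by rewrite -[RHS](mulKmx au) (mulmxA a) -gA // mulmxK.
  exists a; first by split; rewrite ?A_FE.
  exists (invmx a *m g); last by rewrite mulKVmx.
  split; last first.
    rewrite A_FE => b Ab; rewrite -mulmxA gA // !mulmxA; congr (_ *m _).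
    have /(torus_pos_cdiag T) aE := torus_posV T Aa.
    by rewrite aE (torus_pos_cdiag T Ab) (cdiag_comm hF_unit).
  have Gm : G (invmx a *m g) by exact: (pointsM T (pointsV T Ga) Gg).
  apply: orthogonal_K_F => //; apply: mulmx1C.
  rewrite agE trmx_mul trmx_inv aT mulmxA -(mulmxA (invmx a)) -aq.
  by rewrite !mulmxA mulVmx // mul1mx mulmxV.
rewrite A_FE in mA *; move=> Aa; split.
  apply/T_FE; split; first exact: (pointsM T (torus_sub T (proj1 Aa)) Gm).
  move=> b Ab; rewrite -mulmxA mA // !mulmxA; congr (_ *m _).
  by rewrite (torus_pos_cdiag T Aa) (torus_pos_cdiag T Ab) (cdiag_comm hF_unit).
by apply: (OmxM hO) => //; exact: Omx_orthogonal.
Qed.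

End Stabilizer.

Theorem theorem5p19 (K : rcfType) (R : realType) (F : rcfType)
    (iR : {rmorphism K -> R}) (iF : {rmorphism K -> F})
    (O : {pred F}) (n : nat) (PG PS : seq (mxpol K n))
    (Delta : seq (dual_space (frak_a iR PS)))
    (hO : convex_subring O)
    (hG : connected_semisimple_in_SL PG)
    (hGT : self_adjoint PG)
    (hS : maximal_split_torus PS PG)
    (hST : forall s, geom_points PS s -> s = s^T)
    (hDelta : root_basis (root_system iR PG PS) Delta) :
  pointwise_stabilizer iF PG (apartment iF O PG Delta)
    = O_points O (T_F iF PG PS) /\
  O_points O (T_F iF PG PS)
    = [set a *m m | a in O_points O (A_F iF PS) & m in M_F iF PG PS].
Proof.
have [[_ _ [h hu hd]] _ _] := hS.
have T : split_frame PG PS h by [].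
split; last exact: (T_F_decomposition iR iF hO T).
apply/seteqP; split=> g; first exact: (stabilizer_sub hO T hDelta).
exact: (sub_stabilizer hO T hDelta).
Qed.
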